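(* Let $(q,V)$ be a nondegenerate $n$-dimensional quadratic space over $k$ of anisotropic dimension $n_\circ\le n$. Let $\lambda$ be a partition of $n$ in which even parts occur with even multiplicity, and let $\mathcal{O}_\lambda(k)\subset\mathfrak{so}(q)$ be the set of $k$-rational points of the corresponding algebraic nilpotent orbit. Let $\chi_i$ be the number of odd parts of $\lambda$ whose multiplicity is exactly $i$, and set $\chi_{3+}=\sum_{i\ge 3}\chi_i$. Then the number of $k$-rational orbits under $\mathrm{O}(q)$ in $\mathcal{O}_\lambda(k)$ is $$\mathsf{T}(q)_{\chi_1,\chi_2,\chi_{3+}}=\begin{cases}\frac18\,4^{\chi_1}7^{\chi_2}8^{\chi_{3+}} & \text{if }\chi_{3+}\ge 1;\\[2pt] \frac18\,4^{\chi_1}7^{\chi_2}+(2-n_\circ)2^{\chi_1-2} & \text{if }\chi_{3+}=0,\ \chi_1\ge 1;\\[2pt] \left\lfloor \frac18 7^{\chi_2}\right\rceil+\varepsilon_{n_\circ,\chi_2} & \text{if }\chi_1=\chi_{3+}=0,\end{cases}$$ where $\varepsilon_{n_\circ,\chi_2}=0$ unless either $n_\circ=0$ and $\chi_2$ is even, or $n_\circ=4$ and $\chi_2$ is odd, in which cases $\varepsilon_{n_\circ,\chi_2}=(-1)^{\chi_2}$. The number of $k$-rational orbits in $\mathcal{O}_\lambda(k)$ under $\mathrm{SO}(q)$ is the same, unless $\chi_1=\chi_2=\chi_{3+}=n_\circ=0$, when there are two.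
   Context: $k$ is a local non-archimedean field of residual characteristic $p\ne 2$. The characteristic of $k$ is either zero or greater than $3(h-1)$, where $h$ is the maximal Coxeter number of an irreducible component of the (absolute) root system of the orthogonal group in question. The anisotropic dimension of $q$ is the dimension of its anisotropic kernel. With $M_q$ the matrix of the symmetric bilinear form of $q$: $\mathrm{O}(q)=\{g\in \mathrm{GL}(n,k)\mid {}^tg M_q g=M_q\}$, $\mathrm{SO}(q)$ is its subgroup of elements of determinant $1$, and $\mathfrak{so}(q)=\{X\in\mathfrak{sl}(n,k)\mid {}^tX M_q+M_qX=0\}$, on which these groups act by the adjoint action (conjugation). Nilpotent adjoint orbits of the algebraic group $\mathbf{O}_n$ (over an algebraic closure) are parametrized by partitions $\lambda$ of $n$ in which even parts occur with even multiplicity, the parts being the Jordan block sizes; thus $\mathcal{O}_\lambda(k)$ is the (possibly empty) set of nilpotent elements of $\mathfrak{so}(q)$ whose Jordan block sizes on $V$ are the parts of $\lambda$. $\lfloor x\rceil$ denotes the integer closest to $x$. *)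

(* Defs.v *)
From HB Require Import structures.
From mathcomp Require Import all_boot all_order all_algebra.
From mathcomp Require Import all_classical constructive_ereal.

Set Implicit Arguments.
Unset Strict Implicit.
Unset Printing Implicit Defensive.

Import Order.TTheory GRing.Theory Num.Theory.

Local Open Scope classical_set_scope.
Local Open Scope card_scope.
Local Open Scope ring_scope.

(* A non-archimedean local field: a field complete for a discrete valuation
   with finite residue field.  The valuation [v] is normalized (its value
   group is Z, by [nalf_uniformizer]) and additive, with [v 0 = +oo]; the
   value [-oo] is excluded by the axioms. *)
Record nonarch_local_field (k : fieldType) (v : k -> \bar int) : Prop :=
  NonarchLocalField {
  nalf_eqoo : forall x, v x = +oo%E <-> x = 0;
  nalf_mul : forall x y, v (x * y) = (v x + v y)%E;
  nalf_add : forall x y, (Order.min (v x) (v y) <= v (x + y)%R)%E;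
  nalf_uniformizer : exists t, v t = 1%:E;
  nalf_complete : forall u : nat -> k,
    (forall N : int, exists m0 : nat, forall m m' : nat,
       (m0 <= m)%N -> (m0 <= m')%N -> (N%:E <= v (u m - u m')%R)%E) ->
    exists l : k, forall N : int, exists m0 : nat, forall m : nat,
       (m0 <= m)%N -> (N%:E <= v (u m - l)%R)%E;
  nalf_residue_finite : exists s : seq k, forall x, (0%:E <= v x)%E ->
    exists2 y, y \in s & (0%:E < v (x - y)%R)%E
}.

(* The image of p in the residue field {v >= 0} / {v > 0} is zero. *)
Definition residue_char (k : fieldType) (v : k -> \bar int) (p : nat) : Prop :=
  prime p /\ (0%:E < v p%:R)%E.

(* The maximal Coxeter number of an irreducible component of the absolute root
   system of an orthogonal group in n variables: h(B_m) = 2m for n = 2m+1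
   (B_1 = A_1), h(D_m) = 2m-2 for n = 2m (D_2 = A_1 x A_1, D_3 = A_3).
   For n = 1, 2 the root system is empty and the value is 0. *)
Definition coxeter_SO (n : nat) : nat := if odd n then n.-1 else n.-2.

(* With truncated predecessor, the bound is vacuous for n = 1, 2. *)
Definition char_zero_or_large (k : fieldType) (n : nat) : Prop :=
  [pchar k] =i pred0 \/
  (exists2 l : nat, l \in [pchar k] & (3 * (coxeter_SO n).-1 < l)%N).

Section QuadraticForms.
Variable k : fieldType.

Definition polar n (q : 'cV[k]_n -> k) (x y : 'cV[k]_n) : k :=
  q (x + y) - q x - q y.

Record quadratic_form n (q : 'cV[k]_n -> k) : Prop := QuadraticForm {
  qformZ : forall (a : k) (x : 'cV[k]_n), q (a *: x) = a ^+ 2 * q x;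
  qform_polar : forall y : 'cV[k]_n, scalar (fun x => polar q x y)
}.

(* Normalized so that q x = x^T M_q x. *)
Definition gram n (q : 'cV[k]_n -> k) : 'M[k]_n :=
  \matrix_(i, j) (polar q (delta_mx i 0) (delta_mx j 0) / 2%:R).

Definition nondegenerate_qform n (q : 'cV[k]_n -> k) : Prop := gram q \in unitmx.

Definition anisotropic n (q : 'cV[k]_n -> k) : Prop :=
  forall x, q x = 0 -> x = 0.

Definition isometric n n' (q : 'cV[k]_n -> k) (q' : 'cV[k]_n' -> k) : Prop :=
  exists (P : 'M[k]_(n', n)) (Q : 'M[k]_(n, n')),
    [/\ P *m Q = 1%:M, Q *m P = 1%:M & forall x, q' (P *m x) = q x].

(* The orthogonal sum of q and of m hyperbolic planes (x, y) |-> x y. *)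
Definition add_hyperbolic n (q : 'cV[k]_n -> k) (m : nat)
    (z : 'cV[k]_(n + (m + m))) : k :=
  q (usubmx z)
  + \sum_(i < m) usubmx (dsubmx z) i 0 * dsubmx (dsubmx z) i 0.

(* Witt decomposition: q_an is the anisotropic kernel of q, unique up to
   isometry by Witt's theorem, and n0 is its dimension. *)
Definition anisotropic_dim n (q : 'cV[k]_n -> k) (n0 : nat) : Prop :=
  exists (m : nat) (q_an : 'cV[k]_n0 -> k),
    [/\ quadratic_form q_an, anisotropic q_an &
        isometric q (@add_hyperbolic n0 q_an m)].

Definition O_group n (q : 'cV[k]_n -> k) : set 'M[k]_n :=
  [set g | g \in unitmx /\ g^T *m gram q *m g = gram q].

Definition SO_group n (q : 'cV[k]_n -> k) : set 'M[k]_n :=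
  [set g | O_group q g /\ \det g = 1].

Definition so_algebra n (q : 'cV[k]_n -> k) : set 'M[k]_n :=
  [set X | \tr X = 0 /\ X^T *m gram q + gram q *m X = 0].

Definition jordan_block0 (d : nat) : 'M[k]_d :=
  \matrix_(i, j) (j == i.+1 :> nat)%:R.

(* The nilpotent matrix in Jordan form whose block sizes are the entries
   of lam. *)
Definition jordan_nilp (lam : seq nat) :=
  \mxdiag_(i < size lam) jordan_block0 (nth 0%N lam i).

(* [jordan_nilp lam] has size [sumn lam] only up to a propositional equality,
   so the invertible matrix P below is formally rectangular. *)
Definition jordan_type n (lam : seq nat) (X : 'M[k]_n) : Prop :=
  exists2 P : 'M[k]_(\sum_(i < size lam) nth 0%N lam i, n),
    row_free P && row_full P & similar P X (jordan_nilp lam).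

Definition nilp_orbit_points n (q : 'cV[k]_n -> k) (lam : seq nat) :
    set 'M[k]_n :=
  [set X | so_algebra q X /\ jordan_type lam X].

Definition adj_orbit n (G : set 'M[k]_n) (X : 'M[k]_n) : set 'M[k]_n :=
  [set g *m X *m invmx g | g in G].

Definition adj_orbits n (G S : set 'M[k]_n) : set (set 'M[k]_n) :=
  [set adj_orbit G X | X in S].

End QuadraticForms.

Definition is_partition (n : nat) (lam : seq nat) : Prop :=
  [/\ sorted geq lam, 0%N \notin lam & sumn lam = n].

Definition even_parts_even_mult (lam : seq nat) : Prop :=
  forall d, d \in lam -> ~~ odd d -> ~~ odd (count_mem d lam).

Definition chi (lam : seq nat) (i : nat) : nat :=
  count (fun d => odd d && (count_mem d lam == i)) (undup lam).

(* Multiplicities are bounded by the number of parts. *)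
Definition chi3plus (lam : seq nat) : nat :=
  (\sum_(3 <= i < (size lam).+1) chi lam i)%N.

(* The tie case, rounded up here, never occurs for the numbers 7^c / 8. *)
Definition nearest_int (x : rat) : int := Num.floor (x + 1 / 2%:R).

Definition epsilon (n0 c2 : nat) : int :=
  if ((n0 == 0%N) && ~~ odd c2) || ((n0 == 4%N) && odd c2)
  then (-1) ^+ c2 else 0.

Definition T_count (n0 c1 c2 c3 : nat) : rat :=
  if (1 <= c3)%N then
    1 / 8%:R * 4%:R ^+ c1 * 7%:R ^+ c2 * 8%:R ^+ c3
  else if (1 <= c1)%N then
    1 / 8%:R * 4%:R ^+ c1 * 7%:R ^+ c2
    + (2%:R - n0%:R) * 2%:R ^ (c1%:Z - 2)
  else
    (nearest_int (1 / 8%:R * 7%:R ^+ c2) + epsilon n0 c2)%:~R.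

Definition has_card (U : Type) (A : set U) (x : rat) : Prop :=
  exists2 N : nat, x = N%:R & A #= `I_N.

(* Main.v *)
(* Splitting off cyclic subspaces of maximal height shows that a nilpotent
   X in so(q) is an orthogonal sum of standard pieces: hyperbolic pairs of Jordan
   blocks of even size, and single blocks of odd size d carrying a scalar a.  The
   scalars at a fixed odd d form the Gram matrix of the nondegenerate form induced by
   (x, y) |-> B(x X^(d-1), y) on ker X^d; hence the O(q)-orbits with Jordan
   type lambda correspond to families (q_d), d running over the odd parts, of isometry
   classes of forms of dimension the multiplicity of d such that the sum of the
   (-1)^((d-1)/2) q_d and q have the same class in the Witt group W(k).
   By Hensel's lemma and Springer's theorem W(k) consists of two copies of the Witt
   group of the residue field and has order 16, and a form is determined by its
   dimension and its Witt class, so the orbits are counted by a convolution on W(k).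
   For SO(q): if lambda has an odd part, then -1 on one block of that size is an
   element of determinant -1 in the centralizer of X; otherwise every element of the
   centralizer in O(q) has determinant 1, and the unique O(q)-orbit splits. *)
Require Import Defs.
From HB Require Import structures.
From mathcomp Require Import all_boot all_order all_algebra.
From mathcomp Require Import all_classical constructive_ereal.
From mathcomp Require Import ring zify lra.

Set Implicit Arguments.
Unset Strict Implicit.
Unset Printing Implicit Defensive.

Import Order.TTheory GRing.Theory Num.Theory.
Local Open Scope ring_scope.

(** * Quadratic spaces with an endomorphism *)

(** Form and endomorphism are carried together by [qmod], so that conjugacy under O(q), isometry of
    forms and similarity of matrices are instances of one relation [iso], and a model built from
    standard pieces can be transported to q along an isometry. The arithmetic of k is condensed into
    [square_classes]; what follows is algebra over a field with four square classes. That the Witt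
    class of a form is well defined rests on one fact: removing a hyperbolic plane lowers the
    dimension of a totally isotropic subspace by at most one. The sign (-1)^((d-1)/2) is the middle
    entry of the alternating antidiagonal matrix, the only part of a block of odd size d that
    survives in the Witt group. The numbers 4, 7 and 8 count the Witt classes of forms of dimension
    1, 2 and at least 3; dimension 2 misses the four-dimensional anisotropic class, and powers of
    this defect produce epsilon. *)

Section QuadraticModules.
Variable k : fieldType.

(* Row convention: the form is (x, y) |-> x G y^T and the endomorphism is
   x |-> x E, so that X in so(q) is encoded by E = X^T and G = M_q. *)
Record qmod := QMod { qdim : nat; qend : 'M[k]_qdim; qgram : 'M[k]_qdim }.

(** Mutually inverse rectangular matrices allow spaces whose dimensions are equal only
    propositionally. The rows of P are the images in y of the basis vectors of x. *)
Definition iso (x y : qmod) : Prop :=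
  exists (P : 'M_(qdim x, qdim y)) (Q : 'M_(qdim y, qdim x)),
    [/\ P *m Q = 1%:M, Q *m P = 1%:M, P *m qend y = qend x *m P
      & P *m qgram y *m P^T = qgram x].

Definition osum (x y : qmod) : qmod :=
  QMod (block_mx (qend x) 0 0 (qend y)) (block_mx (qgram x) 0 0 (qgram y)).

Definition ozero : qmod := QMod (0 : 'M_0) 0.

Definition osums : seq qmod -> qmod := foldr osum ozero.

(** With the endomorphism set to zero, [iso] becomes isometry of forms; with the form set to zero,
    as in [forgetG], it becomes similarity of matrices. *)
Definition forgetE (x : qmod) : qmod := QMod 0 (qgram x).
Definition forgetG (x : qmod) : qmod := QMod (qend x) 0.
Definition scaleG (t : k) (x : qmod) : qmod := QMod (qend x) (t *: qgram x).

Lemma iso_refl x : iso x x.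
Proof.
by exists 1%:M, 1%:M; rewrite trmx1 !mulmx1 !mul1mx.
Qed.

Lemma iso_sym x y : iso x y -> iso y x.
Proof.
case=> P [Q [PQ QP PE PG]]; exists Q, P; split=> //.
  by rewrite -[LHS]mulmx1 -PQ !mulmxA -(mulmxA Q) -PE mulmxA QP mul1mx.
rewrite -PG !mulmxA QP mul1mx -mulmxA -trmx_mul QP.
by rewrite trmx1 mulmx1.
Qed.

Lemma iso_trans y x z : iso x y -> iso y z -> iso x z.
Proof.
case=> P [Q [PQ QP PE PG]] [P' [Q' [PQ' QP' PE' PG']]].
exists (P *m P'), (Q' *m Q); split.
- by rewrite mulmxA -(mulmxA P) PQ' mulmx1.
- by rewrite mulmxA -(mulmxA Q') QP mulmx1.
- by rewrite -mulmxA PE' !mulmxA PE.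
- by rewrite trmx_mul -PG -PG' !mulmxA.
Qed.

Lemma right_inverse_dim_leq m n (P : 'M[k]_(m, n)) (Q : 'M_(n, m)) :
  P *m Q = 1%:M -> (m <= n)%N.
Proof.
move=> PQ; rewrite -(mxrank1 k m) -PQ.
exact: leq_trans (mxrankM_maxl _ _) (rank_leq_col _).
Qed.

Lemma iso_dim x y : iso x y -> qdim x = qdim y.
Proof.
case=> P [Q [/right_inverse_dim_leq PQ /right_inverse_dim_leq QP _ _]].
by apply/eqP; rewrite eqn_leq PQ QP.
Qed.

Lemma iso_osum x x' y y' : iso x x' -> iso y y' -> iso (osum x y) (osum x' y').
Proof.
case=> P [Q [PQ QP PE PG]] [P' [Q' [PQ' QP' PE' PG']]].
exists (block_mx P 0 0 P'), (block_mx Q 0 0 Q'); rewrite /=.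
rewrite !mulmx_block tr_block_mx !mulmx_block !(mulmx0, mul0mx, addr0, add0r, trmx0).
by rewrite PQ PQ' QP QP' PE PE' PG PG' -!scalar_mx_block.
Qed.

Lemma osumC x y : iso (osum x y) (osum y x).
Proof.
exists (block_mx 0 1%:M 1%:M 0), (block_mx 0 1%:M 1%:M 0); rewrite /=.
rewrite !mulmx_block tr_block_mx !mulmx_block.
rewrite !(mulmx0, mul0mx, addr0, add0r, trmx0, trmx1, mulmx1, mul1mx).
by rewrite -!scalar_mx_block.
Qed.

Lemma iso_cast m n (e : m = n) (A M : 'M[k]_m) :
  iso (QMod A M) (QMod (castmx (e, e) A) (castmx (e, e) M)).
Proof. by case: n / e; exact: iso_refl. Qed.

Lemma block_diag_mxA m1 m2 m3 (A : 'M[k]_m1) (B : 'M_m2) (C : 'M_m3) :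
  castmx (addnA _ _ _, addnA _ _ _) (block_mx A 0 0 (block_mx B 0 0 C)) =
  block_mx (block_mx A 0 0 B) 0 0 C.
Proof.
have := @block_mxA k m1 m2 m3 m1 m2 m3 A 0 0 0 B 0 0 0 C.
by rewrite /= !row_mx0 !col_mx0 => ->; rewrite castmx_comp castmx_id.
Qed.

Lemma osumA x y z : iso (osum x (osum y z)) (osum (osum x y) z).
Proof.
apply: iso_trans (iso_cast (addnA _ _ _) _ _) _; rewrite /osum /=.
by rewrite !block_diag_mxA; apply: iso_refl.
Qed.

Lemma osum0x x : iso (osum (ozero) x) x.
Proof.
exists (col_mx 0 1%:M), (row_mx 0 1%:M); rewrite /=; split.
- rewrite mul_col_row !mul0mx !mulmx0 mulmx1 .
  rewrite [RHS](@scalar_mx_block _ 0 _ 1).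
  by congr (block_mx _ _ _ _); rewrite flatmx0.
- by rewrite mul_row_col mul0mx add0r mulmx1.
- by rewrite mul_col_mx mul_block_col !(mul0mx, mulmx1, mul1mx, mulmx0) !add0r.
- rewrite tr_col_mx mul_col_mx mul_col_row trmx0 trmx1.
  by rewrite !(mul0mx, mulmx0, mulmx1, mul1mx).
Qed.

Lemma osumx0 x : iso (osum x (ozero)) x.
Proof. exact: iso_trans (osumC _ _) (osum0x _). Qed.

Lemma iso_osums_cat s t : iso (osums (s ++ t)) (osum (osums s) (osums t)).
Proof.
elim: s => [|x s IHs] /=; first exact/iso_sym/osum0x.
exact: iso_trans (iso_osum (iso_refl _) IHs) (osumA _ _ _).
Qed.

Lemma osumAC x y z : iso (osum x (osum y z)) (osum y (osum x z)).
Proof.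
apply: iso_trans (osumA _ _ _) _.
apply: iso_trans (iso_osum (osumC _ _) (iso_refl _)) _.
exact/iso_sym/osumA.
Qed.

Lemma scaleG_osum t x y : scaleG t (osum x y) = osum (scaleG t x) (scaleG t y).
Proof. by rewrite /scaleG /osum /= scale_block_mx !scaler0. Qed.

Lemma forgetE_osum x y : forgetE (osum x y) = osum (forgetE x) (forgetE y).
Proof. by rewrite /forgetE /osum /= block_mx0. Qed.

Lemma forgetG_osum x y : forgetG (osum x y) = osum (forgetG x) (forgetG y).
Proof. by rewrite /forgetG /osum /= block_mx0. Qed.

Lemma iso_scaleG t x y : iso x y -> iso (scaleG t x) (scaleG t y).
Proof.
case=> P [Q [PQ QP PE PG]]; exists P, Q; split=> //=.
by rewrite -scalemxAr -scalemxAl PG.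
Qed.

Lemma iso_forgetE x y : iso x y -> iso (forgetE x) (forgetE y).
Proof.
by case=> P [Q [PQ QP _ PG]]; exists P, Q; split=> //=; rewrite mul0mx mulmx0.
Qed.

Lemma iso_forgetG x y : iso x y -> iso (forgetG x) (forgetG y).
Proof.
by case=> P [Q [PQ QP PE _]]; exists P, Q; split=> //=; rewrite mulmx0 mul0mx.
Qed.

(* With the sign (-1)^j the block J_d is skew-adjoint for T_d: J T = - T J^T. *)
Definition alt_antidiag d : 'M[k]_d :=
  \matrix_(i, j) ((-1) ^+ j *+ ((i + j).+1 == d)%N).

Definition odd_piece d (a : k) := QMod (jordan_block0 k d) (a *: alt_antidiag d).

Definition even_piece d :=
  QMod (block_mx (jordan_block0 k d) 0 0 (jordan_block0 k d))
       (block_mx 0 (alt_antidiag d) (alt_antidiag d)^T 0).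

(* The coefficient of a piece of even size is ignored. *)
Definition piece (p : nat * k) : qmod :=
  if odd p.1 then odd_piece p.1 p.2 else even_piece p.1.

Definition nform (l : seq (nat * k)) : qmod := osums (map piece l).

Lemma nform_cat l1 l2 : iso (nform (l1 ++ l2)) (osum (nform l1) (nform l2)).
Proof. by rewrite /nform map_cat; apply: iso_osums_cat. Qed.

Lemma nform_perm l1 l2 : perm_eq l1 l2 -> iso (nform l1) (nform l2).
Proof.
move=> p12; move: p12 (iso_refl (nform l1)).
apply: (@catCA_perm_ind _ (fun s => iso (nform l1) (nform s))) => s1 s2 s3 IH.
apply: iso_trans IH _; apply: iso_trans (nform_cat _ _) _.
apply: iso_trans (iso_osum (iso_refl _) (nform_cat _ _)) _.
apply: iso_trans (osumAC _ _ _) _; apply: iso_sym.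
apply: iso_trans (nform_cat _ _) _.
exact: iso_osum (iso_refl _) (nform_cat _ _).
Qed.

End QuadraticModules.

(** * Normal form of nilpotent skew-adjoint endomorphisms *)

Section NormalForm.
Variable k : fieldType.
Implicit Types x y z : qmod k.

Definition skew_nilpotent x : Prop :=
  [/\ (qgram x)^T = qgram x, qgram x \in unitmx,
      qend x *m qgram x = - (qgram x *m (qend x)^T)
    & exists d, qend x ^+ d = 0].

Lemma rect_inverse m n (P : 'M[k]_(m, n)) :
  row_free P -> m = n -> exists Q : 'M_(n, m), P *m Q = 1%:M /\ Q *m P = 1%:M.
Proof.
move=> fP e; have fullP : row_full P by rewrite /row_full (eqP fP) e.
have [Q PQ] := row_freeP fP; have [Q' QP] := row_fullP fullP.
exists Q; split=> //; suff <- : Q' = Q by [].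
by rewrite -[Q']mulmx1 -PQ mulmxA QP mul1mx.
Qed.

Lemma unitmx_rect m n (P : 'M[k]_(m, n)) (Q : 'M_(n, m)) (A : 'M_n) :
  P *m Q = 1%:M -> Q *m P = 1%:M -> A \in unitmx -> P *m A *m P^T \in unitmx.
Proof.
move=> PQ QP uA.
apply: (proj1 (@mulmx1_unit _ _ _ (Q^T *m invmx A *m Q) _)).
rewrite -!mulmxA (mulmxA P^T) -trmx_mul QP trmx1 mul1mx (mulmxA A) mulmxV //.
by rewrite mul1mx.
Qed.

Lemma intertwine_exp m n (P : 'M[k]_(m, n)) (A : 'M_m) (B : 'M_n) d :
  P *m B = A *m P -> P *m B ^+ d = A ^+ d *m P.
Proof.
move=> PBA; elim: d => [|d IHd]; first by rewrite !expr0 mulmx1 mul1mx.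
by rewrite !exprSr -mulmxE mulmxA IHd -mulmxA PBA mulmxA.
Qed.

Lemma iso_skew_nilpotent x y : iso x y -> skew_nilpotent y -> skew_nilpotent x.
Proof.
case=> P [Q [PQ QP PE PG]] [sy uy ky [d dy]]; split.
- by rewrite -PG !trmx_mul trmxK sy mulmxA.
- by rewrite -PG; apply: unitmx_rect PQ QP uy.
- rewrite -PG -!mulmxA -trmx_mul -PE trmx_mul !mulmxA -PE.
  by rewrite -(mulmxA P) ky mulmxN mulNmx !mulmxA.
- exists d; rewrite -[LHS]mulmx1 -PQ mulmxA -(intertwine_exp _ PE).
  by rewrite dy mulmx0 mul0mx.
Qed.

Lemma split_off x r (U : 'M_(r, qdim x)) (Y1 G : 'M_r) :
  skew_nilpotent x -> U *m qend x = Y1 *m U -> U *m qgram x *m U^T = G ->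
  G \in unitmx ->
  exists y, skew_nilpotent y /\ iso x (osum (QMod Y1 G) y).
Proof.
case: x U => n Y M /= U [/= sM uM kM [d dY]] UY UG uG.
set C := M *m U^T; have UC : U *m C = G by rewrite /C mulmxA.
have rC : \rank C = r.
  apply/eqP; rewrite eqn_leq rank_leq_col /= -[X in (X <= _)%N](mxrank_unit uG).
  by rewrite -UC mxrankM_maxr.
have [W fW eW] : exists2 W : 'M_(\rank (kermx C), n),
    row_free W & (W :=: kermx C)%MS.
  by exists (row_base (kermx C)); [apply: row_base_free | apply: eq_row_base].
have WC : W *m C = 0 by apply/sub_kermxP; rewrite eW.
have rW : (r + \rank (kermx C))%N = n.
  by rewrite mxrank_ker rC subnKC // -rC rank_leq_row.
pose P := col_mx U W.
have fP : row_free P.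
  rewrite -kermx_eq0 -submx0; apply/rV_subP => w /sub_kermxP.
  rewrite -[w]hsubmxK; set a := lsubmx w; set b := rsubmx w.
  rewrite mul_row_col => e.
  have a0 : a = 0.
    have : (a *m U + b *m W) *m C = 0 by rewrite e mul0mx.
    rewrite mulmxDl -!mulmxA UC WC mulmx0 addr0 => aG.
    by rewrite -[a]mulmx1 -(mulmxV uG) mulmxA aG mul0mx.
  move: e; rewrite a0 mul0mx add0r => bW.
  have /row_freeP[W' WW'] := fW.
  by rewrite -[b]mulmx1 -WW' mulmxA bW mul0mx row_mx0 sub0mx.
have [Q [PQ QP]] := rect_inverse fP rW.
(* W Y M U^T = - W M (U Y)^T = - W M U^T Y1^T = 0. *)
have WYC : (W *m Y <= kermx C)%MS.
  apply/sub_kermxP; rewrite /C -!mulmxA (mulmxA Y) kM mulNmx -mulmxA -trmx_mul.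
  rewrite UY trmx_mul !mulmxN !mulmxA -(mulmxA W) -/C WC mul0mx.
  by rewrite oppr0.
have [Y2 WY] : exists Y2, W *m Y = Y2 *m W.
  by apply/submxP; rewrite eW.
pose M2 := W *m M *m W^T.
have CtW : U *m M *m W^T = 0.
  by apply: trmx_inj; rewrite !trmx_mul trmxK sM -/C WC trmx0.
have PM : P *m M *m P^T = block_mx G 0 0 M2.
  by rewrite /P tr_col_mx mul_col_mx mul_col_row UG CtW -[W *m M *m U^T]mulmxA WC.
have uM2 : M2 \in unitmx.
  have := unitmx_rect PQ QP uM; rewrite PM !unitmxE det_ublock.
  by rewrite unitrM => /andP[].
have isox : iso (QMod Y M) (osum (QMod Y1 G) (QMod Y2 M2)).
  apply: iso_sym; exists P, Q; split=> //=.
  by rewrite /P mul_col_mx UY WY mul_block_col !mul0mx addr0 add0r.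
exists (QMod Y2 M2); split=> //; split=> //=.
- by rewrite /M2 !trmx_mul trmxK sM mulmxA.
- rewrite /M2 !mulmxA -WY -(mulmxA W) kM mulmxN mulNmx; congr (- _).
  by rewrite -!mulmxA -!trmx_mul WY.
- exists d; have /row_freeP[W' WW'] := fW.
  by rewrite -[LHS]mulmx1 -WW' mulmxA -(intertwine_exp _ WY) dY mulmx0 mul0mx.
Qed.

Lemma mx_entry_rows m n p (A : 'M[k]_(m, n)) (C : 'M_n) (B : 'M_(p, n)) i j :
  (A *m C *m B^T) i j = (row i A *m C *m (row j B)^T) 0 0.
Proof. by rewrite -row_mul !mxE; apply: eq_bigr => l _; rewrite !mxE. Qed.

(** * Cyclic subspaces and their Gram matrices *)

Section Cyclic.
Variables (n : nat) (Y M : 'M[k]_n).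
Hypotheses (sM : M^T = M) (kM : Y *m M = - (M *m Y^T)).

(** Powers of Y cross the form up to sign, so the Gram matrix between two cyclic subspaces depends
    on this one sequence in m. *)
Definition bform (u w : 'rV[k]_n) m : k := (u *m Y ^+ m *m M *m w^T) 0 0.

Lemma skew_exp j : M *m (Y ^+ j)^T = (-1) ^+ j *: (Y ^+ j *m M).
Proof.
elim: j => [|j IHj]; first by rewrite !expr0 trmx1 mulmx1 mul1mx scale1r.
rewrite [Y ^+ j.+1]exprS -mulmxE trmx_mul mulmxA IHj -scalemxAl -mulmxA.
rewrite -[M *m Y^T]opprK -kM mulmxN mulmxA exprS mulN1r scaleNr scalerN.
by rewrite (_ : Y ^+ j *m Y = Y *m Y ^+ j) // mulmxE -exprS -exprSr.
Qed.

Lemma bform_shiftl u w i m : bform (u *m Y ^+ i) w m = bform u w (i + m).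
Proof. by rewrite /bform exprD -mulmxE !mulmxA. Qed.

Lemma bform_shiftr u w j m :
  bform u (w *m Y ^+ j) m = (-1) ^+ j * bform u w (m + j).
Proof.
rewrite /bform trmx_mul mulmxA -(mulmxA _ M) skew_exp exprD -mulmxE.
by rewrite -scalemxAr -scalemxAl !mxE !mulmxA.
Qed.

Lemma bform_sym u w m : bform u w m = (-1) ^+ m * bform w u m.
Proof.
rewrite /bform -[in LHS](trmxK (u *m _ *m _ *m _)) mxE !trmx_mul trmxK sM.
by rewrite (mulmxA M) skew_exp -scalemxAl -scalemxAr mxE !mulmxA.
Qed.

Lemma bformDl u u' w m : bform (u + u') w m = bform u w m + bform u' w m.
Proof. by rewrite /bform !mulmxDl mxE. Qed.

Lemma bformDr u w w' m : bform u (w + w') m = bform u w m + bform u w' m.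
Proof. by rewrite /bform linearD /= mulmxDr mxE. Qed.

Lemma bformZl c u w m : bform (c *: u) w m = c * bform u w m.
Proof. by rewrite /bform -!scalemxAl mxE. Qed.

Lemma bformZr c u w m : bform u (c *: w) m = c * bform u w m.
Proof. by rewrite /bform linearZ /= -scalemxAr mxE. Qed.

Variable d : nat.
Hypothesis Yd : Y ^+ d = 0.

Lemma bform_large u w m : (d <= m)%N -> bform u w m = 0.
Proof.
by move=> /subnKC <-; rewrite /bform exprD Yd mul0r mulmx0 !mul0mx mxE.
Qed.

(** The coefficient 1 + (-1)^m is 2 for even m and 0 for odd m: only even m can be corrected this
    way, and odd m vanish by [bform_alt0]. The last term is zero as soon as m + 2 e reaches d. *)
Lemma bform_adjust u w c e m :
  let u' := u + c *: (w *m Y ^+ e) in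
  bform u' u' m = bform u u m
     + c * (-1) ^+ e * (1 + (-1) ^+ m) * bform u w (m + e)
     + c ^+ 2 * (-1) ^+ e * bform w w (m + e + e).
Proof.
rewrite /= bformDl !bformDr !bformZl !bformZr !bform_shiftl !bform_shiftr.
rewrite (bform_sym w u) (addnC e m) exprD; ring.
Qed.

Definition cyclic_rows u : 'M_(d, n) := \matrix_(i < d) (u *m Y ^+ i).

Lemma cyclic_rows_end u : cyclic_rows u *m Y = jordan_block0 k d *m cyclic_rows u.
Proof.
apply/row_matrixP => i; rewrite !row_mul rowK -mulmxA.
have -> : Y ^+ i *m Y = Y ^+ i.+1 by rewrite exprSr.
rewrite [RHS]mulmx_sum_row.
have [lt_id|] := ltnP i.+1 d.
  rewrite (bigD1 (Ordinal lt_id)) //= rowK !mxE eqxx scale1r.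
  rewrite big1 ?addr0 // => j ne; rewrite !mxE.
  by rewrite -(inj_eq val_inj) /= in ne; rewrite (negPf ne) scale0r.
move=> ge_id; have -> : i.+1 = d by apply/eqP; rewrite eqn_leq ltn_ord.
rewrite Yd mulmx0.
rewrite big1 // => j _; rewrite !mxE.
by rewrite (ltn_eqF (leq_trans (ltn_ord j) ge_id)) scale0r.
Qed.

Lemma cyclic_rows_gram u w i j :
  (cyclic_rows u *m M *m (cyclic_rows w)^T) i j = (-1) ^+ j * bform u w (i + j).
Proof.
have E (v v' : 'rV_n) : (v *m M *m v'^T) 0 0 = bform v v' 0 by rewrite /bform expr0 mulmx1.
by rewrite mx_entry_rows !rowK E bform_shiftl bform_shiftr addn0.
Qed.

Hypothesis two_neq0 : (2%:R : k) != 0.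
Hypothesis d_gt0 : (0 < d)%N.

Lemma bform_alt0 u m : odd m -> bform u u m = 0.
Proof.
move=> om; have := bform_sym u u m; rewrite -signr_odd om expr1 mulN1r => e.
apply/eqP; rewrite -(mulrI_eq0 _ (mulfI two_neq0)).
by rewrite mulr_natl mulr2n {1}e addNr.
Qed.

(** Descending elimination: adding a multiple of w Y^e with m0 + e = d - 1 kills the value at m0 and
    leaves all larger exponents unchanged. *)
Lemma odd_cyclic_vector u a : odd d -> bform u u d.-1 = a -> a != 0 ->
  exists w, forall m, (m < d)%N -> bform w w m = a *+ (m.+1 == d).
Proof.
move=> od ua a0.
suff H t : exists w, bform w w d.-1 = a /\ forall m, (d.-1 - t <= m)%N -> (m < d.-1)%N -> bform w w m = 0.
  have [w [wa w0]] := H d.-1; exists w => m lt_md.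
  have [e|ne] := eqVneq m.+1 d; first by rewrite -e /= in wa *.
  by rewrite w0 ?subnn //; lia.
elim: t => [|t [w [wa w0]]]; first by exists u; split=> // m; lia.
have [le_dt|lt_td] := leqP d.-1 t.
  by exists w; split=> // m _; apply: w0; lia.
pose m0 := (d.-1 - t.+1)%N; have [om0|em0] := boolP (odd m0).
  exists w; split=> // m h1 h2; have [->|ne] := eqVneq m m0.
    exact: bform_alt0.
  by apply: w0 => //; rewrite /m0 in ne; lia.
(* As d is odd and m0 even, e is even, and c solves [bform w w m0] + 2 c a = 0. *)
pose c := - bform w w m0 / (2%:R * a); pose e := t.+1.
exists (w + c *: (w *m Y ^+ e)); split=> [|m h1 h2].
  rewrite bform_adjust wa (@bform_large _ _ (d.-1 + e)) ?(@bform_large _ _ (_ + e + e)).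
  - by rewrite !mulr0 !addr0.
  - by rewrite /e; lia.
  - by rewrite /e; lia.
rewrite bform_adjust (@bform_large _ _ (m + e + e)) /e; last by rewrite /e; lia.
rewrite mulr0 addr0; have [->|ne] := eqVneq m m0; last first.
  rewrite w0 ?bform_large ?mulr0 ?addr0 //; rewrite /m0 in ne; lia.
have -> : (m0 + t.+1)%N = d.-1 by rewrite /m0; lia.
rewrite -!(signr_odd _ t.+1) -!(signr_odd _ m0) (negPf em0) wa.
have -> : odd t.+1 = false by move: em0 od; rewrite /m0; lia.
rewrite expr0 /c; field.
by rewrite a0 two_neq0.
Qed.

(** For even d the top value of u against itself vanishes, so the elimination runs along a second
    vector w that pairs with u at the top exponent. *)
Lemma even_isotropic_vector u w b : ~~ odd d -> bform u w d.-1 = b -> b != 0 ->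
  exists u', bform u' w d.-1 = b /\ forall m, bform u' u' m = 0.
Proof.
move=> ed ub b0.
suff H t : exists u', bform u' w d.-1 = b /\ forall m, (d - t <= m)%N -> bform u' u' m = 0.
  have [u' [wa w0]] := H d; exists u'; split=> // m.
  by rewrite w0 ?subnn.
elim: t => [|t [v [vb v0]]].
  by exists u; split=> // m; rewrite subn0; apply: bform_large.
have [le_dt|lt_td] := leqP d t.
  by exists v; split=> // m _; apply: v0; lia.
pose m0 := (d - t.+1)%N; have [om0|em0] := boolP (odd m0).
  exists v; split=> // m h1; have [->|ne] := eqVneq m m0.
    exact: bform_alt0.
  by apply: v0 => //; rewrite /m0 in ne; lia.
(* Here e is odd whenever m0 is even, so the correction at m0 is - 2 c b; hence no minus sign in
   c. *)
pose c := bform v v m0 / (2%:R * b); pose e := t.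
have t0 : (0 < t)%N by move: em0 ed; rewrite /m0; lia.
exists (v + c *: (w *m Y ^+ e)); split=> [|m h1].
  rewrite bformDl vb bformZl bform_shiftl bform_large ?mulr0 ?addr0 // /e; lia.
rewrite bform_adjust (@bform_large _ _ (m + e + e)) /e; last by rewrite /e; lia.
rewrite mulr0 addr0; have [->|ne] := eqVneq m m0; last first.
  rewrite v0 ?bform_large ?mulr0 ?addr0 //; rewrite /m0 in ne; lia.
have -> : (m0 + t)%N = d.-1 by rewrite /m0; lia.
rewrite -!(signr_odd _ t) -!(signr_odd _ m0) (negPf em0) vb.
have -> : odd t by move: em0 ed; rewrite /m0; lia.
rewrite expr0 expr1 /c; field.
by rewrite b0 two_neq0.
Qed.

(** Each correction adds a multiple of the vector times a power of Y; it stays in a totally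
    isotropic cyclic span, so isotropy survives while the pairing with w is normalized. *)
Lemma dual_cyclic_vector u w b : bform u w d.-1 = b -> b != 0 ->
  (forall m, bform u u m = 0) ->
  exists u', (forall m, (m < d)%N -> bform u' w m = (m.+1 == d)%:R) /\ forall m, bform u' u' m = 0.
Proof.
move=> ub b0 u0.
suff H t : exists u', [/\ bform u' w d.-1 = b,
    forall m, (d.-1 - t <= m)%N -> (m < d.-1)%N -> bform u' w m = 0
    & forall m, bform u' u' m = 0].
  have [u' [wa w0 z0]] := H d.-1; exists (b^-1 *: u'); split=> m => [lt_md|].
    rewrite bformZl; have [e|ne] := eqVneq m.+1 d.
      by rewrite -e /= in wa; rewrite wa mulVf.
    by rewrite w0 ?mulr0 ?subnn //; lia.
  by rewrite bformZl bformZr z0 !mulr0.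
elim: t => [|t [v [vb v0 z0]]]; first by exists u; split=> // m; lia.
have [le_dt|lt_td] := leqP d.-1 t.
  by exists v; split=> // m _; apply: v0; lia.
pose m0 := (d.-1 - t.+1)%N; pose c := - bform v w m0 / b.
exists (v + c *: (v *m Y ^+ t.+1)); split=> [|m h1 h2|m].
- rewrite bformDl vb bformZl bform_shiftl bform_large ?mulr0 ?addr0 //; lia.
- rewrite bformDl bformZl bform_shiftl.
  have [->|ne] := eqVneq m m0; last first.
    by rewrite v0 ?bform_large ?mulr0 ?addr0 //; rewrite /m0 in ne; lia.
  have -> : (t.+1 + m0)%N = d.-1 by rewrite /m0; lia.
  by rewrite vb /c divfK // addrN.
- by rewrite bform_adjust !z0 !mulr0 !addr0.
Qed.
End Cyclic.

Lemma symmetric_nonzero_value n (S : 'M[k]_n) : (2%:R : k) != 0 ->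
  S^T = S -> S != 0 -> exists u : 'rV_n, (u *m S *m u^T) 0 0 != 0.
Proof.
move=> two0 sS S0; case: (boolP [exists i, exists j, S i j != 0]); last first.
  move=> h; case/eqP: S0; apply/matrixP => i j; rewrite mxE; apply/eqP.
  by apply: contraNT h => h; apply/existsP; exists i; apply/existsP; exists j.
case/existsP=> i /existsP[j Sij].
have E a b : ((delta_mx 0 a : 'rV_n) *m S *m (delta_mx 0 b : 'rV_n)^T) 0 0 = S a b.
  by rewrite -rowE trmx_delta -colE !mxE.
case: (eqVneq (S i i) 0) => [ii|]; last by exists (delta_mx 0 i); rewrite E.
case: (eqVneq (S j j) 0) => [jj|]; last by exists (delta_mx 0 j); rewrite E.
exists (delta_mx 0 i + delta_mx 0 j); rewrite linearD /= !mulmxDl !mulmxDr.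
have F (A B : 'M[k]_1) : (A + B) 0 0 = A 0 0 + B 0 0 by rewrite mxE.
rewrite !F !E ii jj add0r addr0 -[in S j i]sS mxE -mulr2n -mulr_natl mulf_neq0 //.
Qed.

Lemma nonzero_value n (S : 'M[k]_n) : S != 0 ->
  exists u w : 'rV_n, (u *m S *m w^T) 0 0 != 0.
Proof.
move=> S0; case: (boolP [exists i, exists j, S i j != 0]); last first.
  move=> h; case/eqP: S0; apply/matrixP => i j; rewrite mxE; apply/eqP.
  by apply: contraNT h => h; apply/existsP; exists i; apply/existsP; exists j.
case/existsP=> i /existsP[j Sij]; exists (delta_mx 0 i), (delta_mx 0 j).
by rewrite -rowE trmx_delta -colE !mxE.
Qed.

Lemma alt_antidiag_unit d : alt_antidiag k d \in unitmx.
Proof.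
apply: (proj1 (mulmx1_unit (_ : _ *m (alt_antidiag k d)^T = 1%:M))).
apply/matrixP => i j; rewrite !mxE (bigD1 (rev_ord i)) //= !mxE big1 ?addr0; last first.
  move=> l ne; rewrite !mxE; case: eqP => [e|]; last by rewrite mul0r.
  case/eqP: ne; apply: val_inj => /=; have := ltn_ord i; lia.
have := ltn_ord i; have := ltn_ord j => lj li.
have -> : ((i + (d - i.+1)).+1 == d) by lia.
have -> : ((j + (d - i.+1)).+1 == d) = (i == j) by rewrite -(inj_eq val_inj) /=; lia.
by case: eqP => _; rewrite ?mulr0 // !mulr1n -signr_odd mulr_sign -signr_odd; case: odd; rewrite ?opprK.
Qed.

Definition valid_pieces (l : seq (nat * k)) : bool :=
  all (fun p => (0 < p.1)%N && (p.2 != 0)) l.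

Lemma normal_form_exists x : (2%:R : k) != 0 -> skew_nilpotent x ->
  exists l, valid_pieces l /\ iso x (nform l).
Proof.
move=> two0; have [N] := ubnP (qdim x); elim: N x => // N IHN x ltxN gx.
have [x0|x_gt0] := posnP (qdim x).
  exists [::]; split=> //; case: x x0 {ltxN gx} => n Y M /= e.
  move: Y M; rewrite e => Y M; rewrite (flatmx0 Y) (flatmx0 M); exact: iso_refl.
have [sM uM kM nilY] := gx.
have exd : exists m, qend x ^+ m == 0 by case: nilY => m /eqP; exists m.
case: (ex_minnP exd) => d /eqP Yd d_min.
have d_gt0 : (0 < d)%N.
  case: d Yd {d_min} => // /eqP; rewrite expr0 -mxrank_eq0 mxrank1 => /eqP e.
  by rewrite e in x_gt0.
(* d is the nilpotency index, so S is nonzero; it is symmetric for odd d and skew for even d. *)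
pose S := qend x ^+ d.-1 *m qgram x.
have S0 : S != 0.
  apply: contraTneq (leqnn d) => e; rewrite -ltnNge -[X in (_ < X)%N](prednK d_gt0).
  rewrite ltnS; apply: contraTT d_gt0 => h; rewrite -leqNgt.
  suff /eqP /d_min : qend x ^+ d.-1 = 0 by lia.
  by rewrite -[LHS]mulmx1 -(mulmxV uM) mulmxA -/S e mul0mx.
have step r (U : 'M_(r, qdim x)) Y1 G p : U *m qend x = Y1 *m U ->
    U *m qgram x *m U^T = G -> G \in unitmx -> (0 < r)%N ->
    piece p = QMod Y1 G -> (0 < p.1)%N -> p.2 != 0 ->
    exists l, valid_pieces l /\ iso x (nform l).
  move=> UY UG uG r0 ep p1 p2; have [y [gy xy]] := split_off gx UY UG uG.
  have dy : (qdim y < N)%N.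
    by move: (iso_dim xy) ltxN => /= ->; move: r0; lia.
  have [l [al yl]] := IHN y dy gy; exists (p :: l); rewrite /= p1 p2 al; split=> //.
  by apply: iso_trans xy _; rewrite /nform /= ep; apply: iso_osum (iso_refl _) yl.
have [od|ed] := boolP (odd d).
  have sS : S^T = S.
    rewrite /S trmx_mul sM (skew_exp kM) -signr_odd.
    by rewrite (_ : odd d.-1 = false) ?scale1r //; move: od; case: (d) => //= m /negPf.
  have [u ua] := symmetric_nonzero_value two0 sS S0.
  have [|w wa] := odd_cyclic_vector sM kM Yd two0 d_gt0 od (erefl (bform (qend x) (qgram x) u u d.-1)).
    by rewrite /bform -(mulmxA u).
  set a := bform _ _ u u _ in wa.
  have a0 : a != 0 by rewrite /a /bform -(mulmxA u).
  have G : cyclic_rows (qend x) d w *m qgram x *m (cyclic_rows (qend x) d w)^T =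
           a *: alt_antidiag k d.
    apply/matrixP => i j; rewrite (cyclic_rows_gram kM) !mxE.
    have [lt_ij|] := ltnP (i + j)%N d; first by rewrite wa // !mulrnAr mulrC.
    by move=> h; rewrite (bform_large _ Yd) // mulr0 [_ == d](_ : _ = false) ?mulr0 //; lia.
  apply: (step _ _ _ _ (d, a) (cyclic_rows_end Yd w) G) => //.
    by rewrite unitmxZ ?unitfE // alt_antidiag_unit.
  by rewrite /piece /= od.
(* Even d: w0 is made isotropic against u0, then u0 against the new w, and the result is made dual
   to w; the two cyclic bases then have the Gram matrix of [even_piece]. *)
have [u0 [w0 b0]] := nonzero_value S0.
set b := (_ *m _) 0 0 in b0.
have bE : bform (qend x) (qgram x) u0 w0 d.-1 = b by rewrite /bform -(mulmxA u0).
have bE' : bform (qend x) (qgram x) w0 u0 d.-1 = - b.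
  rewrite (bform_sym sM kM) bE -signr_odd (_ : odd d.-1) ?expr1 ?mulN1r //.
  by move: ed d_gt0; case: (d) => //= m; rewrite negbK.
have nb0 : - b != 0 by rewrite oppr_eq0.
have [w [wb w_iso]] := even_isotropic_vector sM kM Yd two0 d_gt0 ed bE' nb0.
have bE2 : bform (qend x) (qgram x) u0 w d.-1 = b.
  rewrite (bform_sym sM kM) wb -signr_odd (_ : odd d.-1) ?expr1 ?mulN1r ?opprK //.
  by move: ed d_gt0; case: (d) => //= m; rewrite negbK.
have [u1 [ub u1_iso]] := even_isotropic_vector sM kM Yd two0 d_gt0 ed bE2 b0.
have [u [uw u_iso]] := dual_cyclic_vector sM kM Yd two0 d_gt0 ub b0 u1_iso.
pose Cu := cyclic_rows (qend x) d u; pose Cw := cyclic_rows (qend x) d w.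
have Guw : Cu *m qgram x *m Cw^T = alt_antidiag k d.
  apply/matrixP => i j; rewrite (cyclic_rows_gram kM) !mxE.
  have [lt_ij|] := ltnP (i + j)%N d; first by rewrite uw // mulr_natr.
  by move=> h; rewrite (bform_large _ Yd) // mulr0 [_ == d](_ : _ = false) //; lia.
have G : col_mx Cu Cw *m qgram x *m (col_mx Cu Cw)^T =
         block_mx 0 (alt_antidiag k d) (alt_antidiag k d)^T 0.
  rewrite tr_col_mx mul_col_mx mul_col_row Guw; congr (block_mx _ _ _ _).
  - by apply/matrixP => i j; rewrite (cyclic_rows_gram kM) u_iso mulr0 mxE.
  - by rewrite -Guw !trmx_mul trmxK sM mulmxA.
  - by apply/matrixP => i j; rewrite (cyclic_rows_gram kM) w_iso mulr0 mxE.
apply: (step _ (col_mx Cu Cw) (block_mx (jordan_block0 k d) 0 0 (jordan_block0 k d))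
         _ (d, 1) _ G) => //=.
- by rewrite mul_col_mx !(cyclic_rows_end Yd) mul_block_col !mul0mx addr0 add0r.
- apply: (proj1 (mulmx1_unit (_ : _ *m block_mx 0 (invmx (alt_antidiag k d)^T)
                                     (invmx (alt_antidiag k d)) 0 = 1%:M))).
  rewrite mulmx_block !(mulmx0, mul0mx, addr0, add0r) !mulmxV ?unitmx_tr ?alt_antidiag_unit //.
  by rewrite -scalar_mx_block.
- by rewrite addn_gt0 d_gt0.
- by rewrite /piece /= (negPf ed).
- exact: oner_neq0.
Qed.
End NormalForm.

(** * Jordan type of the normal form *)

Section JordanType.
Variable k : fieldType.
Implicit Types x y z : qmod k.
Local Notation J := (jordan_block0 k).
Local Notation T := (alt_antidiag k).

Lemma jordan_block_mulE d n (A : 'M[k]_(d, n)) i j :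
  (J d *m A) i j = if insub i.+1 is Some i' then A i' j else 0.
Proof.
rewrite mxE; case: insubP => [i' _ e|h].
  rewrite (bigD1 i') //= !mxE e eqxx mul1r big1 ?addr0 // => l ne.
  by rewrite !mxE -e (inj_eq val_inj) (negPf ne) mul0r.
rewrite big1 // => l _; rewrite !mxE (_ : _ == _ = false) ?mul0r //.
by apply: contraNF h => /eqP <-.
Qed.

Lemma jordan_block_exp d m : J d ^+ m = \matrix_(i, j) (j == (i + m)%N :> nat)%:R.
Proof.
elim: m => [|m IHm].
  by apply/matrixP => i j; rewrite expr0 !mxE addn0 eq_sym (inj_eq val_inj).
rewrite exprS -mulmxE IHm; apply/matrixP => i j.
rewrite jordan_block_mulE; case: insubP => [i' _ e|h]; first by rewrite !mxE e addnS.
rewrite mxE (_ : _ == _ = false) //; move: h; rewrite -leqNgt.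
have := ltn_ord j; lia.
Qed.

Lemma jordan_block_nil d : J d ^+ d = 0.
Proof.
rewrite jordan_block_exp; apply/matrixP => i j; rewrite !mxE.
by rewrite (_ : _ == _ = false) //; have := ltn_ord j; lia.
Qed.

(** J^m factors through dimension d - m: independent columns times independent rows. *)
Lemma rank_jordan_block_exp d m : \rank (J d ^+ m) = (d - m)%N.
Proof.
pose A : 'M[k]_(d, d - m) := \matrix_(i, j) (i == j :> nat)%:R.
pose B : 'M[k]_(d - m, d) := \matrix_(i, j) (j == (i + m)%N :> nat)%:R.
have -> : J d ^+ m = A *m B.
  rewrite jordan_block_exp; apply/matrixP => i j; rewrite !mxE.
  have [lt_i|le_i] := ltnP i (d - m).
    rewrite (bigD1 (Ordinal lt_i)) //= !mxE eqxx mul1r big1 ?addr0 // => l ne.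
    rewrite !mxE (_ : _ == _ = false) ?mul0r // eq_sym.
    by apply: contraNF ne => /eqP e; apply/eqP/val_inj.
  rewrite big1 => [|l _]; last first.
    by rewrite !mxE (_ : _ == _ = false) ?mul0r //; have := ltn_ord l; lia.
  by rewrite (_ : _ == _ = false) //; have := ltn_ord j; lia.
have fB : row_free B.
  apply/row_freeP; exists B^T; apply/matrixP => i j; rewrite !mxE.
  have lt_i : (i + m < d)%N by have := ltn_ord i; lia.
  rewrite (bigD1 (Ordinal lt_i)) //= !mxE eqxx mul1r big1 ?addr0 => [|l ne].
    by rewrite eqn_add2r (inj_eq val_inj).
  rewrite !mxE (_ : (l == (i + m)%N :> nat) = false) ?mul0r //.
  by apply: contraNF ne => /eqP e; apply/eqP/val_inj.
have fA : row_free A^T.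
  apply/row_freeP; exists A; apply/matrixP => i j; rewrite !mxE.
  have lt_i : (i < d)%N by have := ltn_ord i; lia.
  rewrite (bigD1 (Ordinal lt_i)) //= !mxE eqxx mul1r big1 ?addr0 => [|l ne].
    by rewrite -(inj_eq val_inj).
  rewrite !mxE (_ : (l == i :> nat) = false) ?mul0r //.
  by apply: contraNF ne => /eqP e; apply/eqP/val_inj.
by rewrite mxrankMfree // -mxrank_tr; apply/eqP.
Qed.

Lemma alt_antidiag_skew d : J d *m T d = - (T d *m (J d)^T).
Proof.
apply/matrixP => i j; rewrite jordan_block_mulE [RHS]mxE -[T d in RHS]trmxK -trmx_mul.
rewrite [(_ *m _)^T _ _]mxE jordan_block_mulE; case: (insubP 'I_d i.+1) => [i' _ ei|hi]; case: (insubP 'I_d j.+1) => [j' _ ej|hj].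
- rewrite /= in ei ej; rewrite !mxE ei ej addSn addnS exprS mulN1r; case: eqP => _; by rewrite ?opprK ?oppr0.
- rewrite /= in ei; rewrite !mxE ei oppr0 (_ : _ == _ = false) //; move: hj (ltn_ord i'); rewrite -leqNgt; lia.
- rewrite /= in ej; rewrite !mxE ej (_ : _ == _ = false) ?oppr0 //; move: hi (ltn_ord j'); rewrite -leqNgt; lia.
- by rewrite oppr0.
Qed.

(** T_d is symmetric for odd d but skew for even d, which is why blocks of even size are paired in
    [even_piece]. *)
Lemma alt_antidiag_tr d : (T d)^T = (-1) ^+ d.-1 *: T d.
Proof.
apply/matrixP => i j; rewrite !mxE addnC; case: eqP => [e|_]; last by rewrite !mulr0n mulr0.
have -> : d.-1 = (i + j)%N by rewrite -[in LHS]e.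
by rewrite !mulr1n exprD -mulrA -expr2 -exprM mulnC exprM sqrrN expr1n expr1n mulr1.
Qed.

Lemma expr_block_diag m n (A : 'M[k]_m) (B : 'M_n) e :
  block_mx A 0 0 B ^+ e = block_mx (A ^+ e) 0 0 (B ^+ e).
Proof.
elim: e => [|e IHe]; first by rewrite !expr0 -scalar_mx_block.
rewrite exprS IHe -mulmxE mulmx_block !(mulmx0, mul0mx, addr0, add0r).
by rewrite !mulmxE -!exprS.
Qed.

Definition jordan_sum (s : seq nat) : qmod k := osums [seq QMod (J d) 0 | d <- s].

Definition block_sizes (l : seq (nat * k)) : seq nat :=
  flatten [seq if odd p.1 then [:: p.1] else [:: p.1; p.1] | p <- l].

Lemma jordan_sum_cat s t : iso (jordan_sum (s ++ t)) (osum (jordan_sum s) (jordan_sum t)).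
Proof. by rewrite /jordan_sum map_cat; apply: iso_osums_cat. Qed.

Lemma jordan_sum_perm s t : perm_eq s t -> iso (jordan_sum s) (jordan_sum t).
Proof.
move=> p12; move: p12 (iso_refl (jordan_sum s)).
apply: (@catCA_perm_ind _ (fun t => iso (jordan_sum s) (jordan_sum t))) => s1 s2 s3 IH.
apply: iso_trans IH _; apply: iso_trans (jordan_sum_cat _ _) _.
apply: iso_trans (iso_osum (iso_refl _) (jordan_sum_cat _ _)) _.
apply: iso_trans (osumAC _ _ _) _; apply: iso_sym.
apply: iso_trans (jordan_sum_cat _ _) _.
exact: iso_osum (iso_refl _) (jordan_sum_cat _ _).
Qed.

Lemma forgetG_nform l : iso (forgetG (nform l)) (jordan_sum (block_sizes l)).
Proof.
elim: l => [|p l IHl]; first exact: iso_refl.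
rewrite /block_sizes /= -/(block_sizes l) /nform /= -/(nform l) forgetG_osum.
apply: iso_sym; apply: iso_trans (jordan_sum_cat _ _) _; apply: iso_sym.
apply: iso_osum IHl; rewrite /piece; case: ifP => _.
  exact/iso_sym/osumx0.
rewrite /jordan_sum /= (_ : forgetG _ = osum (QMod (J p.1) 0) (QMod (J p.1) 0)).
  exact: iso_osum (iso_refl _) (iso_sym (osumx0 _)).
by rewrite /osum /= block_mx0.
Qed.

Lemma iso_rank x y e : iso x y -> \rank (qend x ^+ e) = \rank (qend y ^+ e).
Proof.
case=> P [Q [PQ QP PE _]].
have E : qend x ^+ e = P *m qend y ^+ e *m Q.
  by rewrite (intertwine_exp _ PE) -mulmxA PQ mulmx1.
have E' : qend y ^+ e = Q *m qend x ^+ e *m P.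
  by rewrite -mulmxA -(intertwine_exp _ PE) mulmxA QP mul1mx.
apply/eqP; rewrite eqn_leq; apply/andP; split.
  by rewrite E; exact: leq_trans (mxrankM_maxl _ _) (mxrankM_maxr _ _).
by rewrite E'; exact: leq_trans (mxrankM_maxl _ _) (mxrankM_maxr _ _).
Qed.

Lemma rank_jordan_sum s e :
  \rank (qend (jordan_sum s) ^+ e) = (\sum_(d <- s) (d - e))%N.
Proof.
elim: s => [|d s IHs]; first by rewrite big_nil; apply/eqP; rewrite -leqn0 rank_leq_row.
by rewrite big_cons /jordan_sum /= expr_block_diag rank_diag_block_mx rank_jordan_block_exp IHs.
Qed.

(** For fixed d, the second difference of the truncated d - b in b is the indicator of d = b + 1;
    the identity is written without subtraction. *)
Lemma count_mem_rank s b :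
  (count_mem b.+1 s + 2 * \sum_(d <- s) (d - b.+1) =
   \sum_(d <- s) (d - b) + \sum_(d <- s) (d - b.+2))%N.
Proof.
elim: s => [|d s IHs]; first by rewrite !big_nil.
rewrite !big_cons /=; move: IHs; move: (\sum_(d <- s) (d - b))%N (\sum_(d <- s) (d - b.+1))%N (\sum_(d <- s) (d - b.+2))%N (count_mem _ s) => A B C D IHs.
by case: eqP => [->|ne]; lia.
Qed.

(** Multiplicities are recovered from the ranks of powers, which do not see empty blocks; hence the
    exclusion of 0. *)
Lemma jordan_sum_inj s t : 0%N \notin s -> 0%N \notin t ->
  iso (jordan_sum s) (jordan_sum t) -> perm_eq s t.
Proof.
move=> s0 t0 st; apply/allP => b _ /=; apply/eqP.
case: b => [|b]; first by rewrite (count_memPn s0) (count_memPn t0).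
have E e : (\sum_(d <- s) (d - e) = \sum_(d <- t) (d - e))%N.
  by rewrite -!rank_jordan_sum; apply: iso_rank.
by have := count_mem_rank s b; rewrite !E -(count_mem_rank t b) => /addIn.
Qed.

(** X is encoded by X^T, so Jordan types must be compared across transposition; reversing the basis
    carries a Jordan block to its transpose. *)
Definition transE (x : qmod k) : qmod k := QMod (qend x)^T 0.

Lemma iso_transE x y : iso x y -> iso (transE x) (transE y).
Proof.
case=> P [Q [PQ QP PE _]]; exists Q^T, P^T; split=> /=.
- by rewrite -trmx_mul PQ trmx1.
- by rewrite -trmx_mul QP trmx1.
- rewrite -!trmx_mul; congr trmx.
  by rewrite -[RHS]mulmx1 -PQ !mulmxA -(mulmxA Q) -PE mulmxA QP mul1mx.
- by rewrite mulmx0 mul0mx.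
Qed.

Lemma transE_jordan_block d : iso (QMod (J d)^T 0) (QMod (J d) 0).
Proof.
pose R : 'M[k]_d := \matrix_(i, j) ((i + j)%N.+1 == d)%:R.
have RR : R *m R = 1%:M.
  apply/matrixP => i j; rewrite !mxE (bigD1 (rev_ord i)) //= !mxE big1 ?addr0.
    have := ltn_ord i; have := ltn_ord j => lj li.
    have -> : ((i + (d - i.+1)).+1 == d)%N by lia.
    have -> : ((d - i.+1 + j).+1 == d)%N = (i == j) by rewrite -(inj_eq val_inj) /=; lia.
    by rewrite mul1r.
  move=> l ne; rewrite !mxE (_ : (_ == d) = false) ?mul0r //.
  apply: contraNF ne => /eqP e; apply/eqP/val_inj => /=; have := ltn_ord i; lia.
have JR i j : (J d *m R) i j = (i + j.+2 == d)%N%:R.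
  rewrite jordan_block_mulE; case: (insubP 'I_d i.+1) => [i' _ /= ei|hi].
    by rewrite !mxE ei !addnS.
  by rewrite (_ : (_ == d) = false) //; move: hi; lia.
apply: iso_sym; exists R, R; split=> //=; last by rewrite mulmx0 mul0mx.
apply: trmx_inj; rewrite trmx_mul trmxK.
have -> : R^T = R by apply/matrixP => i j; rewrite !mxE addnC.
by apply/matrixP => i j; rewrite [RHS]mxE !JR !addnS addnC.
Qed.

Lemma transE_jordan_sum s : iso (transE (jordan_sum s)) (jordan_sum s).
Proof.
elim: s => [|d s IHs]; first by apply: (iso_trans _ (iso_refl _)); rewrite /transE /= trmx0; apply: iso_refl.
rewrite /jordan_sum /= -/(jordan_sum s) /osum /transE /= tr_block_mx !trmx0.
have -> : QMod (block_mx (J d)^T 0 0 (qend (jordan_sum s))^T) 0 =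
          osum (QMod (J d)^T 0) (transE (jordan_sum s)).
  by rewrite /osum /= block_mx0.
exact: iso_osum (transE_jordan_block d) IHs.
Qed.

Lemma iso_dim0 x y : qdim x = 0%N -> qdim y = 0%N -> iso x y.
Proof.
move=> ex ey; exists 0, 0; split; apply/matrixP => i j;
  by have := ltn_ord i; rewrite ?[X in (_ < X)%N]ex ?[X in (_ < X)%N]ey.
Qed.

Lemma mxdiag_jordan_iso m (p_ : 'I_m -> nat) :
  iso (QMod (\mxdiag_i J (p_ i)) 0) (jordan_sum [seq p_ i | i <- enum 'I_m]).
Proof.
elim: m p_ => [|m IHm] p_.
  by apply: iso_dim0; rewrite /= ?big_ord0 // enum_ord0.
rewrite mxdiag_recl enum_ordSl /= -map_comp.
apply: iso_trans (_ : iso (osum (QMod (J (p_ ord0)) 0)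
  (QMod (\mxdiag_i J (p_ (lift ord0 i))) 0)) _); last first.
  exact: iso_osum (iso_refl _) (IHm _).
rewrite /osum /= block_mx0; move: (mxsize_recl (p_ := p_)) (block_mx _ _ _ _) => e A.
have <- : castmx (e, e) 0 = 0 :> 'M[k]__ by apply/matrixP => i j; rewrite castmxE !mxE.
exact/iso_sym/iso_cast.
Qed.

Lemma jordan_nilp_iso lam : iso (QMod (jordan_nilp k lam) 0) (jordan_sum lam).
Proof.
have := mxdiag_jordan_iso (fun i : 'I_(size lam) => nth 0%N lam i).
rewrite (_ : [seq _ | i <- _] = lam) // (map_comp (nth 0%N lam) val).
by rewrite val_enum_ord -/(mkseq _ _) mkseq_nth.
Qed.

Lemma jordan_typeE n lam (X : 'M[k]_n) :
  jordan_type lam X <-> iso (QMod X^T 0) (jordan_sum lam).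
Proof.
have S : iso (QMod X 0) (jordan_sum lam) <-> iso (QMod X^T 0) (jordan_sum lam).
  split=> h; have := iso_trans (iso_transE h) (transE_jordan_sum lam) => //.
  by rewrite /transE /= trmxK.
rewrite -S; split.
  case=> P /andP[fP fuP] /(simmxPp _) PX; apply: iso_trans (jordan_nilp_iso lam).
  have [Q PQ] := row_freeP fP; have [Q' QP] := row_fullP fuP.
  have eQ : Q' = Q by rewrite -[Q']mulmx1 -PQ mulmxA QP mul1mx.
  apply: iso_sym; exists P, Q; split=> //=; last by rewrite mulmx0 mul0mx.
    by rewrite -eQ.
  by apply: PX; rewrite submx_full.
move=> h; have [P [Q [PQ QP PE _]]] := iso_trans (jordan_nilp_iso lam) (iso_sym h).
exists P; first by apply/andP; split; [apply/row_freeP; exists Q | apply/row_fullP; exists Q].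
by apply: simmxW => //; apply/row_freeP; exists Q.
Qed.

Lemma jordan_type_block_sizes n lam (X M : 'M[k]_n) l :
  0%N \notin lam -> valid_pieces l -> iso (QMod X^T M) (nform l) ->
  jordan_type lam X <-> perm_eq lam (block_sizes l).
Proof.
move=> lam0 vl /iso_forgetG; rewrite /forgetG /= => h; rewrite jordan_typeE.
have hl := iso_trans h (forgetG_nform l); split=> [h'|p].
  apply: jordan_sum_inj => //; last exact: iso_trans (iso_sym h') hl.
  apply/flattenP => -[_ /mapP[p pl ->]].
  have /andP[] := allP vl p pl; rewrite lt0n eq_sym => /negPf p0 _.
  by case: ifP; rewrite !inE p0.
by apply: iso_trans hl (iso_sym _); apply: jordan_sum_perm.
Qed.

Lemma piece_skew (p : nat * k) : [/\ (qgram (piece p))^T = qgram (piece p),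
  p.2 != 0 -> qgram (piece p) \in unitmx,
  qend (piece p) *m qgram (piece p) = - (qgram (piece p) *m (qend (piece p))^T)
  & qend (piece p) ^+ p.1 = 0].
Proof.
rewrite /piece; case: ifP => [od|ed] /=.
  split=> //.
  - rewrite linearZ /= alt_antidiag_tr -signr_odd (_ : odd p.1.-1 = false) ?scale1r //.
    by case: p.1 od => //= m /negPf.
  - by move=> a0; rewrite unitmxZ ?unitfE // alt_antidiag_unit.
  - by rewrite -scalemxAr -scalemxAl alt_antidiag_skew scalerN.
  - exact: jordan_block_nil.
split=> //.
- by rewrite tr_block_mx trmxK !trmx0.
- move=> _; apply: (proj1 (mulmx1_unit (_ : _ *m block_mx 0 (invmx (T p.1)^T)
                                     (invmx (T p.1)) 0 = 1%:M))).
  rewrite mulmx_block !(mulmx0, mul0mx, addr0, add0r) !mulmxV ?unitmx_tr ?alt_antidiag_unit //.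
  by rewrite -scalar_mx_block.
- rewrite tr_block_mx !mulmx_block !(mulmx0, mul0mx, addr0, add0r, trmx0).
  rewrite opp_block_mx !oppr0 alt_antidiag_skew; congr block_mx.
  by rewrite -[RHS]trmxK linearN /= trmx_mul !trmxK alt_antidiag_skew opprK trmx_mul trmxK.
- by rewrite expr_block_diag !jordan_block_nil block_mx0.
Qed.

Lemma osum_skew_nilpotent x y :
  skew_nilpotent x -> skew_nilpotent y -> skew_nilpotent (osum x y).
Proof.
case=> sx ux kx [d dx] [sy uy ky [e ey]]; split=> /=.
- by rewrite tr_block_mx !trmx0 sx sy.
- by rewrite unitmxE det_ublock unitrM -!unitmxE ux uy.
- rewrite tr_block_mx !mulmx_block !(mulmx0, mul0mx, addr0, add0r, trmx0).
  by rewrite opp_block_mx !oppr0 kx ky.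
- exists (d + e)%N; rewrite expr_block_diag !exprD dx ey mul0r mulr0 block_mx0 //.
Qed.

Lemma nform_skew_nilpotent (l : seq (nat * k)) : valid_pieces l -> skew_nilpotent (nform l).
Proof.
elim: l => [_|p l IHl /= /andP[/andP[_ p0] vl]].
  split=> //=; rewrite ?trmx0 ?mul0mx ?oppr0 //.
    by rewrite unitmxE det_mx00 unitr1.
  by exists 1%N; rewrite expr1.
apply: osum_skew_nilpotent (IHl vl); have [h1 h2 h3 h4] := piece_skew p.
by split=> //; [apply: h2 | exists p.1].
Qed.
End JordanType.

(** * Multiplicity forms *)

Section Coefficients.
Variable k : fieldType.
Implicit Types (x y z : qmod k) (l : seq (nat * k)) (s t : seq k).
Local Notation J := (jordan_block0 k).
Local Notation T := (alt_antidiag k).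

(** For d = 1 the endomorphism is zero and this is the diagonal form on s; for odd d it is that form
    tensored with one standard block of size d. *)
Definition dsum d s : qmod k := nform [seq (d, a) | a <- s].

Definition coeffs d l : seq k := [seq p.2 | p <- l & p.1 == d].

Lemma map_coeffs d l : [seq (d, a) | a <- coeffs d l] = [seq p <- l | p.1 == d].
Proof.
rewrite /coeffs -map_comp -[RHS]map_id; apply/eq_in_map => -[e a] /=.
by rewrite mem_filter => /andP[/eqP /= -> _].
Qed.

Lemma coeffs_pairs d s : coeffs d [seq (d, a) | a <- s] = s.
Proof. by rewrite /coeffs filter_map /= (eq_filter (a2 := predT)) ?filter_predT ?mapK // => a /=; rewrite eqxx. Qed.

Lemma dsum_cat d s t : iso (dsum d (s ++ t)) (osum (dsum d s) (dsum d t)).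
Proof. by rewrite /dsum map_cat; apply: nform_cat. Qed.

Lemma qdim_dsum1 s : qdim (dsum 1 s) = size s.
Proof. by elim: s => //= a s IHs; rewrite -IHs. Qed.

Lemma qend_dsum1 s : qend (dsum 1 s) = 0.
Proof.
elim: s => [|a s IHs] //=; rewrite [qend _]IHs.
rewrite (_ : J 1 = 0) ?block_mx0 //.
by apply/matrixP => i j; rewrite !mxE !ord1.
Qed.

Lemma qgram_dsum1 a s :
  qgram (dsum 1 (a :: s)) = block_mx a%:M 0 0 (qgram (dsum 1 s)).
Proof.
rewrite /dsum /=; congr (block_mx _ _ _ _).
by apply/matrixP => i j; rewrite !mxE !ord1 /= mulr1n mulr1.
Qed.

Lemma dsum1_unit s : 0 \notin s -> qgram (dsum 1 s) \in unitmx.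
Proof.
elim: s => [_|a s IHs]; first by rewrite unitmxE det_mx00 unitr1.
rewrite inE negb_or eq_sym => /andP[a0 s0].
rewrite qgram_dsum1 unitmxE det_ublock unitrM -!unitmxE IHs // andbT.
by rewrite unitmxE det_scalar1 unitfE.
Qed.

Lemma jordan_exp_antidiag e m i j :
  (J e ^+ m *m T e) i j = (-1) ^+ j *+ ((i + m + j).+1 == e)%N.
Proof.
rewrite jordan_block_exp !mxE; have [lt_im|le_im] := ltnP (i + m) e.
  rewrite (bigD1 (Ordinal lt_im)) //= !mxE eqxx mul1r big1 ?addr0 // => l ne.
  rewrite !mxE (_ : (_ == _ :> nat) = false) ?mul0r //.
  by apply: contraNF ne => /eqP h; apply/eqP/val_inj.
rewrite big1 => [|l _]; first by rewrite (_ : (_ == e) = false) //; lia.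
by rewrite !mxE (_ : (_ == _ :> nat) = false) ?mul0r //; have := ltn_ord l; lia.
Qed.

Lemma jordan_ker_entry e d r (U : 'M_(r, e)) i (j : 'I_e) :
  U *m J e ^+ d = 0 -> (j + d < e)%N -> U i j = 0.
Proof.
move=> U0 lt_jd; have := congr1 (fun A : 'M_(_, _) => A i (Ordinal lt_jd)) U0.
rewrite jordan_block_exp !mxE (bigD1 j) //= !mxE eqxx mulr1 big1 ?addr0 // => l ne.
rewrite !mxE /= (_ : (_ == _ :> nat) = false) ?mulr0 //.
by apply: contraNF ne => /eqP h; apply/eqP/val_inj => /=; lia.
Qed.

(** Indices h and l contribute only if h + l + d = e, while the kernel conditions require h + d >= e
    and l + d >= e; together these force h = l = 0 and d = e. *)
Lemma jordan_gram_off_size e d r (U V : 'M_(r, e)) : (0 < d)%N -> e != d ->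
  U *m J e ^+ d = 0 -> V *m J e ^+ d = 0 -> U *m J e ^+ d.-1 *m T e *m V^T = 0.
Proof.
move=> d0 ne U0 V0; rewrite -(mulmxA U); apply/matrixP => i j; rewrite [RHS]mxE.
rewrite mxE big1 // => l _; rewrite [X in X * _]mxE mulr_suml.
rewrite big1 // => h _; rewrite jordan_exp_antidiag [V^T _ _]mxE.
have [lt_h|le_h] := ltnP (h + d) e; first by rewrite (jordan_ker_entry _ U0 lt_h) !mul0r.
have [lt_l|le_l] := ltnP (l + d) e; first by rewrite (jordan_ker_entry _ V0 lt_l) mulr0.
rewrite (_ : (_ == e) = false) ?mulr0 ?mul0r //; lia.
Qed.

(** In a piece of size d the form only sees the coordinate along the first basis vector, which is
    the column c. *)
Lemma piece_upper d r (p : nat * k) (U : 'M_(r, qdim (piece p))) : odd d ->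
  U *m qend (piece p) ^+ d = 0 ->
  let S := U *m qend (piece p) ^+ d.-1 *m qgram (piece p) *m U^T in
  if p.1 == d then exists c : 'cV_r, S = c *m p.2%:M *m c^T else S = 0.
Proof.
case: p U => e a; rewrite /piece /= => U od.
have d_gt0 : (0 < d)%N by case: (d) od.
have [ed|ne] := eqVneq e d.
  move: U; rewrite ed od /= => U _; exists (U *m (\col_i (i == 0%N :> nat)%:R)).
  rewrite -scalemxAr -scalemxAl mul_mx_scalar -scalemxAl; congr (_ *: _).
  rewrite trmx_mul -!mulmxA; congr (_ *m _); rewrite !mulmxA; congr (_ *m _).
  apply/matrixP => i j; rewrite jordan_exp_antidiag !mxE big_ord1 !mxE.
  have -> : ((i + d.-1 + j).+1 == d)%N = (i == 0%N :> nat) && (j == 0%N :> nat) by lia.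
  by case: eqP => _; case: eqP => [->|_]; rewrite ?mulr0 ?mulr1 ?mul0r.
case: ifP U => [oe|ee] /= U.
  move=> U0; rewrite -scalemxAr -scalemxAl jordan_gram_off_size ?scaler0 //.
rewrite !expr_block_diag -[U]hsubmxK; set A := lsubmx U; set B := rsubmx U.
rewrite !mul_row_block !mulmx0 !addr0 !add0r => /eqP.
rewrite row_mx_eq0 => /andP[/eqP A0 /eqP B0].
rewrite tr_row_mx mul_row_col alt_antidiag_tr.
rewrite -scalemxAr -scalemxAl !jordan_gram_off_size ?scaler0 ?addr0 //.
Qed.

(* On ker Y^d the form B(x Y^(d-1), y) only sees the pieces of size d. *)
Lemma coeffs_upper d l r (U : 'M_(r, qdim (nform l))) : odd d ->
  U *m qend (nform l) ^+ d = 0 ->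
  exists P, U *m qend (nform l) ^+ d.-1 *m qgram (nform l) *m U^T =
            P *m qgram (dsum 1 (coeffs d l)) *m P^T.
Proof.
move=> od; elim: l U => [|p l IHl] U.
  by move=> _; exists 0; rewrite [qgram (nform _)]flatmx0 !(mulmx0, mul0mx).
rewrite /nform /= -/(nform l) !expr_block_diag -[U]hsubmxK.
set U1 := lsubmx U; set U2 := rsubmx U.
rewrite mul_row_block !mulmx0 addr0 add0r.
move=> /eqP; rewrite row_mx_eq0 => /andP[/eqP U1d /eqP U2d]; have [P eP] := IHl U2 U2d.
have := piece_upper od U1d; rewrite /=.
rewrite !mul_row_block !mulmx0 !addr0 !add0r tr_row_mx mul_row_col eP.
rewrite /coeffs /=; case: ifP => [pd [c ->]|_ ->]; last by exists P; rewrite add0r.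
exists (row_mx c P); rewrite qgram_dsum1.
by rewrite tr_row_mx mul_row_block mul_row_col !mulmx0 addr0 add0r.
Qed.

(** The rows of U are the first basis vectors of the pieces of size d. *)
Lemma coeffs_lower d l : odd d ->
  exists U, U *m qend (nform l) ^+ d = 0 /\
    U *m qend (nform l) ^+ d.-1 *m qgram (nform l) *m U^T =
      qgram (dsum 1 (coeffs d l)).
Proof.
move=> od; elim: l => [|[e a] l [U [U0 UG]]].
  by exists 0; rewrite !mul0mx; split=> //; rewrite [LHS]flatmx0 [RHS]flatmx0.
rewrite /coeffs /nform /= -/(nform l) !expr_block_diag -/(coeffs d l).
have [->|ne] := eqVneq e d; last first.
  exists (row_mx 0 U); rewrite !mul_row_block !(mulmx0, mul0mx, addr0, add0r) U0.
  by rewrite row_mx0 tr_row_mx mul_row_col !(mul0mx, add0r).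
rewrite qgram_dsum1 /= /piece /= od.
have lt0d : (0 < d)%N by case: (d) od.
pose u : 'rV[k]_d := delta_mx 0 (Ordinal lt0d).
exists (block_mx u 0 0 U) => /=.
rewrite !mulmx_block !(mulmx0, mul0mx, addr0, add0r) U0.
rewrite jordan_block_nil mulmx0 block_mx0; split=> //.
rewrite tr_block_mx !trmx0 mulmx_block !(mulmx0, mul0mx, addr0, add0r) UG.
congr (block_mx _ _ _ _); rewrite -!scalemxAr -!scalemxAl -(mulmxA u) -rowE trmx_delta -colE.
apply/matrixP => i j; rewrite !ord1 mxE [X in _ * X]mxE [X in _ * X]mxE jordan_exp_antidiag !mxE /=.
by rewrite add0n addn0 prednK // eqxx !mulr1n mulr1.
Qed.

Lemma size_coeffs d l : odd d -> size (coeffs d l) = count_mem d (block_sizes l).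
Proof.
move=> od; rewrite size_map size_filter.
elim: l => //= -[e a] l IHl; rewrite /block_sizes /= count_cat -/(block_sizes l) IHl /=.
by case: ifP => //= oe; [rewrite addn0|rewrite (_ : (e == d) = false) //; apply: contraFF oe => /eqP->].
Qed.

Lemma size_coeffs_even d l :
  ~~ odd d -> ((size (coeffs d l)).*2 = count_mem d (block_sizes l))%N.
Proof.
move=> ed; rewrite size_map size_filter.
elim: l => //= -[e a] l IHl; rewrite /block_sizes /= count_cat -/(block_sizes l) -IHl /=.
rewrite doubleD; case: ifP => //= oe; last by rewrite addn0 -addnn.
by rewrite (_ : (e == d) = false) //; apply: contraTF oe => /eqP->.
Qed.

Lemma coeffs_neq0 d l : valid_pieces l -> 0 \notin coeffs d l.
Proof.
move=> vl; apply/mapP => -[p]; rewrite mem_filter => /andP[_ pl] p0.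
by have /andP[_] := allP vl p pl; rewrite -p0 eqxx.
Qed.

(** The rows realizing the multiplicity form of l are carried into the kernel of the d-th power on
    the other side, where [coeffs_upper] writes their Gram matrix as V G' V^T. This matrix is
    invertible and the sizes agree, so V is invertible; V stands for the induced map between the
    quotients of the kernels by their radicals. *)
Lemma iso_coeffs d l l' : valid_pieces l -> valid_pieces l' -> odd d ->
  iso (nform l) (nform l') -> perm_eq (block_sizes l) (block_sizes l') ->
  iso (dsum 1 (coeffs d l)) (dsum 1 (coeffs d l')).
Proof.
move=> vl vl' od [P [Q [PQ QP PE PG]]] /permP pll'.
have [U [U0 UG]] := coeffs_lower l od.
have [|V eV] := @coeffs_upper d l' _ (U *m P) od.
  by rewrite -mulmxA (intertwine_exp _ PE) mulmxA U0 mul0mx.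
have eG : qgram (dsum 1 (coeffs d l)) = V *m qgram (dsum 1 (coeffs d l')) *m V^T.
  rewrite -eV -UG -PG trmx_mul -(mulmxA U P) (intertwine_exp _ PE) !mulmxA.
  by rewrite -(mulmxA U) -(mulmxA U).
have fV : row_free V.
  rewrite /row_free eqn_leq rank_leq_row /=.
  rewrite -[X in (X <= _)%N](mxrank_unit (dsum1_unit (coeffs_neq0 d vl))) eG -mulmxA.
  exact: mxrankM_maxl.
have [|W [VW WV]] := rect_inverse fV.
  by rewrite !qdim_dsum1 !size_coeffs.
by exists V, W; split=> //; rewrite !qend_dsum1 mulmx0 mul0mx.
Qed.

(* Isometry of diagonal forms, tensored with every Jordan block of odd size d;
   the case d = 1 is isometry itself. *)
Definition ceq s t := forall d, odd d -> iso (dsum d s) (dsum d t).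

Lemma ceq_refl s : ceq s s. Proof. by move=> d _; apply: iso_refl. Qed.

Lemma ceq_sym s t : ceq s t -> ceq t s.
Proof. by move=> st d od; apply/iso_sym/st. Qed.

Lemma ceq_trans t s u : ceq s t -> ceq t u -> ceq s u.
Proof. by move=> st tu d od; apply: iso_trans (st d od) (tu d od). Qed.

Lemma ceq_cat s s' t t' : ceq s s' -> ceq t t' -> ceq (s ++ t) (s' ++ t').
Proof.
move=> ss' tt' d od; apply: iso_trans (dsum_cat _ _ _) _.
apply: iso_trans (iso_osum (ss' d od) (tt' d od)) _.
exact/iso_sym/dsum_cat.
Qed.

Lemma ceq_perm s t : perm_eq s t -> ceq s t.
Proof. by move=> st d _; apply: nform_perm; apply: perm_map. Qed.

Lemma dsum_scale c d s : odd d -> dsum d [seq c * a | a <- s] = scaleG c (dsum d s).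
Proof.
move=> od; elim: s => [|a s IHs].
  by rewrite /dsum /nform /= /ozero /scaleG /= scaler0.
rewrite /dsum /= -/(dsum _ _) /nform /= -!/(nform _) scaleG_osum -/(dsum d s) -IHs.
by congr (osum _ _); rewrite /piece /= od /scaleG /odd_piece /= scalerA.
Qed.

Lemma ceq_scale c s t : ceq s t -> ceq [seq c * a | a <- s] [seq c * a | a <- t].
Proof. by move=> st d od; rewrite !dsum_scale //; apply/iso_scaleG/st. Qed.

Lemma ceq_square c a : c != 0 -> ceq [:: a] [:: c ^+ 2 * a].
Proof.
move=> c0 d od; apply: iso_osum (iso_refl _); rewrite /piece /= od.
exists (c^-1%:M), (c%:M); rewrite /= -!scalar_mxM mulfV // mulVf //; split=> //.
  by rewrite scalar_mxC.
rewrite tr_scalar_mx mul_scalar_mx mul_mx_scalar !scalerA; congr (_ *: _).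
by field.
Qed.

(** The new basis consists of (u, v) and the orthogonal vector (- b v, a u). All blocks of the
    change of basis are scalar, so it commutes with the Jordan blocks. *)
Lemma ceq_binary (a b u v : k) : a * u ^+ 2 + b * v ^+ 2 != 0 ->
  a != 0 -> b != 0 ->
  let c := a * u ^+ 2 + b * v ^+ 2 in ceq [:: a; b] [:: c; a * b * c].
Proof.
move=> c0 a0 b0 c d od; rewrite -/c in c0.
rewrite /dsum /nform /= /piece /= od.
have red (x y : qmod k) : iso (osum x (osum y (ozero k))) (osum x y).
  by apply: iso_osum (iso_refl _) _; apply: osumx0.
apply: iso_trans (red _ _) (iso_trans _ (iso_sym (red _ _))); apply: iso_sym.
exists (block_mx u%:M v%:M (- (b * v))%:M (a * u)%:M),
       (c^-1 *: block_mx (a * u)%:M (- v)%:M (b * v)%:M u%:M); split=> /=.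
- rewrite -scalemxAr mulmx_block -!scalar_mxM -!raddfD /=.
  rewrite (_ : u * (a * u) + _ = c); last by rewrite /c; ring.
  rewrite (_ : u * - v + _ = 0); last by ring.
  rewrite (_ : - (b * v) * (a * u) + _ = 0); last by ring.
  rewrite (_ : - (b * v) * - v + _ = c); last by rewrite /c; ring.
  rewrite scale_block_mx !scale_scalar_mx mulr0 mulVf //.
  by rewrite [RHS]scalar_mx_block !raddf0.
- rewrite -scalemxAl mulmx_block -!scalar_mxM -!raddfD /=.
  rewrite (_ : a * u * u + _ = c); last by rewrite /c; ring.
  rewrite (_ : a * u * v + _ = 0); last by ring.
  rewrite (_ : b * v * u + _ = 0); last by ring.
  rewrite (_ : b * v * v + _ = c); last by rewrite /c; ring.
  rewrite scale_block_mx !scale_scalar_mx mulr0 mulVf //.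
  by rewrite [RHS]scalar_mx_block !raddf0.
- by rewrite !mulmx_block !(mulmx0, mul0mx, addr0, add0r) !scalar_mxC.
- rewrite tr_block_mx !tr_scalar_mx !mulmx_block !(mulmx0, mul0mx, addr0, add0r).
  rewrite !mul_scalar_mx !mul_mx_scalar !scalerA -!scalerDl.
  congr (block_mx _ _ _ _).
  + by congr (_ *: _); rewrite /c; ring.
  + by rewrite (_ : _ + _ = 0) ?scale0r //; ring.
  + by rewrite (_ : _ + _ = 0) ?scale0r //; ring.
  + by congr (_ *: _); rewrite /c; ring.
Qed.

Lemma ceq_hyperbolic a : (2%:R : k) != 0 -> a != 0 -> ceq [:: a; - a] [:: 1; - 1].
Proof.
(* x + y = 1 and x - y = 1 / a, so a (x^2 - y^2) = 1. *)
move=> two0 a0; pose x := (1 + a^-1) / 2%:R; pose y := (1 - a^-1) / 2%:R.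
have e : a * x ^+ 2 + - a * y ^+ 2 = 1.
  by rewrite /x /y; field; rewrite a0 two0.
have := @ceq_binary a (- a) x y; rewrite /= e oner_neq0 oppr_eq0 => /(_ isT a0 a0) h.
apply: ceq_trans h _; rewrite (_ : [:: 1; _] = [:: 1] ++ [:: a ^+ 2 * -1]).
  apply: (@ceq_cat [:: 1] [:: 1] _ [:: -1]); first exact: ceq_refl.
  by apply/ceq_sym/ceq_square.
by congr [:: _; _]; ring.
Qed.

Lemma nform_iso_coeffs l l' : perm_eq (block_sizes l) (block_sizes l') ->
  (forall d, odd d -> ceq (coeffs d l) (coeffs d l')) -> iso (nform l) (nform l').
Proof.
move=> /permP pll' cll'.
have E d : iso (nform [seq p <- l | p.1 == d]) (nform [seq p <- l' | p.1 == d]).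
  rewrite -!map_coeffs; have [od|ed] := boolP (odd d); first exact: cll'.
  have : size (coeffs d l) = size (coeffs d l').
    by apply: double_inj; rewrite !size_coeffs_even // pll'.
  elim: (coeffs d l) (coeffs d l') => [|a s IHs] [|b t] //=; first by move=> _; apply: iso_refl.
  by case=> st; apply: iso_osum (IHs _ st); rewrite /piece /= (negPf ed); apply: iso_refl.
move=> {cll' pll'}.
(* Induction on a list of sizes covering both sequences; each step splits off the pieces of one
   size. *)
have [D] : exists D : seq nat, forall p, p \in l ++ l' -> p.1 \in D.
  by exists (map fst (l ++ l')) => p pl; apply: map_f.
elim: D l l' E => [|d D IHD] l l' E memD.
  case: l E memD => [|p l] E memD; last by have := memD p (mem_head _ _).
  case: l' E memD => [|p l'] E memD; last by have := memD p (mem_head _ _).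
  exact: iso_refl.
have split_d (m : seq (nat * k)) : iso (nform m) (osum (nform [seq p <- m | p.1 == d])
                                     (nform [seq p <- m | p.1 != d])).
  by apply: iso_trans (nform_perm _) (nform_cat _ _); rewrite perm_sym perm_filterC.
rewrite -/(iso (nform l) (nform l')). apply: iso_trans (split_d l) _; apply: iso_sym.
apply: iso_trans (split_d l') _; apply: iso_sym.
apply: iso_osum (E d) (IHD _ _ _ _) => [e|p].
  rewrite -!filter_predI; have [->|ne] := eqVneq e d.
    by rewrite !(eq_filter (a2 := pred0)) ?filter_pred0 => [|p /=|p /=]; rewrite ?andbN //; apply: iso_refl.
  have F m : [seq p <- m | [predI (fun p => p.1 == e) & (fun p => p.1 != d)] p] = [seq p : nat * k <- m | p.1 == e].
    apply: eq_filter => p; apply/andP/idP => [[]|pe] //; split=> //.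
    by apply: contra ne => /eqP pd; apply/eqP; rewrite -[LHS](eqP pe).
  by rewrite !F.
rewrite -filter_cat mem_filter => /andP[ne pl].
by have := memD p pl; rewrite inE (negPf ne).
Qed.
End Coefficients.

(** * Square classes of a local field *)

(* u is a non-square unit, t a uniformizer and par the parity of the valuation. *)
Record square_classes (k : fieldType) (u t : k) (par : k -> bool) : Prop :=
  SquareClasses {
  sqc_two : (2%:R : k) != 0;
  sqc_u : u != 0;
  sqc_t : t != 0;
  sqc_parM : forall a b, a != 0 -> b != 0 -> par (a * b) = par a (+) par b;
  sqc_paru : par u = false;
  sqc_part : par t;
  sqc_parN1 : par (-1) = false;
  sqc_even : forall a, a != 0 -> ~~ par a -> exists s, a = s ^+ 2 \/ a = s ^+ 2 * u;
  sqc_nsq : forall s, s ^+ 2 <> u;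
  sqc_norm : exists x y, x ^+ 2 - u * y ^+ 2 = u;
  sqc_norm_even : forall x y, x ^+ 2 - u * y ^+ 2 != 0 -> ~~ par (x ^+ 2 - u * y ^+ 2)
}.

Section LocalField.
Variables (k : fieldType) (v : k -> \bar int).
Hypothesis hk : nonarch_local_field v.

Definition valz (x : k) : int := fine (v x).

Lemma valE x : x != 0 -> v x = (valz x)%:E.
Proof.
move=> x0; rewrite /valz; case e : (v x) => [//||].
  by move/(nalf_eqoo hk): e => /eqP; rewrite (negPf x0).
have [t vt] := nalf_uniformizer hk.
have v1 : v 1 = -oo%E by rewrite -(mulfV x0) (nalf_mul hk) e addNye.
by move: vt; rewrite -[t]mulr1 (nalf_mul hk) v1 addeNy.
Qed.

(** [valz 0] is the default value 0 of [fine] at infinity, hence the separate disjunct. *)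
Definition vge (N : int) (x : k) : bool := (x == 0) || (N <= valz x).

Lemma vgeP N x : (N%:E <= v x)%E = vge N x.
Proof.
rewrite /vge; have [->|x0] := eqVneq x 0; first by rewrite (proj2 (nalf_eqoo hk 0)) // leey.
by rewrite valE.
Qed.

Lemma valM x y : x != 0 -> y != 0 -> valz (x * y) = valz x + valz y.
Proof.
move=> x0 y0; apply: EFin_inj.
by rewrite -valE ?mulf_neq0 // (nalf_mul hk) !valE.
Qed.

Lemma val1 : valz 1 = 0.
Proof.
by have := valM (oner_neq0 k) (oner_neq0 k); rewrite mulr1 -[X in X = _]addr0 => /addrI.
Qed.

Lemma valN1 : valz (-1) = 0.
Proof.
have n1 : (-1 : k) != 0 by rewrite oppr_eq0 oner_eq0.
by have := valM n1 n1; rewrite mulrNN mulr1 val1; lia.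
Qed.

Lemma valN x : valz (- x) = valz x.
Proof.
have [->|x0] := eqVneq x 0; first by rewrite oppr0.
by rewrite -mulN1r valM ?valN1 ?add0r // oppr_eq0 oner_eq0.
Qed.

Lemma valV x : x != 0 -> valz x^-1 = - valz x.
Proof. by move=> x0; have := valM x0 (invr_neq0 x0); rewrite mulfV // val1; lia. Qed.

Lemma valX x n : x != 0 -> valz (x ^+ n) = valz x * n%:Z.
Proof.
move=> x0; elim: n => [|n IHn]; first by rewrite expr0 val1 mulr0.
by rewrite exprS valM ?expf_neq0 // IHn intS mulrDr mulr1.
Qed.

Lemma vge0 N : vge N 0. Proof. by rewrite /vge eqxx. Qed.

Lemma vgeN N x : vge N (- x) = vge N x.
Proof. by rewrite /vge oppr_eq0 valN. Qed.

Lemma vgeD N x y : vge N x -> vge N y -> vge N (x + y).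
Proof.
rewrite -!vgeP => hx hy; apply: le_trans (nalf_add hk x y).
by rewrite le_min hx hy.
Qed.

Lemma vgeB N x y : vge N x -> vge N y -> vge N (x - y).
Proof. by move=> hx hy; apply: vgeD => //; rewrite vgeN. Qed.

Lemma vgeM N M x y : vge N x -> vge M y -> vge (N + M) (x * y).
Proof.
rewrite /vge mulf_eq0; have [//|x0] := eqVneq x 0; have [//|y0] := eqVneq y 0.
by rewrite /= valM //; lia.
Qed.

Lemma vgeW N M x : M <= N -> vge N x -> vge M x.
Proof. by rewrite /vge; case: eqP => //= _; lia. Qed.

Lemma vge_all x : (forall n : nat, vge n%:Z x) -> x = 0.
Proof.
move=> h; apply/eqP; case: (eqVneq x 0) => // x0.
by have := h (`|valz x|%N.+1); rewrite /vge (negPf x0) /=; lia.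
Qed.

Lemma vge_val_add x y : x != 0 -> vge (valz x + 1) y ->
  x + y != 0 /\ valz (x + y) = valz x.
Proof.
move=> x0 hy; have hx : vge (valz x) x by rewrite /vge lexx orbT.
have := vgeD hx (vgeW (_ : valz x <= valz x + 1) hy) => /(_ ltac:(lia)) hxy.
have n : ~~ vge (valz x + 1) (x + y).
  apply: contraT; rewrite negbK => /vgeB/(_ hy); rewrite addrK /vge (negPf x0) /=; lia.
move: n hxy; rewrite /vge; have [->|h] //= := eqVneq (x + y) 0.
by rewrite -ltNge ltzD1 => n hxy; split=> //; apply/eqP; rewrite eq_le n hxy.
Qed.

Variable p : nat.
Hypotheses (hp : residue_char v p) (p2 : p <> 2%N).

Lemma not_vge1_1 : ~~ vge 1 1.
Proof. by rewrite /vge oner_eq0 val1. Qed.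

Lemma vge_p : vge 1 p%:R.
Proof.
case: hp => _; have [->|n0] := eqVneq (p%:R : k) 0; first by rewrite vge0.
by rewrite valE // lte_fin /vge (negPf n0) gtz0_ge1.
Qed.

Lemma vge_nat n : vge 0 n%:R.
Proof.
elim: n => [|n IHn]; first exact: vge0.
by rewrite -natr1; apply: vgeD => //; rewrite /vge val1 lexx orbT.
Qed.

(** As p is odd, 1 = p - 2 ((p - 1) / 2) would otherwise lie in the maximal ideal. *)
Lemma not_vge1_2 : ~~ vge 1 2%:R.
Proof.
apply: contra not_vge1_1 => h2; have op : odd p.
  by case: hp => /even_prime [/p2|].
have -> : (1 : k) = p%:R - 2%:R * (p./2)%:R.
  by rewrite -natrM mul2n -[X in X%:R - _](odd_double_half p) op natrD addrK.
by apply: vgeB vge_p _; apply: vgeM h2 (vge_nat _).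
Qed.

Lemma two_neq0 : (2%:R : k) != 0.
Proof. by apply: contra not_vge1_2 => /eqP->; apply: vge0. Qed.

Lemma val2 : valz 2%:R = 0.
Proof.
by have := not_vge1_2; have := vge_nat 2; rewrite /vge (negPf two_neq0) /=; lia.
Qed.

(** Newton iteration from 1. The new error x^2 - a is the square of the step just made; a gain of
    one in valuation per step already gives convergence. *)
Lemma hensel_sqrt_one a : vge 1 (a - 1) -> exists s, s ^+ 2 = a.
Proof.
move=> ha; pose f (x : k) := x - (x ^+ 2 - a) / (2%:R * x).
pose w n := iter n f 1.
have [I D] : (forall n : nat, [/\ w n != 0, valz (w n) = 0 & vge n.+1%:Z (w n ^+ 2 - a)])
       /\ forall n : nat, vge n.+1%:Z (w n.+1 - w n).
  have step x (n : nat) : x != 0 -> valz x = 0 -> vge n.+1%:Z (x ^+ 2 - a) ->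
      [/\ f x != 0, valz (f x) = 0, vge n.+2%:Z (f x ^+ 2 - a) & vge n.+1%:Z (f x - x)].
    move=> x0 vx hx; have d0 : 2%:R * x != 0 by rewrite mulf_neq0 ?two_neq0.
    have hd : vge n.+1%:Z (- ((x ^+ 2 - a) / (2%:R * x))).
      rewrite vgeN -[n.+1%:Z]addr0; apply: vgeM => //.
      by rewrite /vge valV // valM ?two_neq0 // val2 vx !addr0 oppr0 lexx orbT.
    have hd1 : vge (valz x + 1) (- ((x ^+ 2 - a) / (2%:R * x))).
      by apply: vgeW hd; rewrite vx; lia.
    have [fx0 vfx] : f x != 0 /\ valz (f x) = valz x := vge_val_add x0 hd1.
    split=> //; rewrite ?vfx //.
      have -> : f x ^+ 2 - a = (- ((x ^+ 2 - a) / (2%:R * x))) ^+ 2.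
        by rewrite /f; field; rewrite x0 two_neq0.
      by rewrite expr2; apply: (vgeW _ (vgeM hd hd)); lia.
    by rewrite /f addrAC addrN add0r.
  have I n : [/\ w n != 0, valz (w n) = 0 & vge n.+1%:Z (w n ^+ 2 - a)].
    elim: n => [|n [w0 vw hw]]; last by have [] := step _ _ w0 vw hw.
    by rewrite /w /= oner_eq0 val1 expr1n -opprB vgeN.
  by split=> // n; have [w0 vw hw] := I n; have [] := step _ _ w0 vw hw.
have C (m d : nat) : vge m.+1%:Z (w (m + d)%N - w m).
  elim: d => [|d IHd]; first by rewrite addn0 addrN vge0.
  rewrite addnS -(subrKA (w (m + d)%N)); apply: vgeD => //.
  by apply: vgeW (D _); lia.
have [|l hl] := @nalf_complete _ _ hk w.
  move=> N; exists `|N|%N => m m' hm hm'; rewrite vgeP.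
  have h1 := C `|N|%N (m - `|N|)%N; have h2 := C `|N|%N (m' - `|N|)%N.
  rewrite !subnKC // in h1 h2.
  have := vgeB h1 h2; rewrite opprB subrKA => /vgeW; apply; lia.
exists l; apply/eqP; rewrite -subr_eq0; apply/eqP/vge_all => N.
have [m0 hm] := hl N%:Z; pose m := maxn m0 N.
have := hm m (leq_maxl _ _); rewrite vgeP => h.
have [w0 vw hw] := I m.
have vgw : vge 0 (w m) by rewrite /vge vw lexx orbT.
have vgl : vge 0 l.
  rewrite -[l](subrK (w m)); apply: vgeD vgw; rewrite -opprB vgeN; apply: vgeW h; lia.
have -> : l ^+ 2 - a = (l - w m) * (l + w m) + (w m ^+ 2 - a) by ring.
apply: vgeD; last by apply: vgeW hw; rewrite /m; lia.
rewrite -[N%:Z]addr0; apply: vgeM (vgeD vgl vgw).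
by rewrite -opprB vgeN.
Qed.

Definition vunit x := (x != 0) && (valz x == 0).

Lemma vunitM x y : vunit x -> vunit y -> vunit (x * y).
Proof.
case/andP=> x0 /eqP vx /andP[y0 /eqP vy].
by rewrite /vunit mulf_neq0 // valM // vx vy.
Qed.

Lemma vunitV x : vunit x -> vunit x^-1.
Proof. by case/andP=> x0 /eqP vx; rewrite /vunit invr_eq0 x0 valV // vx. Qed.

Lemma vunit_vge x : vunit x -> vge 0 x.
Proof. by case/andP=> x0 /eqP vx; rewrite /vge vx lexx orbT. Qed.

Lemma vunit1 : vunit 1. Proof. by rewrite /vunit oner_eq0 val1. Qed.

Lemma vunitN x : vunit (- x) = vunit x.
Proof. by rewrite /vunit oppr_eq0 valN. Qed.

Lemma vunit_congr x y : vunit x -> vge 1 (y - x) -> vunit y.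
Proof.
case/andP=> x0 /eqP vx h; have := @vge_val_add x (y - x) x0.
rewrite vx add0r (_ : x + (y - x) = y); last by ring.
by move=> /(_ h) [y0 vy]; rewrite /vunit y0 vy.
Qed.

Lemma vunit_not_vge1 x : vunit x -> ~~ vge 1 x.
Proof. by case/andP=> x0 /eqP vx; rewrite /vge vx (negPf x0). Qed.

Lemma vunit_sqrt x : vunit (x ^+ 2) -> vunit x.
Proof.
case: (eqVneq x 0) => [->|x0]; first by rewrite expr0n /vunit eqxx.
by rewrite /vunit expf_neq0 // x0 valX // mulf_eq0 orbF.
Qed.

Lemma hensel_sqrt a b : vunit b -> vge 1 (a - b ^+ 2) -> exists s, s ^+ 2 = a.
Proof.
move=> ub h; have /andP[b0 _] := ub.
have [|s es] := @hensel_sqrt_one (a / b ^+ 2).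
  have -> : a / b ^+ 2 - 1 = (a - b ^+ 2) * (b^-1 * b^-1) by field.
  by rewrite -[1]addr0; apply: vgeM h (vunit_vge (vunitM _ _)); apply: vunitV.
by exists (s * b); rewrite exprMn es divfK // expf_neq0.
Qed.

Lemma vgt0P x : (0%:E < v x)%E = vge 1 x.
Proof.
rewrite /vge; have [->|x0] := eqVneq x 0; first by rewrite (proj2 (nalf_eqoo hk 0)) // ltey.
by rewrite valE // lte_fin gtz0_ge1.
Qed.

Lemma vge1_sym x y : vge 1 (x - y) = vge 1 (y - x).
Proof. by rewrite -vgeN opprB. Qed.

Lemma vge1_trans y x z : vge 1 (x - y) -> vge 1 (y - z) -> vge 1 (x - z).
Proof. by move=> hxy hyz; rewrite -(subrKA y); apply: vgeD. Qed.

(** r picks the first listed representative of a residue class, so among integral elements equality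
    under r is congruence. The finite residue field is handled through the list s. *)
Lemma residue_section : exists (r : k -> k) (s : seq k),
  forall x, vge 0 x ->
  [/\ r x \in s, vge 1 (x - r x) & forall y, vge 1 (x - y) -> r x = r y].
Proof.
have [s hs] := nalf_residue_finite hk.
exists (fun x => nth 0 s (find (fun y => vge 1 (x - y)) s)), s => x hx.
have h : has (fun y => vge 1 (x - y)) s.
  have [|y ys] := hs x; first by rewrite vgeP.
  by rewrite vgt0P => hxy; apply/hasP; exists y.
split; [by rewrite mem_nth // -has_find | exact: (nth_find 0 h)|] => y hxy.
congr (nth _ _ _); apply: eq_find => z /=; apply/idP/idP; last exact: (vge1_trans hxy).
by apply: (@vge1_trans x); rewrite vge1_sym.
Qed.

Definition nonsquare (a : k) := forall s, s ^+ 2 <> a.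

(* Counting in the residue field: squaring is two-to-one on its units. *)
Lemma unit_square_classes :
  (exists2 u, vunit u & nonsquare u) /\
  forall u u', vunit u -> vunit u' -> nonsquare u -> nonsquare u' ->
    exists s, s ^+ 2 = u * u'.
Proof.
have [r [s hr]] := residue_section.
have hru x : vunit x -> [/\ r x \in s, vge 1 (x - r x) & vunit (r x)].
  move=> ux; have [h1 h2 _] := hr x (vunit_vge ux); split=> //.
  by apply: vunit_congr ux _; rewrite vge1_sym.
have rE x y : vunit x -> vunit y -> (r x = r y) <-> vge 1 (x - y).
  move=> ux uy; have [_ _ hx] := hr x (vunit_vge ux); split; last exact: hx.
  move=> e; have [_ h1 _] := hru x ux; have [_ h2 _] := hru y uy.
  by apply: vge1_trans h1 _; rewrite e vge1_sym.
(* U has one representative for each unit of the residue field; S below consists of those of the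
   squares. *)
pose U := undup [seq x <- s | vunit x & r x == x].
have memU x : x \in U -> vunit x /\ r x = x.
  by rewrite mem_undup mem_filter => /andP[/andP[ux /eqP e] _].
have rU x : vunit x -> r x \in U.
  move=> ux; have [h1 h2 h3] := hru x ux; rewrite mem_undup mem_filter h1 h3 andbT /=.
  by apply/eqP/rE => //; rewrite vge1_sym.
have uU : uniq U by apply: undup_uniq.
pose f x := r (x ^+ 2); pose S := undup (map f U).
have fU x : x \in U -> f x \in U.
  by case/memU=> ux _; apply: rU; rewrite expr2 vunitM.
have uS : uniq S by apply: undup_uniq.
have SU : {subset S <= U}.
  by move=> y; rewrite mem_undup => /mapP[x xU ->]; apply: fU.
have fE x y : vunit x -> vunit y -> f x = f y -> vge 1 (x - y) || vge 1 (x + y).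
  move=> ux uy; rewrite /f => /rE; rewrite !expr2 !vunitM // => /(_ isT isT).
  apply: contraTT; rewrite negb_or => /andP[n1 n2]; have -> : x * x - y * y = (x - y) * (x + y) by ring.
  have hx := vunit_vge ux; have hy := vunit_vge uy.
  have o z : vge 0 z -> ~~ vge 1 z -> vunit z.
    rewrite /vge /vunit; case: eqP => //= _ h1 h2.
    by rewrite eq_le h1 andbT -ltzD1 add0r ltNge.
  by apply/vunit_not_vge1/vunitM; apply: o => //; [apply: vgeB | apply: vgeD].
have n1 : r 1 != r (-1).
  apply/eqP; move/rE; rewrite vunitN vunit1 => /(_ isT isT).
  by rewrite opprK -(natrD _ 1 1); apply/negP/not_vge1_2.
have S1 : r 1 \in S.
  rewrite mem_undup; apply/mapP; exists (r 1); rewrite ?rU ?vunit1 //.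
  have [_ h1 h2] := hru 1 vunit1.
  apply/rE; rewrite ?vunit1 ?expr2 ?vunitM //.
  rewrite (_ : 1 - _ = (1 - r 1) * (1 + r 1)); last by ring.
  by rewrite -[1 : int]addr0; apply: vgeM h1 (vgeD (vunit_vge vunit1) (vunit_vge h2)).
have sS x : vunit x -> reflect (exists t, t ^+ 2 = x) (r x \in S).
  move=> ux; apply: (iffP idP).
    rewrite mem_undup => /mapP[y yU]; have [uy _] := memU y yU.
    by move/rE; rewrite expr2 vunitM // => /(_ ux isT); rewrite -expr2; apply: hensel_sqrt.
  case=> t et; have ut : vunit t by apply: vunit_sqrt; rewrite et.
  rewrite mem_undup; apply/mapP; exists (r t); rewrite ?rU //.
  have [_ h1 h2] := hru t ut.
  apply/rE; rewrite ?expr2 ?vunitM // -et.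
  rewrite (_ : t ^+ 2 - _ = (t - r t) * (t + r t)); last by ring.
  by rewrite -[1 : int]addr0; apply: vgeM h1 (vgeD (vunit_vge ut) (vunit_vge h2)).
(* x is determined by f x and by whether it is the first listed root c: any other root is congruent
   to - c. *)
have le2 : (size U <= (size S).*2)%N.
  pose g x := (f x, x == nth 0 U (index (f x) (map f U))).
  have gI : {in U &, injective g}.
    move=> x y xU yU [efxy]; rewrite /= efxy; set c := nth 0 U _.
    have h : (index (f y) (map f U) < size U)%N by rewrite -(size_map f U) index_mem map_f.
    have cU : c \in U by rewrite mem_nth.
    have fc : f c = f y by rewrite /c -(nth_map _ 0) ?nth_index ?map_f.
    clearbody c; have [xc|xc] := eqVneq x c; have [yc|yc] //= := eqVneq y c.
      by rewrite xc yc.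
    move=> _; have [[[ux rx] [uy ry]] [uc rc]] := (memU x xU, memU y yU, memU c cU).
    have opp z : z \in U -> f z = f y -> z != c -> vge 1 (z + c).
      move=> zU ez zc; have [uz rz] := memU z zU.
      have := fE z c uz uc; rewrite ez fc => /(_ erefl) /orP[] // /rE.
      by rewrite rz rc => /(_ uz uc) e; rewrite e eqxx in zc.
    rewrite -rx -ry; apply/rE => //.
    rewrite (_ : x - y = (x + c) - (y + c)); last by ring.
    by apply: vgeB; apply: opp.
  have ug : uniq (map g U) by rewrite map_inj_in_uniq.
  have -> : (size S).*2 = size [seq (a, b) | a <- S, b <- [:: true; false]].
    by rewrite size_allpairs muln2.
  rewrite -(size_map g); apply: uniq_leq_size => // _ /mapP[x xU ->].
  by apply: allpairs_f; [rewrite mem_undup map_f | case: (_ == _)].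
split.
  (* If all units were squares, f would be injective on U, but it agrees on the distinct classes of
     1 and -1. *)
  have [z zU zS] : exists2 z, z \in U & z \notin S.
    apply/hasP; apply: contraT; rewrite has_predC negbK => /allP US.
    have eqs : (size U <= size S)%N by apply: uniq_leq_size.
    have : uniq (map f U).
      rewrite (uniq_size_uniq (s1 := S)) ?size_map // => [|y]; last by rewrite mem_undup.
      by rewrite eqn_leq eqs uniq_leq_size.
    move=> um; case/negP: n1; apply/eqP.
    have u1 : r 1 \in U by apply: rU vunit1.
    have uN1 : r (-1) \in U by apply: rU; rewrite vunitN vunit1.
    have e : f (r 1) = f (r (-1)).
      have [_ h1 h2] := hru 1 vunit1; have [|_ h3 h4] := hru (-1); first by rewrite vunitN vunit1.
      apply/rE; rewrite ?expr2 ?vunitM //.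
      rewrite (_ : _ - _ = (r 1 - r (-1)) * (r 1 + r (-1))); last by ring.
      rewrite -[1 : int]add0r; apply: vgeM (vgeB (vunit_vge h2) (vunit_vge h4)) _.
      rewrite (_ : _ + _ = - ((1 - r 1) + (-1 - r (-1)))); last by ring.
      by rewrite vgeN; apply: vgeD.
    have i1 : (index (r 1%R) U < size (map f U))%N by rewrite size_map index_mem.
    have i2 : (index (r (-1)%R) U < size (map f U))%N by rewrite size_map index_mem.
    have := nth_uniq 0 i1 i2 um; rewrite size_map in i1 i2.
    rewrite !(nth_map 0) // !nth_index // e eqxx => /esym/eqP ei.
    by rewrite -(nth_index 0 u1) ei nth_index.
  have [uz rz] := memU z zU; exists z => // t et; case/negP: zS.
  by rewrite -rz; apply/(sS z uz); exists t.
(* If u u' were not a square, the cosets S, u S and u' S would be disjoint in U, giving 3 |S| <= |U|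
   <= 2 |S|. *)
move=> u u' uu uu' nu nu'; apply/sS; first exact: vunitM.
apply: contraT => nS.
pose mulS a := [seq r (a * x) | x <- S].
have uS' a : vunit a -> uniq (mulS a).
  move=> ua; rewrite map_inj_in_uniq // => x y /SU/memU[ux rx] /SU/memU[uy ry].
  move/rE; rewrite !vunitM // => /(_ isT isT) h; rewrite -rx -ry; apply/rE => //.
  have /andP[a0 _] := ua.
  rewrite (_ : x - y = (a * x - a * y) * a^-1); last by field.
  by rewrite -[1 : int]addr0; apply: vgeM h (vunit_vge (vunitV ua)).
have disj (a b : k) : vunit a -> vunit b -> (forall t, t ^+ 2 <> a * b) ->
    ~~ has (mem (mulS a)) (mulS b).
  move=> ua ub nab; apply/hasPn => _ /mapP[y yS ->]; apply/mapP => -[x xS].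
  have [[uy ry] [ux rx]] := (memU y (SU y yS), memU x (SU x xS)).
  have [ty ety] : exists t, t ^+ 2 = y by apply/(sS y uy); rewrite ry.
  have [tx etx] : exists t, t ^+ 2 = x by apply/(sS x ux); rewrite rx.
  move/rE; rewrite !vunitM // => /(_ isT isT) h.
  have /andP[x0 _] := ux; have /andP[a0 _] := ua; have /andP[b0 _] := ub.
  have uty : vunit ty by apply: vunit_sqrt; rewrite ety.
  have utx : vunit tx by apply: vunit_sqrt; rewrite etx.
  have /andP[tx0 _] := utx.
  have [||t et] := @hensel_sqrt (a * b) (b * ty / tx); first by rewrite !vunitM ?vunitV.
    rewrite (_ : _ - _ = - ((b * y - a * x) * (b * tx^-1 * tx^-1))); last first.
      by rewrite -etx -ety; field.
    by rewrite vgeN -[1 : int]addr0; apply: vgeM h _; apply: vunit_vge; rewrite !vunitM ?vunitV.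
  exact: nab et.
have sub a : vunit a -> {subset mulS a <= U}.
  by move=> ua _ /mapP[x /SU/memU[ux _] ->]; apply: rU; apply: vunitM.
have le3 : (3 * size S <= size U)%N.
  have -> : (3 * size S = size (mulS 1%R ++ mulS u ++ mulS u'))%N.
    by rewrite !size_cat !size_map !mulSn mul0n addn0.
  apply: uniq_leq_size; last first.
    move=> x; rewrite !mem_cat => /or3P[]; apply: sub => //; exact: vunit1.
  rewrite !cat_uniq !uS' ?vunit1 // has_cat negb_or !disj ?vunit1 //; rewrite ?mul1r //.
  by move=> t et; case/negP: nS; apply/(sS _ (vunitM uu uu')); exists t.
have : (0 < size S)%N by move: S1; case: (S).
have := leq_trans le3 le2; clear; lia.
Qed.

Lemma local_square_classes : exists u t par, @square_classes k u t par.
Proof.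
have [[u uu nu] hu] := unit_square_classes; have /andP[u0 /eqP vu] := uu.
have [t vt] := nalf_uniformizer hk.
have t0 : t != 0.
  by apply/eqP => t0; move: vt; rewrite (proj2 (nalf_eqoo hk t) t0).
have vt1 : valz t = 1 by apply: EFin_inj; rewrite -valE.
pose par x := odd `|valz x|%N.
have parM a b : a != 0 -> b != 0 -> par (a * b) = par a (+) par b.
  by move=> a0 b0; rewrite /par valM //; lia.
have units a : vunit a -> exists s, a = s ^+ 2 \/ a = s ^+ 2 * u.
  move=> ua; have [[s es]|ns] := pselect (exists s, s ^+ 2 = a); first by exists s; left.
  have [|s es] := hu a u ua uu _ nu; first by move=> s es; apply: ns; exists s.
  by exists (s / u); right; rewrite expr_div_n es; field.
(* Unequal valuations of x and y leave one dominant term. For equal ones, z = x / y is a unit, and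
   z^2 - u in the maximal ideal would make u a square by Hensel's lemma. *)
have norm_val x y : x ^+ 2 - u * y ^+ 2 != 0 -> ~~ par (x ^+ 2 - u * y ^+ 2).
  have [->|x0] := eqVneq x 0.
    rewrite expr0n sub0r oppr_eq0 mulf_eq0 expf_eq0 /= (negPf u0) /= => y0.
    by rewrite /par valN valM ?expf_neq0 // valX // vu; lia.
  have [->|y0] := eqVneq y 0.
    by rewrite expr0n mulr0 subr0 => _; rewrite /par valX //; lia.
  have vx : valz (x ^+ 2) = valz x * 2 by rewrite valX.
  have vy : valz (- (u * y ^+ 2)) = valz y * 2.
    by rewrite valN valM ?expf_neq0 // valX // vu add0r.
  have [lt_xy|lt_yx|e_xy] := ltgtP (valz x) (valz y).
  - have [||_ e] := @vge_val_add (x ^+ 2) (- (u * y ^+ 2)); rewrite ?expf_neq0 //.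
      by rewrite /vge vx vy; apply/orP; right; lia.
    by rewrite /par e vx => _; lia.
  - have [||_ e] := @vge_val_add (- (u * y ^+ 2)) (x ^+ 2); rewrite ?oppr_eq0 ?mulf_neq0 ?expf_neq0 //.
      by rewrite /vge vx vy; apply/orP; right; lia.
    by rewrite addrC /par e vy => _; lia.
  - move=> n0; set z := x / y.
    have iy0 : y^-1 != 0 by rewrite invr_eq0.
    have uz : vunit z.
      by apply/andP; split; [apply: mulf_neq0 | rewrite valM // valV // e_xy addrN].
    have e : x ^+ 2 - u * y ^+ 2 = y ^+ 2 * (z ^+ 2 - u) by rewrite /z; field.
    have zu0 : z ^+ 2 - u != 0 by apply: contraNneq n0 => zu; rewrite e zu mulr0.
    have nzu : ~~ vge 1 (z ^+ 2 - u).
      apply/negP => h; have [|s es] := hensel_sqrt uz (a := u); last exact: nu es.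
      by rewrite -opprB vgeN.
    have : vge 0 (z ^+ 2 - u).
      by apply: vgeB; apply: vunit_vge => //; rewrite expr2 vunitM.
    move: nzu; rewrite /vge (negPf zu0) /= => h1 h2.
    by rewrite e /par valM ?expf_neq0 // valX //; lia.
exists u, t, par; split=> //.
- exact: two_neq0.
- by rewrite /par vu.
- by rewrite /par vt1.
- by rewrite /par valN1.
- move=> a a0; rewrite /par => pa; pose m := (valz a %/ 2)%Z.
  have em : valz a = m * 2 by rewrite /m; lia.
  have [c [c0 vc]] : exists c, c != 0 /\ valz c = m.
    have h (j : nat) : t ^+ j != 0 /\ valz (t ^+ j) = j%:Z.
      by rewrite expf_neq0 // valX // vt1 mul1r.
    case: (m) => j; first by exists (t ^+ j); apply: h.
    exists (t ^+ j.+1)^-1; have [h1 h2] := h j.+1.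
    by rewrite invr_eq0 h1 valV // h2.
  have [|s [es|es]] := units (a / c ^+ 2).
  + have ic0 : (c ^+ 2)^-1 != 0 by rewrite invr_eq0 expf_neq0.
    by apply/andP; split; [apply: mulf_neq0 | rewrite valM // valV ?expf_neq0 // valX // vc em addrN].
  + by exists (s * c); left; rewrite exprMn -es divfK // expf_neq0.
  + by exists (s * c); right; rewrite exprMn mulrAC -es divfK // expf_neq0.
(* If -1 = s^2, then - u s^2 = u. Otherwise u is - s^2 for some s, and a representation of -1 as a
   sum of two squares is scaled by s. *)
- have [[s es]|n1] := pselect (exists s, s ^+ 2 = -1 :> k).
    exists 0, s; rewrite es; ring.
  have un1 : vunit (-1) by rewrite vunitN vunit1.
  have nn1 : nonsquare (-1) by move=> s es; apply: n1; exists s.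
  have no_sqrt_N1 s : ~~ vge 1 (-1 - s ^+ 2).
    apply/negP => h; have us2 : vunit (s ^+ 2) by apply: vunit_congr un1 _; rewrite vge1_sym.
    have us := vunit_sqrt us2.
    by have [r] := hensel_sqrt us h; apply: nn1.
  have [x [y exy]] : exists x y : k, x ^+ 2 + y ^+ 2 = -1.
    (* The least nonsquare natural number is a square plus one, and its product with -1 is a square
       r^2; dividing by r^2 gives -1. It exists since p - 1 is congruent to the nonsquare -1. *)
    pose P j := `[< forall s : k, s ^+ 2 <> j%:R >].
    have exP : exists j, P j.
      exists p.-1; apply/asboolP => s es; have /negP[] := no_sqrt_N1 s.
      have e : (p%:R : k) = 1 + p.-1%:R.
        by rewrite -[1]/(1%:R) -natrD add1n prednK //; case: hp => /prime_gt0.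
      by rewrite es (_ : _ - _ = - p%:R) ?vgeN ?vge_p // e opprD.
    case: (ex_minnP exP) => -[|j] /asboolP nj minj.
      by case: (nj 0); rewrite expr0n.
    have [s es] : exists s : k, s ^+ 2 = j%:R.
      have [//|ns] := pselect (exists s : k, s ^+ 2 = j%:R).
      have /minj : P j by apply/asboolP => s es; apply: ns; exists s.
      by rewrite ltnn.
    pose w : k := s ^+ 2 + 1; have nw : nonsquare w by rewrite /w es natr1.
    have uw : vunit w.
      have n1w : ~~ vge 1 w.
        by apply: contra (no_sqrt_N1 s) => h; rewrite -opprD vgeN addrC.
      have : vge 0 w by rewrite /w es natr1 vge_nat.
      move: n1w; rewrite /vge /vunit; case: eqP => //= _ h1 h2.
      by rewrite eq_le h2 andbT -ltzD1 add0r ltNge.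
    have [r er] := hu (-1) w un1 uw nn1 nw.
    have r0 : r != 0.
      apply: contraTneq uw => r0; move: er; rewrite r0 expr0n mulN1r => /esym/eqP.
      by rewrite oppr_eq0 => /eqP->; rewrite /vunit eqxx.
    exists (s / r), (1 / r); rewrite !expr_div_n -mulrDl er expr1n -/w.
    have w0 : w != 0 by case/andP: uw.
    by field; rewrite w0 oppr_eq0 oner_neq0.
  have [s es] := hu u (-1) uu un1 nu nn1.
  have eu : u = - s ^+ 2 by rewrite es; ring.
  exists (s * x), y; rewrite eu.
  rewrite (_ : _ - _ = s ^+ 2 * (x ^+ 2 + y ^+ 2)); last by ring.
  by rewrite exy mulrN1.
Qed.
End LocalField.
Print Assumptions local_square_classes.

(** * The Witt group *)

(* The Witt group of the residue field: a class is the pair of its parity and of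
   its signed discriminant, and eta says whether -1 is a non-square. *)
Definition witt1 : Type := bool * bool.

(* W(k) is the sum of two copies of the Witt group of the residue field. *)
Definition witt : Type := witt1 * witt1.

(** Signed discriminants multiply, with an extra factor -1 when both dimensions are odd. The group
    is cyclic of order 4 if -1 is a nonsquare and a Klein four-group otherwise. *)
Definition wadd1 (eta : bool) (x y : witt1) : witt1 :=
  (x.1 (+) y.1, x.2 (+) y.2 (+) [&& eta, x.1 & y.1]).
Definition wopp1 (eta : bool) (x : witt1) : witt1 := (x.1, x.2 (+) (eta && x.1)).
Definition wadd eta (x y : witt) : witt := (wadd1 eta x.1 y.1, wadd1 eta x.2 y.2).
Definition wopp eta (x : witt) : witt := (wopp1 eta x.1, wopp1 eta x.2).
Definition w0 : witt := ((false, false), (false, false)).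

(** Dimension of the anisotropic form in the class: a residue form of dimension at least 3 is
    isotropic, and one of dimension 2 is anisotropic iff its signed discriminant is a nonsquare. *)
Definition adim1 (x : witt1) : nat := if x.1 then 1 else (x.2).*2.
Definition adim (w : witt) : nat := adim1 w.1 + adim1 w.2.

Lemma waddA eta x y z : wadd eta x (wadd eta y z) = wadd eta (wadd eta x y) z.
Proof. by case: eta x y z => -[[[] []] [[] []]] [[[] []] [[] []]] [[[] []] [[] []]]. Qed.

Lemma waddC eta x y : wadd eta x y = wadd eta y x.
Proof. by case: eta x y => -[[[] []] [[] []]] [[[] []] [[] []]]. Qed.

Lemma wadd0 eta x : wadd eta x w0 = x.
Proof. by case: eta x => -[[[] []] [[] []]]. Qed.

Lemma w0add eta x : wadd eta w0 x = x.
Proof. by rewrite waddC wadd0. Qed.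

Lemma waddN eta x : wadd eta x (wopp eta x) = w0.
Proof. by case: eta x => -[[[] []] [[] []]]. Qed.

Lemma wopp_add eta x y : wopp eta (wadd eta x y) = wadd eta (wopp eta x) (wopp eta y).
Proof. by case: eta x y => -[[[] []] [[] []]] [[[] []] [[] []]]. Qed.

Lemma wadd_eq0 eta x y : wadd eta x (wopp eta y) = w0 -> x = y.
Proof. by case: eta x y => -[[[] []] [[] []]] [[[] []] [[] []]]. Qed.

Lemma adim_eq0 w : adim w = 0%N -> w = w0.
Proof. by case: w => -[[] []] [[] []]. Qed.

Section WittClasses.
Variables (k : fieldType) (u t : k) (par : k -> bool).
Hypothesis sqc : square_classes u t par.
Implicit Types (a b c : k) (s : seq k).

Let two0 := sqc_two sqc.
Let u0 := sqc_u sqc.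
Let t0 := sqc_t sqc.

Definition nsq a : bool := `[< nonsquare a >].
Definition nsqN1 : bool := nsq (-1).
Definition evenv a : bool := (a != 0) && ~~ par a.

(** For odd valuation the second residue is that of a / t, which has the square class of a t. *)
Definition cls a : witt :=
  if par a then ((false, false), (true, nsq (a * t)))
  else ((true, nsq a), (false, false)).

Definition wsum s : witt := foldr (fun a w => wadd nsqN1 (cls a) w) w0 s.

Lemma nsq_square x : nsq (x ^+ 2) = false.
Proof. by apply/asboolPn => /(_ x). Qed.

Lemma nsq_u : nsq u.
Proof. by apply/asboolP => s; apply: (sqc_nsq sqc). Qed.

Lemma nsqZ x a : x != 0 -> nsq (x ^+ 2 * a) = nsq a.
Proof.
move=> x0; apply/asboolP/asboolP => h s es; last first.
  by apply: (h (s / x)); rewrite expr_div_n es; field.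
by apply: (h (x * s)); rewrite exprMn es.
Qed.

Lemma par1 : par 1 = false.
Proof.
have n1 := oner_neq0 k; have := sqc_parM sqc n1 n1.
by rewrite mulr1; case: (par 1).
Qed.

Lemma parX2 a : a != 0 -> par (a ^+ 2) = false.
Proof. by move=> a0; rewrite expr2 (sqc_parM sqc) // addbb. Qed.

Lemma parN a : par (- a) = par a.
Proof.
have [->|a0] := eqVneq a 0; first by rewrite oppr0.
by rewrite -mulN1r (sqc_parM sqc) ?oppr_eq0 ?oner_neq0 // (sqc_parN1 sqc).
Qed.

Lemma evenvM a b : evenv a -> evenv b -> evenv (a * b).
Proof.
case/andP=> a0 pa /andP[b0 pb]; rewrite /evenv mulf_neq0 //= (sqc_parM sqc) //.
by rewrite (negPf pa) (negPf pb).
Qed.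

Lemma evenvN a : evenv (- a) = evenv a.
Proof. by rewrite /evenv oppr_eq0 parN. Qed.

Lemma evenv1 : evenv 1. Proof. by rewrite /evenv oner_neq0 par1. Qed.
Lemma evenvu : evenv u. Proof. by rewrite /evenv u0 (sqc_paru sqc). Qed.

Lemma evenv_repr a : evenv a -> exists z, z != 0 /\ a = z ^+ 2 * (if nsq a then u else 1).
Proof.
case/andP=> a0 pa; have [s [es|es]] := sqc_even sqc a0 pa; exists s.
  have s0 : s != 0 by apply: contraNneq a0 => s0; rewrite es s0 expr0n.
  by rewrite s0 es nsq_square mulr1.
have s0 : s != 0 by apply: contraNneq a0 => s0; rewrite es s0 expr0n mul0r.
by rewrite s0 es nsqZ // nsq_u.
Qed.

Lemma nsqM a b : evenv a -> evenv b -> nsq (a * b) = nsq a (+) nsq b.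
Proof.
move=> ea eb; have [x [x0 ex]] := evenv_repr ea; have [y [y0 ey]] := evenv_repr eb.
rewrite {1}ex {1}ey mulrACA -exprMn nsqZ ?mulf_neq0 //.
case: (nsq a); case: (nsq b); rewrite ?mulr1 ?mul1r ?nsq_u //.
  by rewrite -expr2 nsq_square.
by rewrite -(expr1n _ 2) nsq_square.
Qed.

Lemma nsqN a : evenv a -> nsq (- a) = nsqN1 (+) nsq a.
Proof. by move=> ea; rewrite -mulN1r nsqM // evenvN evenv1. Qed.

Lemma cls_opp a : a != 0 -> cls (- a) = wopp nsqN1 (cls a).
Proof.
move=> a0; rewrite /cls parN; case: ifP => pa; rewrite /wopp /wopp1 /=.
  rewrite mulNr nsqN ?andbT ?andbF ?addbF //; first by rewrite addbC.
  by rewrite /evenv mulf_neq0 // (sqc_parM sqc) // pa (sqc_part sqc).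
by rewrite nsqN ?andbT ?andbF /evenv ?a0 ?pa // addbC.
Qed.

Lemma wsum_cat s s' : wsum (s ++ s') = wadd nsqN1 (wsum s) (wsum s').
Proof. by elim: s => [|a s IHs] /=; rewrite ?w0add // IHs waddA. Qed.

Lemma wsum_opp s : 0 \notin s -> wsum [seq - a | a <- s] = wopp nsqN1 (wsum s).
Proof.
elim: s => [_|a s IHs] /=; first by rewrite /wopp /wopp1 /= andbF.
rewrite inE negb_or eq_sym => /andP[a0 s0].
by rewrite IHs // cls_opp // wopp_add.
Qed.

Definition anis1 (x : witt1) : seq k :=
  if x.1 then [:: if x.2 then u else 1] else if x.2 then [:: 1; - u] else [::].
Definition anis (w : witt) : seq k := anis1 w.1 ++ [seq t * a | a <- anis1 w.2].
Definition hyps (m : nat) : seq k := flatten (nseq m [:: 1; - 1]).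

Lemma size_anis w : size (anis w) = adim w.
Proof. by rewrite size_cat size_map; case: w => -[[] []] [[] []]. Qed.

Lemma size_hyps m : size (hyps m) = m.*2.
Proof. by rewrite /hyps; elim: m => //= m ->. Qed.

Lemma hypsD m m' : hyps (m + m') = hyps m ++ hyps m'.
Proof. by rewrite /hyps nseqD flatten_cat. Qed.

Lemma anis_neq0 w : 0 \notin anis w.
Proof.
have h1 x : 0 \notin anis1 x.
  case: x => -[] []; rewrite /anis1 ?inE //= ?negb_or 1?eq_sym ?u0 ?oner_neq0 //=.
  by rewrite eq_sym oppr_eq0 u0.
rewrite mem_cat negb_or h1; apply/mapP => -[a ha] /esym/eqP.
by rewrite mulf_eq0 (negPf t0) => /eqP a0; move: (h1 w.2); rewrite -a0 ha.
Qed.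

Lemma hyps_neq0 m : 0 \notin hyps m.
Proof.
rewrite /hyps; elim: m => //= m IHm.
by rewrite !inE !negb_or IHm [0 == 1]eq_sym [0 == -1]eq_sym oppr_eq0 oner_neq0.
Qed.

Lemma ceq_evenv a b : evenv a -> evenv b -> nsq a = nsq b -> ceq [:: a] [:: b].
Proof.
move=> ea eb e; have [x [x0 ->]] := evenv_repr ea; have [y [y0 ->]] := evenv_repr eb.
by rewrite e; apply: ceq_trans (ceq_sym (ceq_square _ x0)) (ceq_square _ y0).
Qed.

Lemma ceq_evenv2 a b a' b' : evenv a -> evenv b -> evenv a' -> evenv b' ->
  nsq a = nsq a' -> nsq b = nsq b' -> ceq [:: a; b] [:: a'; b'].
Proof.
move=> ea eb ea' eb' e e'; rewrite -[[:: a; b]]/([:: a] ++ [:: b]).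
by rewrite -[[:: a'; b']]/([:: a'] ++ [:: b']); apply: ceq_cat; apply: ceq_evenv.
Qed.

(* The norm form <1, -u> is universal on units, hence <1, -u> = <u, -1>. *)
Lemma ceq_norm : ceq [:: 1; - u] [:: u; -1].
Proof.
have [x [y e]] := sqc_norm sqc.
have := @ceq_binary _ 1 (- u) x y.
rewrite mul1r mulNr e mul1r oppr_eq0 oner_neq0 => /(_ u0 isT u0) h.
apply: ceq_trans h _; apply: ceq_evenv2; rewrite ?evenvM ?evenvN ?evenvu ?evenv1 //.
by rewrite mulNr nsqN ?evenvM ?evenvu // -expr2 nsq_square addbF.
Qed.

(** The signed discriminant - a b decides: a square gives the hyperbolic plane, a nonsquare the norm
    form x^2 - u y^2. *)
Lemma ceq_pair a b : evenv a -> evenv b ->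
  ceq [:: a; b] (if nsqN1 (+) nsq a (+) nsq b then [:: 1; - u] else [:: 1; - 1]).
Proof.
move=> ea eb; case: ifP => h.
  have e : nsq b = nsqN1 (+) ~~ nsq a by move: h; case: nsqN1; case: (nsq a); case: (nsq b).
  case na : (nsq a) e => /= e.
    apply: ceq_trans (ceq_sym ceq_norm).
    by apply: ceq_evenv2; rewrite ?evenvN ?evenvu ?evenv1 ?nsq_u // e addbF.
  apply: ceq_evenv2; rewrite ?evenvN ?evenvu ?evenv1 ?nsqN ?evenvu ?nsq_u ?na //.
  by rewrite -(expr1n _ 2) nsq_square.
have a0 : a != 0 by case/andP: ea.
apply: ceq_trans (ceq_hyperbolic two0 a0); apply: ceq_evenv2; rewrite ?evenvN // nsqN //.
by move: h; case: nsqN1; case: (nsq a); case: (nsq b).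
Qed.

Lemma ceq_unit_cons c x : evenv c -> exists m,
  ceq (c :: anis1 x) (anis1 (wadd1 nsqN1 (true, nsq c) x) ++ hyps m).
Proof.
move=> ec; have n1 : nsq 1 = false by rewrite -(expr1n _ 2) nsq_square.
have one : ceq [:: c] [:: if nsq c then u else 1].
  by apply: ceq_evenv => //; case: (nsq c); rewrite ?evenvu ?evenv1 ?nsq_u ?n1.
case: x => -[] b; rewrite /wadd1 /anis1 /=.
- set y := (if b then u else 1).
  have ey : evenv y by rewrite /y; case: (b); rewrite ?evenvu ?evenv1.
  have ny : nsq y = b by rewrite /y; case: (b); rewrite ?nsq_u ?n1.
  have := ceq_pair ec ey; rewrite ny (_ : nsqN1 (+) _ (+) _ = nsq c (+) b (+) (nsqN1 && true)).
    by case: ifP => _ h; [exists 0%N; rewrite cats0|exists 1%N].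
  by case: nsqN1; case: (nsq c); case: (b).
- rewrite andbF addbF; case: b => /=; last by exists 0%N; rewrite ?addbF; apply: one.
  (* <1, -u> is replaced by <-c, u c>, whose signed discriminant is also u up to squares; then <c,
     -c> splits off. *)
  exists 1%N; apply: (ceq_trans (t := [:: c; - c; u * c])).
    apply: (@ceq_cat _ [:: c] [:: c]); first exact: ceq_refl.
    apply: ceq_sym; have enc : evenv (- c) by rewrite evenvN.
    have := ceq_pair enc (evenvM evenvu ec); rewrite nsqN // nsqM ?evenvu // nsq_u.
    by case: nsqN1; case: (nsq c).
  apply: (ceq_trans (t := [:: 1; - 1] ++ [:: u * c])).
    apply: (@ceq_cat _ [:: c; - c] _ [:: u * c]); last exact: ceq_refl.
    by apply: ceq_hyperbolic => //; case/andP: ec.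
  apply: (ceq_trans (t := [:: u * c] ++ [:: 1; - 1])).
    by apply: ceq_perm; rewrite perm_catC.
  apply: (@ceq_cat _ [:: u * c] [:: _] [:: 1; -1] [:: 1; -1]); last exact: ceq_refl.
  apply: ceq_evenv; rewrite ?evenvM ?evenvu //; last first.
    by rewrite nsqM ?evenvu // nsq_u; case: (nsq c) => /=; rewrite ?nsq_u ?n1.
  by case: (nsq c) => /=; rewrite ?evenvu ?evenv1.
Qed.

Lemma ceq_scale_hyps c m : c != 0 -> ceq [seq c * a | a <- hyps m] (hyps m).
Proof.
move=> c0; elim: m => [|m IHm]; first exact: ceq_refl.
rewrite -[m.+1]add1n hypsD map_cat; apply: ceq_cat IHm => /=.
by rewrite mulr1 mulrN1; apply: ceq_hyperbolic.
Qed.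

(** Explicit Witt decomposition. A coefficient a of odd valuation equals t (a t) up to a square, and
    a t is absorbed into the second residue form before that form is rescaled by t. *)
Lemma ceq_canonical s : 0 \notin s -> exists m, ceq s (anis (wsum s) ++ hyps m).
Proof.
elim: s => [_|a s IHs]; first by exists 0%N; apply: ceq_refl.
rewrite inE negb_or eq_sym => /andP[a0 /IHs[m hm]] /=.
set w := wsum s in hm *.
have step : ceq (a :: s) ([:: a] ++ (anis w ++ hyps m)).
  by apply: (@ceq_cat _ [:: a]); [apply: ceq_refl|].
rewrite /cls; case: ifP => pa.
  have ec : evenv (a * t) by rewrite /evenv mulf_neq0 // (sqc_parM sqc) // pa (sqc_part sqc).
  have [m' hm'] := ceq_unit_cons w.2 ec.
  exists (m' + m)%N; apply: ceq_trans step _.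
  have ta : ceq [:: a] [:: t * (a * t)].
    by rewrite (_ : t * (a * t) = t ^+ 2 * a); [apply: ceq_square | ring].
  apply: ceq_trans (ceq_cat ta (ceq_refl _)) _.
  rewrite /anis hypsD -!catA /wadd /= (_ : wadd1 _ (false, false) _ = w.1); last first.
    by rewrite /wadd1 /= andbF addbF; case: (w.1).
  apply: (ceq_trans (t := anis1 w.1 ++ ([seq t * a | a <- (a * t) :: anis1 w.2] ++ hyps m))).
    by apply: ceq_perm; rewrite /= -[X in perm_eq X _]cat1s perm_catCA.
  apply: ceq_cat; first exact: ceq_refl.
  rewrite catA; apply: ceq_cat; last exact: ceq_refl.
  apply: ceq_trans (ceq_scale t hm') _; rewrite map_cat.
  by apply: ceq_cat; [apply: ceq_refl | apply: ceq_scale_hyps].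
have ec : evenv a by rewrite /evenv a0 pa.
have [m' hm'] := ceq_unit_cons w.1 ec.
exists (m' + m)%N; apply: ceq_trans step _.
rewrite /anis hypsD -!catA /wadd /= (_ : wadd1 _ (false, false) _ = w.2); last first.
  by rewrite /wadd1 /= andbF addbF; case: (w.2).
rewrite -[a :: _]/((a :: anis1 w.1) ++ _); apply: ceq_trans (ceq_cat hm' (ceq_refl _)) _.
rewrite -catA; apply: ceq_cat; first exact: ceq_refl.
by apply: ceq_perm; rewrite perm_catCA.
Qed.

Lemma size_canonical s m : ceq s (anis (wsum s) ++ hyps m) ->
  size s = (adim (wsum s) + m.*2)%N.
Proof.
move=> /(_ 1%N isT)/iso_dim; rewrite !qdim_dsum1 => ->.
by rewrite size_cat size_anis size_hyps.
Qed.

Lemma ceq_of_wsum s s' : 0 \notin s -> 0 \notin s' -> size s = size s' ->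
  wsum s = wsum s' -> ceq s s'.
Proof.
move=> /ceq_canonical[m hm] /ceq_canonical[m' hm'] es ew.
have : (m.*2 = m'.*2)%N.
  by have := es; rewrite (size_canonical hm) (size_canonical hm') ew => /addnI.
move/double_inj => em; apply: ceq_trans hm _; rewrite ew em.
exact: ceq_sym.
Qed.
End WittClasses.

(** * Isotropic subspaces and Witt invariants *)

Section Isotropy.
Variable k : fieldType.
Implicit Types (x y : qmod k) (s : seq k).

Definition isotropic_rank x (r : nat) : Prop :=
  exists m (U : 'M_(m, qdim x)), U *m qgram x *m U^T = 0 /\ (r <= \rank U)%N.

Definition anisotropic_gram x : Prop :=
  forall z : 'rV_(qdim x), (z *m qgram x *m z^T) 0 0 = 0 -> z = 0.

Lemma isotropic_rankW x r r' : (r' <= r)%N -> isotropic_rank x r -> isotropic_rank x r'.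
Proof. by move=> le [m [U [U0 rU]]]; exists m, U; split=> //; apply: leq_trans rU. Qed.

Lemma iso_isotropic_rank x y r : iso x y -> isotropic_rank x r -> isotropic_rank y r.
Proof.
case=> P [Q [PQ QP _ PG]] [m [U [U0 rU]]]; exists m, (U *m P); split.
  by rewrite trmx_mul -U0 -PG !mulmxA.
by rewrite mxrankMfree //; apply/row_freeP; exists Q.
Qed.

Lemma isotropic_rank_osum x y r r' :
  isotropic_rank x r -> isotropic_rank y r' -> isotropic_rank (osum x y) (r + r').
Proof.
move=> [m [U [U0 rU]]] [m' [U' [U0' rU']]]; exists (m + m')%N, (block_mx U 0 0 U'); split=> /=.
  rewrite tr_block_mx !mulmx_block !(mulmx0, mul0mx, addr0, add0r, trmx0) U0 U0'.
  exact: block_mx0.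
by rewrite rank_diag_block_mx leq_add.
Qed.

Lemma anisotropic_isotropic_rank x : anisotropic_gram x -> ~ isotropic_rank x 1.
Proof.
move=> ax [m [U [U0]]]; apply/negP; rewrite -ltnNge ltnS leqn0 mxrank_eq0; apply/eqP.
apply/row_matrixP => i; rewrite row0; apply: ax.
by rewrite -mx_entry_rows U0 mxE.
Qed.

(** Keep the vectors of U orthogonal to an isotropic line of the plane and project them to x. Either
    U is orthogonal to that line, or the condition costs one dimension and U does not contain the
    line; at most one dimension is lost in both cases. *)
Lemma isotropic_rank_hyperbolic x r :
  isotropic_rank (osum (dsum 1 [:: 1; -1]) x) r.+1 -> isotropic_rank x r.
Proof.
set H := dsum 1 _; move=> [m [U []]].
rewrite -[U]hsubmxK /= -/H; set A := lsubmx U; set B := rsubmx U.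
rewrite tr_row_mx mul_row_block mul_row_col !mulmx0 addr0 add0r.
(* e spans an isotropic line, f is its Gram image, and inside the plane the orthogonal of e is that
   line. *)
pose e : 'rV[k]_(qdim H) := row_mx 1%:M (row_mx 1%:M 0).
pose f : 'cV[k]_(qdim H) := col_mx 1%:M (col_mx (- 1%:M) 0).
have GHe : qgram H *m e^T = f.
  rewrite /H qgram_dsum1 [qgram (dsum 1 [:: -1])]qgram_dsum1 /e !tr_row_mx.
  rewrite !mul_block_col !(mul0mx, mulmx0, addr0, add0r, trmx0) !tr_scalar_mx !mulmx1 /f.
  by congr col_mx; congr col_mx; rewrite raddfN.
have eH (y : 'rV_(qdim H)) : y *m f = 0 -> exists c, y = c *: e.
  rewrite -[y]hsubmxK; set y1 := lsubmx y; set y' := rsubmx y.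
  rewrite -[y']hsubmxK; set y2 := lsubmx y'; set y3 := rsubmx y'.
  rewrite /f !mul_row_col mulmx0 addr0 mulmxN !mulmx1 => /eqP; rewrite subr_eq0 => /eqP e12.
  exists (y1 0 0); rewrite /e !scale_row_mx -e12 scaler0 [y3]thinmx0.
  by rewrite scale_scalar_mx mulr1 -mx11_scalar.
have rowE p (C : 'M_(p, qdim H)) : C *m f = 0 -> exists c : 'cV_p, C = c *m e.
  move=> Cf; have h i : exists c, row i C = c *: e by apply: eH; rewrite -row_mul Cf row0.
  exists (\col_i projT1 (cid (h i))); apply/row_matrixP => i; rewrite row_mul.
  rewrite (projT2 (cid (h i))) [row i (\col__ _)]mx11_scalar mul_scalar_mx.
  by rewrite !mxE.
have ef : e *m f = 0.
  by rewrite /e /f !mul_row_col mulmx0 addr0 mulmxN !mulmx1 addrN.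
set phi := A *m f => iso0 rU.
have isoK p (K : 'M_(p, m)) : K *m phi = 0 -> K *m B *m qgram x *m (K *m B)^T = 0.
  rewrite /phi mulmxA => /rowE[c Kc].
  have KA0 : (K *m A) *m qgram H *m (K *m A)^T = 0.
    by rewrite Kc trmx_mul -!mulmxA (mulmxA (qgram H)) GHe (mulmxA e) ef mul0mx mulmx0.
  apply: etrans (_ : K *m (A *m qgram H *m A^T + B *m qgram x *m B^T) *m K^T = _).
    rewrite mulmxDr mulmxDl [X in _ = X + _](_ : _ = 0) ?add0r.
      by rewrite trmx_mul !mulmxA.
    by rewrite -KA0 trmx_mul !mulmxA.
  by rewrite iso0 mulmx0 mul0mx.
(* phi records the products of U with e. If it vanishes, the kernel of the projection is at most the
   line of e. *)
have [phi0|phi_neq0] := eqVneq phi 0.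
  exists m, B; split; first by have := @isoK m 1%:M; rewrite mul1mx !mul1mx => ->.
  have [c ec] := rowE _ _ phi0.
  rewrite -ltnS; apply: leq_trans rU _.
  have -> : row_mx A B = row_mx A 0 + row_mx 0 B by rewrite add_row_mx addr0 add0r.
  apply: leq_trans (mxrank_add _ _) _; rewrite rank_row_mx0 rank_row_0mx -[X in (_ <= X)%N]add1n leq_add2r.
  by rewrite ec; apply: leq_trans (mxrankM_maxr _ _) (rank_leq_row _).
pose K := kermx phi; exists m, (K *m B); split; first exact/isoK/mulmx_ker.
have rK : (\rank K = m - 1)%N.
  rewrite mxrank_ker; congr (_ - _)%N; apply/eqP.
  by rewrite eqn_leq rank_leq_col lt0n mxrank_eq0.
have rphi : (0 < m)%N.
  by rewrite lt0n; apply: contraNneq phi_neq0 => m0; apply/eqP/matrixP => i; have := ltn_ord i; rewrite [X in (_ < X)%N]m0.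
have le1 : (r <= \rank (K *m row_mx A B))%N.
  apply: leq_trans (mxrank_mul_min K (row_mx A B)); rewrite rK.
  by move: rU rphi; move: (\rank _) => R; clear; lia.
apply: leq_trans le1 _; rewrite -[X in (_ <= X)%N]mxrank_tr.
suff : (kermx (K *m B) <= kermx (K *m row_mx A B))%MS.
  by move/mxrankS; rewrite !mxrank_ker mxrank_tr; have := rank_leq_row (K *m row_mx A B); lia.
apply/sub_kermxP; set Z := kermx _; have ZB : Z *m K *m B = 0 by rewrite -mulmxA mulmx_ker.
have Kphi : K *m phi = 0 by apply: mulmx_ker.
clearbody Z; clearbody K.
have [c ec] : exists c, Z *m K *m A = c *m e.
  by apply: rowE; rewrite -mulmxA -/phi -mulmxA Kphi mulmx0.
(* A multiple of e in the span of U is orthogonal to U; as phi is nonzero the multiple is zero, so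
   the projection is injective on the kept vectors. *)
have c0 : c = 0.
  have : Z *m K *m (A *m qgram H *m A^T + B *m qgram x *m B^T) = 0 by rewrite iso0 mulmx0.
  rewrite mulmxDr !mulmxA ZB !mul0mx addr0 ec => cphi.
  have /matrix0Pn[i [j phi_ij]] := phi_neq0.
  have : (c *m phi^T) = 0.
    have sH : (qgram H)^T = qgram H.
      have [] // := @nform_skew_nilpotent k [:: (1%N, 1); (1%N, -1)].
      by rewrite /valid_pieces /= oppr_eq0 oner_neq0.
    by apply: etrans cphi; rewrite /phi trmx_mul -GHe trmx_mul trmxK sH !mulmxA.
  move=> /matrixP h; apply/matrixP => a b; have := h a i.
  rewrite !mxE big_ord1 mxE [b]ord1 => /eqP.
  by rewrite mulf_eq0 -[X in phi i X](ord1 j) (negPf phi_ij) orbF => /eqP.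
by rewrite mulmxA mul_mx_row ZB ec c0 mul0mx row_mx0.
Qed.

Lemma isotropic_rank_hyps x m r :
  isotropic_rank (osum (dsum 1 (hyps k m)) x) (m + r) -> isotropic_rank x r.
Proof.
elim: m => [|m IHm]; first by apply: iso_isotropic_rank; apply: osum0x.
move=> h; apply: IHm; rewrite addSn in h; apply: isotropic_rank_hyperbolic.
apply: iso_isotropic_rank h; apply: iso_trans (iso_sym (osumA _ _ _)).
apply: iso_osum (iso_refl _); exact: (dsum_cat 1 [:: 1; -1]).
Qed.

Lemma hyps_isotropic_rank m : isotropic_rank (dsum 1 (hyps k m)) m.
Proof.
elim: m => [|m IHm]; first by exists 0%N, 0; rewrite !mul0mx.
have h : isotropic_rank (dsum 1 [:: 1; -1 : k]) 1.
  exists 1%N, (row_mx 1%:M (row_mx 1%:M 0)); split.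
    rewrite qgram_dsum1 [qgram (dsum 1 [:: -1])]qgram_dsum1 !tr_row_mx.
    rewrite !mul_row_block !mul_row_col !(mul0mx, mulmx0, addr0, add0r, trmx0).
    by rewrite !tr_scalar_mx !mul1mx mul_row_col mulmx0 addr0 mulmx1 raddfN /= addrN.
  rewrite lt0n mxrank_eq0; apply/eqP => /matrixP/(_ 0 0).
  by rewrite !mxE; case: splitP => // j _; rewrite !mxE ord1 eqxx; apply/eqP/oner_neq0.
apply: iso_isotropic_rank (isotropic_rank_osum h IHm).
exact: iso_sym (dsum_cat 1 [:: 1; -1] (hyps k m)).
Qed.
End Isotropy.

(** * Invariance of the Witt class under isometry *)

Section WittInvariant.
Variables (k : fieldType) (u t : k) (par : k -> bool).
Hypothesis sqc : square_classes u t par.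
Implicit Types (a b c : k) (s : seq k) (x y : qmod k).

Let two0 := sqc_two sqc.
Let u0 := sqc_u sqc.
Let t0 := sqc_t sqc.
Local Notation nsqN1 := (nsqN1 k).
Local Notation cls := (cls t par).
Local Notation wsum := (wsum t par).
Local Notation anis := (anis u t).
Local Notation anis1 := (anis1 u).
Local Notation hyps := (hyps k).

Definition qeval (s zs : seq k) : k :=
  foldr (fun p acc => p.1 * p.2 ^+ 2 + acc) 0 (zip s zs).

Lemma qeval_cat s1 s2 z1 z2 : size s1 = size z1 ->
  qeval (s1 ++ s2) (z1 ++ z2) = qeval s1 z1 + qeval s2 z2.
Proof.
move=> e; rewrite /qeval zip_cat // foldr_cat.
by elim: (zip s1 z1) => [|p l IHl] /=; rewrite ?add0r // IHl addrA.
Qed.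

Lemma qeval_scale c s zs : qeval [seq c * a | a <- s] zs = c * qeval s zs.
Proof.
rewrite /qeval; elim: s zs => [|a s IHs] [|z zs] /=; rewrite ?mulr0 //.
by rewrite IHs mulrDr mulrA.
Qed.

Lemma qeval_dsum1 s (z : 'rV_(qdim (dsum 1 s))) : exists zs,
  [/\ size zs = size s, (z *m qgram (dsum 1 s) *m z^T) 0 0 = qeval s zs
    & all (eq_op^~ 0) zs -> z = 0].
Proof.
elim: s z => [|a s IHs] z.
  exists [::]; split=> //; last by move=> _; apply/matrixP => i [].
  by rewrite mxE big_ord0.
rewrite -[z]hsubmxK qgram_dsum1; have [zs [sz ez z0]] := IHs (rsubmx z).
exists (lsubmx z 0 0 :: zs); split=> /=; first by rewrite sz.
  rewrite tr_row_mx mul_row_block mul_row_col !mulmx0 addr0 add0r mxE.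
  rewrite ez; congr (_ + _); rewrite mul_mx_scalar mxE big_ord1 !mxE.
  by move: (z 0 _) => c /=; ring.
case/andP=> /eqP l0 /z0->; rewrite (_ : lsubmx z = 0) ?row_mx0 //.
by apply/matrixP => i j; rewrite !ord1 [RHS]mxE.
Qed.

Lemma qeval_anis1 (x : witt1) (zs : seq k) : size zs = size (anis1 x) ->
  (qeval (anis1 x) zs = 0 -> all (eq_op^~ 0) zs) /\
  (qeval (anis1 x) zs != 0 -> ~~ par (qeval (anis1 x) zs)).
Proof.
have sq c z : c != 0 -> ~~ par c -> (c * z ^+ 2 = 0 -> z == 0) /\
    (c * z ^+ 2 != 0 -> ~~ par (c * z ^+ 2)).
  move=> c0 pc; split; first by move/eqP; rewrite mulf_eq0 expf_eq0 (negPf c0).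
  rewrite mulf_eq0 negb_or expf_eq0 /= => /andP[_ z0].
  by rewrite (sqc_parM sqc) ?expf_neq0 // (parX2 sqc) // addbF.
rewrite /anis1; case: x => -[] b /=.
  case: zs => [|z [|]] //= _; rewrite /qeval /= addr0 andbT.
  by apply: sq; case: (b); rewrite ?u0 ?oner_neq0 ?(sqc_paru sqc) ?(par1 sqc).
case: b => /=; last by case: zs => //= _; rewrite /qeval /= eqxx; split.
case: zs => [|z1 [|z2 [|]]] //= _; rewrite /qeval /= addr0 mul1r mulNr andbT.
split; last exact: (sqc_norm_even sqc).
move/eqP; rewrite subr_eq0 => /eqP e; have [z20|z20] := eqVneq z2 0.
  by move: e => /eqP; rewrite z20 expr0n mulr0 expf_eq0 /= => ->.
by case: (sqc_nsq sqc (s := z1 / z2)); rewrite expr_div_n e; field.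
Qed.

(** Springer's argument: nonzero values q1, q2 of the two residue parts have even valuation, so q1 =
    - t q2 is excluded by parity. *)
Lemma anis_anisotropic w : anisotropic_gram (dsum 1 (anis w)).
Proof.
move=> z; have [zs [sz -> z0]] := qeval_dsum1 z; move=> e; apply: z0; move: e.
rewrite -(cat_take_drop (size (anis1 w.1)) zs).
set z1 := take _ _; set z2 := drop _ _.
have s1 : size z1 = size (anis1 w.1).
  by rewrite size_takel // sz size_cat leq_addr.
have s2 : size z2 = size (anis1 w.2).
  by rewrite size_drop sz size_cat size_map addKn.
rewrite qeval_cat ?s1 // qeval_scale all_cat.
have [a1 b1] := qeval_anis1 s1; have [a2 b2] := qeval_anis1 s2.
set q1 := qeval _ z1 in a1 b1 *; set q2 := qeval _ z2 in a2 b2 *.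
have [q20|q20] := eqVneq q2 0; first by rewrite q20 mulr0 addr0 => /a1->; apply: a2.
move=> e; have e1 : q1 = - (t * q2) by apply/eqP; rewrite -addr_eq0 e.
have q10 : q1 != 0 by rewrite e1 oppr_eq0 mulf_neq0.
have := b1 q10; rewrite e1 (parN sqc) (sqc_parM sqc) // (sqc_part sqc).
by rewrite (negPf (b2 q20)).
Qed.

(** With a nonzero anisotropic part the canonical form has m < r hyperbolic planes, and removing
    them would leave an isotropic vector in an anisotropic form. *)
Lemma wsum_isotropic s r : 0 \notin s -> size s = r.*2 ->
  isotropic_rank (dsum 1 s) r -> wsum s = w0.
Proof.
move=> s0 sr ir; have [m hm] := ceq_canonical sqc s0.
have := size_canonical hm; rewrite sr => es.
apply: adim_eq0; case ew: (adim _) => [//|d]; exfalso.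
have lt_mr : (m < r)%N by rewrite -ltn_double es ew; lia.
apply: (anisotropic_isotropic_rank (@anis_anisotropic (wsum s))).
apply: (isotropic_rankW (r := r - m)); first by rewrite subn_gt0.
apply: (@isotropic_rank_hyps _ _ m); rewrite subnKC; last exact: ltnW.
apply: iso_isotropic_rank ir; apply: iso_trans (hm 1%N isT) _.
exact: iso_trans (dsum_cat _ _ _) (osumC _ _).
Qed.

(** After identifying the two forms, the diagonal is a totally isotropic subspace of half the
    dimension in <s> + <-s'>, so the difference of the classes is zero. *)
Lemma wsum_iso s s' : 0 \notin s -> 0 \notin s' ->
  iso (dsum 1 s) (dsum 1 s') -> wsum s = wsum s'.
Proof.
move=> s0 s0' h; apply: (@wadd_eq0 nsqN1); rewrite -(wsum_opp sqc) // -wsum_cat.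
have N0 : 0 \notin [seq - a | a <- s'].
  by apply/mapP => -[a as' /esym/eqP]; rewrite oppr_eq0 => /eqP a0; rewrite a0 (negPf s0') in as'.
apply: (@wsum_isotropic _ (size s')).
- by rewrite mem_cat negb_or s0.
- by rewrite size_cat size_map -!(qdim_dsum1 _) -(iso_dim h) addnn.
apply: iso_isotropic_rank (iso_sym (dsum_cat _ _ _)) _.
apply: iso_isotropic_rank (iso_osum (iso_sym h) (iso_refl _)) _.
have -> : dsum 1 [seq - a | a <- s'] = scaleG (-1) (dsum 1 s').
  by rewrite -dsum_scale //; congr dsum; apply: eq_map => a; rewrite mulN1r.
exists (qdim (dsum 1 s')), (row_mx 1%:M 1%:M); rewrite /=; split.
  rewrite tr_row_mx mul_row_block mul_row_col !trmx1 !mulmx1 !mulmx0 !mul1mx.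
  by rewrite addr0 add0r scaleN1r addrN.
rewrite -qdim_dsum1; apply: leq_trans (mxrankM_maxl _ (col_mx 1%:M 0)).
by rewrite mul_row_col mulmx1 mulmx0 addr0 mxrank1.
Qed.

Definition nondeg x : Prop := (qgram x)^T = qgram x /\ qgram x \in unitmx.

(** A relation, since a diagonalization is only known to exist; [has_witt_inj] gives uniqueness. *)
Definition has_witt x (w : witt) : Prop :=
  exists s, [/\ 0 \notin s, iso (forgetE x) (dsum 1 s) & wsum s = w].

Lemma forgetE_dsum1 s : forgetE (dsum 1 s) = dsum 1 s.
Proof.
rewrite /forgetE -(qend_dsum1 s); by case: (dsum 1 s).
Qed.

Lemma has_witt_dsum1 s : 0 \notin s -> has_witt (dsum 1 s) (wsum s).
Proof. by move=> s0; exists s; split=> //; rewrite forgetE_dsum1; apply: iso_refl. Qed.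

Lemma has_witt_inj x w w' : has_witt x w -> has_witt x w' -> w = w'.
Proof.
move=> [s [s0 xs <-]] [s' [s0' xs' <-]].
by apply: wsum_iso => //; apply: iso_trans (iso_sym xs) xs'.
Qed.

Lemma has_witt_iso x y w : iso (forgetE x) (forgetE y) -> has_witt y w -> has_witt x w.
Proof. by move=> xy [s [s0 ys e]]; exists s; split=> //; apply: iso_trans xy ys. Qed.

Lemma has_witt_osum x y w w' : has_witt x w -> has_witt y w' ->
  has_witt (osum x y) (wadd nsqN1 w w').
Proof.
move=> [s [s0 xs <-]] [s' [s0' xs' <-]]; exists (s ++ s'); split.
- by rewrite mem_cat negb_or s0.
- by rewrite forgetE_osum; apply: iso_trans (iso_osum xs xs') (iso_sym (dsum_cat _ _ _)).
- by rewrite wsum_cat.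
Qed.

(** Diagonalization is the normal form theorem for the zero endomorphism: its rank is 0, so all
    pieces have size 1. *)
Lemma nondeg_diagonal x : nondeg x ->
  exists s, 0 \notin s /\ iso (forgetE x) (dsum 1 s).
Proof.
case=> sx ux; have sk : skew_nilpotent (forgetE x).
  split=> //=; rewrite ?trmx0 ?mul0mx ?mulmx0 ?oppr0 //.
  by exists 1%N; rewrite expr1.
have [l [vl hl]] := normal_form_exists two0 sk.
have all1 : all (fun p => p.1 == 1%N) l.
  have := iso_rank 1 (iso_forgetG hl); rewrite (iso_rank 1 (forgetG_nform l)) /= expr1.
  rewrite rank_jordan_sum mxrank0 => /esym/eqP; rewrite sum_nat_seq_eq0 => /allP h.
  apply/allP => -[d a] pl /=; have /andP[/= d0 _] := allP vl _ pl.
  have := h d; rewrite subn_eq0 /= => h'; rewrite eqn_leq d0 andbT; apply: h'.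
  apply/flattenP; exists (if odd d then [:: d] else [:: d; d]).
    by apply/mapP; exists (d, a).
  by case: ifP; rewrite !inE eqxx.
have el : l = [seq (1%N, a) | a <- [seq p.2 | p <- l]].
  rewrite -map_comp -[LHS]map_id; apply/eq_in_map => -[d a] pl /=.
  by have /eqP /= -> := allP all1 _ pl.
exists [seq p.2 | p <- l]; split; last by rewrite /dsum -el.
by apply/mapP => -[p pl p0]; have /andP[_] := allP vl _ pl; rewrite -p0 eqxx.
Qed.

Lemma has_witt_exists x : nondeg x -> exists w, has_witt x w.
Proof. by move=> /nondeg_diagonal[s [s0 h]]; exists (wsum s), s. Qed.

Lemma has_witt_isotropic x r : nondeg x -> qdim x = r.*2 -> isotropic_rank x r ->
  has_witt x w0.
Proof.
move=> /nondeg_diagonal[s [s0 h]] dx ir; exists s; split=> //.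
have irE : isotropic_rank (forgetE x) r by [].
apply: (@wsum_isotropic _ r) => //; last exact: iso_isotropic_rank h irE.
by rewrite -(qdim_dsum1 s) -(iso_dim h).
Qed.

Lemma nondeg_iso_witt x y w : nondeg x -> nondeg y -> qdim x = qdim y ->
  has_witt x w -> has_witt y w -> iso (forgetE x) (forgetE y).
Proof.
move=> nx ny exy [s [s0 xs e]] [s' [s0' ys e']].
have es : size s = size s' by rewrite -!(qdim_dsum1) -(iso_dim xs) -(iso_dim ys).
have h := ceq_of_wsum sqc s0 s0' es (etrans e (esym e')) (isT : odd 1).
exact: iso_trans xs (iso_trans h (iso_sym ys)).
Qed.
End WittInvariant.

HB.instance Definition _ e :=
  Monoid.isComLaw.Build witt w0 (wadd e) (waddA e) (waddC e) (w0add e).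

(** * Witt class of a normal form *)

Section WittOfNormalForm.
Variables (k : fieldType) (u t : k) (par : k -> bool).
Hypothesis sqc : square_classes u t par.
Implicit Types (a b c : k) (s : seq k) (x y : qmod k) (l : seq (nat * k)).

Local Notation nsqN1 := (nsqN1 k).
Local Notation cls := (cls t par).
Local Notation wsum := (wsum t par).
Local Notation has_witt := (has_witt t par).
Local Notation T := (alt_antidiag k).

(** For odd d this is (-1)^((d-1)/2), the middle entry of T_d. *)
Definition piece_sign d : k := (-1) ^+ d./2.

Lemma piece_sign_neq0 d : piece_sign d != 0.
Proof. by rewrite /piece_sign signr_eq0. Qed.

Lemma piece_nondeg p : p.2 != 0 -> nondeg (piece p : qmod k).
Proof. by move=> p0; have [h1 h2 _ _] := piece_skew p; split=> //; apply: h2. Qed.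

Lemma osum_nondeg x y : nondeg x -> nondeg y -> nondeg (osum x y).
Proof.
case=> sx ux [sy uy]; split=> /=; first by rewrite tr_block_mx !trmx0 sx sy.
by rewrite unitmxE det_ublock unitrM -!unitmxE ux uy.
Qed.

Lemma dsum1_nondeg s : 0 \notin s -> nondeg (dsum 1 s).
Proof.
move=> s0; split; last exact: dsum1_unit.
elim: s {s0} => [|a s IHs]; first by rewrite [LHS]flatmx0 [RHS]flatmx0.
by rewrite qgram_dsum1 tr_block_mx !trmx0 tr_scalar_mx IHs.
Qed.

Lemma even_piece_witt (p : nat * k) : ~~ odd p.1 -> p.2 != 0 -> has_witt (piece p) w0.
Proof.
move=> ep p0; apply: (has_witt_isotropic sqc (r := p.1)) (piece_nondeg p0) _ _.
  by rewrite /piece (negPf ep) /= addnn.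
rewrite /piece (negPf ep); exists p.1, (row_mx 1%:M 0) => /=; split.
  by rewrite tr_row_mx mul_row_block mul_row_col !(mul0mx, mulmx0, addr0, add0r, trmx0).
by rewrite rank_row_mx0 mxrank1.
Qed.

(* piece (d, a) + <- e a> is hyperbolic, where e is the sign of the middle entry of T_d:
   the first basis vectors together with the sum of the middle one and the
   added one span a Lagrangian. *)
Lemma odd_piece_witt (p : nat * k) : odd p.1 -> p.2 != 0 ->
  has_witt (piece p) (cls (piece_sign p.1 * p.2)).
Proof.
case: p => d a /= od a0; have np : nondeg (piece (d, a)) by apply: piece_nondeg.
have [w hw] := has_witt_exists sqc np.
pose b := piece_sign d * a; have b0 : b != 0 by rewrite mulf_neq0 // piece_sign_neq0.
have nb : 0 \notin [:: - b] by rewrite inE eq_sym oppr_eq0.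
have hs := has_witt_osum hw (has_witt_dsum1 t par nb).
suff iso0 : has_witt (osum (piece (d, a)) (dsum 1 [:: - b])) w0.
  have := has_witt_inj sqc hs iso0; rewrite /= wadd0 (cls_opp sqc) //.
  by move/wadd_eq0 <-.
have ed : d = (d./2).*2.+1 by rewrite -[LHS]odd_double_half od.
set m := d./2 in ed.
apply: (has_witt_isotropic sqc (r := m.+1)).
- by apply: osum_nondeg => //; apply: dsum1_nondeg.
- by rewrite /piece /= od /=; lia.
rewrite /piece /= od.
have lt_m (i : 'I_m) : (i < d)%N by have := ltn_ord i; lia.
have lt_mid : (m < d)%N by lia.
pose A : 'M[k]_(m, d) := \matrix_(i, j) (j == i :> nat)%:R.
pose B : 'rV[k]_d := delta_mx 0 (Ordinal lt_mid).
have rowA i : row i A = delta_mx 0 (Ordinal (lt_m i)).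
  by apply/rowP => j; rewrite !mxE eqxx.
have entry i j : ((delta_mx 0 i : 'rV_d) *m T d *m (delta_mx 0 j : 'rV_d)^T) 0 0 = T d i j.
  by rewrite -rowE trmx_delta -colE !mxE.
have AA : A *m T d *m A^T = 0.
  apply/matrixP => i j; rewrite mx_entry_rows !rowA entry !mxE /=.
  by rewrite (_ : (_ == d) = false) //; have := ltn_ord i; have := ltn_ord j; lia.
have AB : A *m T d *m B^T = 0.
  apply/matrixP => i j; rewrite mx_entry_rows !rowA [row j B](_ : _ = B); last first.
    by apply/rowP => j'; rewrite !mxE !ord1.
  rewrite entry !mxE /= (_ : (_ == d) = false) //; have := ltn_ord i; lia.
have BA : B *m T d *m A^T = 0.
  apply: trmx_inj; rewrite !trmx_mul trmxK trmx0 alt_antidiag_tr.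
  by rewrite -scalemxAl -scalemxAr mulmxA AB scaler0.
have BB : B *m T d *m B^T = (piece_sign d)%:M.
  apply/matrixP => i j; rewrite !ord1 entry !mxE /= (_ : (_ == d) = true) //; lia.
pose V : 'rV[k]_(1 + 0) := row_mx 1%:M 0.
have VG : V *m qgram (dsum 1 [:: - b]) *m V^T = (- b)%:M.
  rewrite qgram_dsum1 tr_row_mx mul_row_block mul_row_col.
  by rewrite !(mul0mx, mulmx0, addr0, add0r, trmx0) trmx1 mulmx1 mul1mx.
exists (m + 1)%N, (block_mx A 0 B V); split=> /=.
  rewrite tr_block_mx !mulmx_block !(mul0mx, mulmx0, addr0, add0r, trmx0).
  rewrite -!scalemxAr -!scalemxAl AA AB BA VG BB !scaler0.
  by rewrite scale_scalar_mx -raddfD /= /b mulrC addrN raddf0 block_mx0.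
suff : row_free (block_mx A 0 B V) by rewrite /row_free => /eqP->; rewrite addn1.
apply/row_freeP; exists (block_mx A^T 0 0 V^T).
rewrite mulmx_block !(mul0mx, mulmx0, addr0, add0r).
have -> : A *m A^T = 1%:M.
  apply/matrixP => i j; rewrite !mxE (bigD1 (Ordinal (lt_m i))) //= !mxE eqxx mul1r.
  rewrite big1 ?addr0 => [|l ne]; first by rewrite -(inj_eq val_inj).
  rewrite !mxE (_ : (l == i :> nat) = false) ?mul0r //.
  by apply: contraNF ne => /eqP e; apply/eqP/val_inj.
have -> : B *m A^T = 0.
  apply/matrixP => i j; rewrite -rowE !mxE /= (_ : (_ == _ :> nat) = false) //.
  by have := ltn_ord j; lia.
have -> : V *m V^T = 1%:M by rewrite /V tr_row_mx mul_row_col trmx1 mulmx1 mul0mx addr0.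
by rewrite -scalar_mx_block.
Qed.

Definition piece_witt (p : nat * k) : witt :=
  if odd p.1 then cls (piece_sign p.1 * p.2) else w0.

Lemma nform_witt l : valid_pieces l ->
  has_witt (nform l) (\big[wadd nsqN1/w0]_(p <- l) piece_witt p).
Proof.
elim: l => [_|p l IHl /= /andP[/andP[_ p0] vl]].
  by rewrite big_nil; apply: (has_witt_dsum1 t par (s := [::])).
rewrite big_cons; apply: has_witt_osum (IHl vl); rewrite /piece_witt.
by have [op|ep] := boolP (odd p.1); [apply: odd_piece_witt | apply: even_piece_witt].
Qed.

(* The Witt class of the form attached to the parts of size d, with the sign
   it carries in the ambient form. *)
Definition part_witt d l : witt := wsum [seq piece_sign d * a | a <- coeffs d l].

Lemma wsumE s : wsum s = \big[wadd nsqN1/w0]_(a <- s) cls a.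
Proof. by rewrite unlock; elim: s => //= a s ->. Qed.

Lemma part_wittE d l : odd d ->
  part_witt d l = \big[wadd nsqN1/w0]_(p <- l | p.1 == d) piece_witt p.
Proof.
move=> od; rewrite /part_witt wsumE big_map /coeffs big_map big_filter.
by apply: eq_bigr => p /eqP e; rewrite /piece_witt e od.
Qed.

Lemma sum_part_witt (ds : seq nat) l : uniq ds -> all odd ds ->
  (forall p, p \in l -> odd p.1 -> p.1 \in ds) ->
  \big[wadd nsqN1/w0]_(p <- l) piece_witt p =
  \big[wadd nsqN1/w0]_(d <- ds) part_witt d l.
Proof.
move=> uds ods lds.
rewrite [RHS](eq_big_seq (fun d => \big[wadd nsqN1/w0]_(p <- l | p.1 == d) piece_witt p)).
  rewrite (exchange_big_dep xpredT) //= [LHS]big_seq [RHS]big_seq.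
  apply: eq_bigr => p pl; have [op|ep] := boolP (odd p.1).
    rewrite (eq_bigl (pred1 p.1)) => [|d]; last by rewrite /= eq_sym.
    by rewrite -big_filter filter_pred1_uniq ?big_seq1 //; apply: lds.
  by rewrite /piece_witt (negPf ep) big1.
by move=> d dds; apply: part_wittE; apply: (allP ods).
Qed.
End WittOfNormalForm.

(** * Counting solutions in the Witt group *)

Section Counting.
Variable e : bool.
Implicit Types (w x : witt) (ms : seq nat).

Definition witt1_enum : seq witt1 :=
  [:: (false, false); (false, true); (true, false); (true, true)].
Definition witt_enum : seq witt :=
  [seq ((x, y) : witt) | x : witt1 <- witt1_enum, y : witt1 <- witt1_enum].

(* The Witt classes of the nondegenerate forms of dimension m. *)
Definition witt_of_dim m : seq witt :=
  [seq w <- witt_enum | (adim w <= m)%N && (odd (adim w) == odd m)].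

Lemma mem_witt_of_dim m w :
  (w \in witt_of_dim m) = (adim w <= m)%N && (odd (adim w) == odd m).
Proof.
rewrite mem_filter (_ : w \in witt_enum) ?andbT //.
by case: w => -[[] []] [[] []].
Qed.

Lemma uniq_witt_of_dim m : uniq (witt_of_dim m).
Proof. exact: filter_uniq. Qed.

(** A duplicate-free enumeration: its length counts the solutions, and convolution on the group
    becomes induction on ms. *)
Fixpoint witt_solutions ms w : seq (seq witt) :=
  if ms is m :: ms' then
    [seq x :: s | x <- witt_of_dim m, s <- witt_solutions ms' (wadd e w (wopp e x))]
  else if w == w0 then [:: [::]] else [::].

Lemma mem_witt_solutions ms w s : (s \in witt_solutions ms w) =
  all2 (fun x m => x \in witt_of_dim m) s ms && (\big[wadd e/w0]_(x <- s) x == w).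
Proof.
elim: ms w s => [|m ms IHms] w s /=.
  case: s => [|x s] /=; first by rewrite big_nil [w0 == w]eq_sym; case: (w == w0).
  by case: (w == w0).
apply/allpairsPdep/idP => [[x [s' [xm]]]|].
  rewrite IHms => /andP[h /eqP hs] -> /=; rewrite xm h /= big_cons hs.
  by apply/eqP; case: (e) (w) (x) => -[[[] []] [[] []]] [[[] []] [[] []]].
case: s => [|x s'] //= /andP[/andP[xm h]]; rewrite big_cons => /eqP hs.
exists x, s'; split=> //; rewrite IHms h /= -hs; apply/eqP.
by move: (\big[_/_]_(_ <- _) _) => y; case: (e) (y) (x) => -[[[] []] [[] []]] [[[] []] [[] []]].
Qed.

Lemma uniq_witt_solutions ms w : uniq (witt_solutions ms w).
Proof.
elim: ms w => [|m ms IHms] w /=; first by case: ifP.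
apply: allpairs_uniq_dep => [|x _|[x s] [x' s'] _ _ /= [-> ->]] //.
exact: uniq_witt_of_dim.
Qed.

(* womega true is the class of the four-dimensional anisotropic form. *)
Definition womega (b : bool) : witt := if b then ((false, true), (false, true)) else w0.

Definition gam w : int := 2 - (adim w)%:Z.
Definition delta b w : int := (w == womega b)%:Z.

(* In the group ring of W(k) let N_i be the sum of the classes of parity i, f_m
   the sum of the classes of the nondegenerate forms of dimension m, omega the
   class of the four-dimensional anisotropic form and
   g_i = sum of (2 - adim w) [w] over the w of parity i.  Then f_2 = N_0 - omega,
   f_m = N_m for m >= 3 and 2 f_1 = N_1 + g_1, while f_1 g_i = 2 g_(i+1),
   f_2 g_i = g_i and f_m g_i = 0 for m >= 3; eight_count is eight times the
   coefficient of w in f_1^c1 f_2^c2 times c3 factors f_m, m >= 3. *)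
Definition eight_count c1 c2 c3 w : int :=
  if (0 < c3)%N then 4 ^+ c1 * 7 ^+ c2 * 8 ^+ c3
  else if (0 < c1)%N then 4 ^+ c1 * 7 ^+ c2 + 2 * 2 ^+ c1 * gam w
  else 7 ^+ c2 + (-1) ^+ c2 * (8 * delta (odd c2) w - 1).

Local Notation "w - x" := (wadd e w (wopp e x)) : witt_scope.
Delimit Scope witt_scope with W.

Lemma sum_gam1 w : \sum_(x <- witt_of_dim 1) gam (w - x)%W = 2 * gam w.
Proof. by rewrite unlock; case: (e) w => -[[[] []] [[] []]]; vm_compute. Qed.

Lemma sum_gam2 w : \sum_(x <- witt_of_dim 2) gam (w - x)%W = gam w.
Proof. by rewrite unlock; case: (e) w => -[[[] []] [[] []]]; vm_compute. Qed.

(** On odd classes, translation by [womega true] exchanges [adim] 1 and 3, so it changes the sign of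
    [gam]. *)
Lemma sum_delta1 b w : odd (adim w) ->
  \sum_(x <- witt_of_dim 1) 2 * delta b (w - x)%W = 1 + (-1) ^+ b * gam w.
Proof. by rewrite unlock; case: (e) b w => -[] [[[] []] [[] []]]; vm_compute. Qed.

Lemma sum_delta2 b w : ~~ odd (adim w) ->
  \sum_(x <- witt_of_dim 2) delta b (w - x)%W = 1 - delta (~~ b) w.
Proof. by rewrite unlock; case: (e) b w => -[] [[[] []] [[] []]]; vm_compute. Qed.

(** [adim] is at most 4, and at most 3 on odd classes, so from dimension 3 on only parity
    matters. *)
Lemma witt_of_dim_large m : (2 < m)%N ->
  witt_of_dim m = [seq w <- witt_enum | odd (adim w) == odd m].
Proof.
move=> m2; apply/eq_in_filter => w _; have [h|] := ltnP 3 m.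
  by rewrite (leq_trans _ h) //; case: w => -[[] []] [[] []].
move=> m3; have -> : m = 3%N by lia.
by case: w => -[[] []] [[] []].
Qed.

Lemma sum_gam3 m w : (2 < m)%N -> \sum_(x <- witt_of_dim m) gam (w - x)%W = 0.
Proof.
move=> m2; rewrite witt_of_dim_large //; case: (odd m);
by rewrite unlock; case: (e) w => -[[[] []] [[] []]]; vm_compute.
Qed.

Lemma sum_delta3 m b w : (2 < m)%N -> odd (adim w) = odd m ->
  \sum_(x <- witt_of_dim m) delta b (w - x)%W = 1.
Proof.
move=> m2; rewrite witt_of_dim_large //; case: (odd m);
by rewrite unlock; case: (e) b w => -[] [[[] []] [[] []]]; vm_compute.
Qed.

Lemma size_witt_of_dim m : (0 < m)%N ->
  size (witt_of_dim m) = (if m == 1 then 4 else if m == 2 then 7 else 8)%N.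
Proof.
case: m => [|[|[|m]]] // _; rewrite witt_of_dim_large //.
by case: (odd m.+3).
Qed.

Lemma odd_adim_sub w x : odd (adim (w - x)%W) = odd (adim w) (+) odd (adim x).
Proof. by case: (e) w x => -[[[] []] [[] []]] [[[] []] [[] []]]. Qed.

Lemma eight_size_witt_solutions ms w : 0%N \notin ms ->
  8 * (size (witt_solutions ms w))%:Z =
  if odd (adim w) == odd (sumn ms) then
    eight_count (count_mem 1%N ms) (count_mem 2%N ms) (count (leq 3) ms) w
  else 0.
Proof.
elim: ms w => [|m ms IHms] w /=.
  by move=> _; case: w => -[[] []] [[] []].
rewrite inE negb_or eq_sym -lt0n => /andP[m0 ms0].
rewrite size_allpairs_dep sumnE big_map (big_morph Posz PoszD (erefl (Posz 0))) mulr_sumr.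
rewrite oddD; set c1 := count_mem 1%N ms in IHms *; set c2 := count_mem 2%N ms in IHms *.
set c3 := count _ ms in IHms *.
(* In this case all entries of ms are 2; this fixes the parity of w wherever [delta] occurs. *)
have ev : c1 = 0%N -> c3 = 0%N -> odd (sumn ms) = false.
  rewrite /c1 /c3 => {IHms}; elim: (ms) ms0 => //= a s IHs.
  rewrite inE negb_or => /andP[a0 s0]; case: a a0 => [|[|[|a]]] //= _.
  by rewrite !add0n => h1 h3; rewrite IHs.
rewrite (eq_big_seq (fun x => if odd (adim w) == odd m (+) odd (sumn ms)
    then eight_count c1 c2 c3 (w - x)%W else 0)); last first.
  move=> x; rewrite mem_witt_of_dim => /andP[_ /eqP ox]; rewrite IHms // odd_adim_sub ox.
  by case: (odd _); case: (odd m); case: (odd _).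
case: eqP => [ow|_]; last by rewrite big1.
have sumC (a : int) : \sum_(x <- witt_of_dim m) a = a * (size (witt_of_dim m))%:Z.
  by rewrite big_const_seq count_predT iter_addr addr0 -mulr_natr natz.
have m_cases : [\/ m = 1%N, m = 2%N | (2 < m)%N] by case: m m0 {ow sumC} => [|[|[|m]]] //; [constructor 1|constructor 2|constructor 3].
rewrite /eight_count; have [c3_0|c3_gt0] := posnP c3; last first.
  rewrite sumC size_witt_of_dim // addn_gt0 c3_gt0 orbT.
  case: m_cases => [->|->|m3]; rewrite /= ?add0n ?add1n ?exprS; try ring.
  rewrite !(gtn_eqF m3) (gtn_eqF (ltnW m3)) m3 add1n exprS; ring.
rewrite c3_0 addn0 /=.
case: m_cases => [em|em|m3].
- rewrite em /= in ow *; have [c1_0|c1_gt0] := posnP c1; last first.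
    rewrite big_split /= -[X in _ + X]mulr_sumr sum_gam1 -em sumC em size_witt_of_dim // !exprS.
    rewrite ?expr0 ?add0n /=; ring.
  rewrite ev // in ow.
  (* A first entry 1 turns the [delta] term into the [gam] term; two factors (-1)^c2 meet, whence
     the reduction to s^2 = 1. *)
  rewrite (eq_bigr (fun x => 7 ^+ c2 - (-1) ^+ c2 + 4 * (-1) ^+ c2 * (2 * delta (odd c2) (w - x)%W))); last first.
    by move=> x _; ring.
  rewrite big_split /= -[X in _ + X]mulr_sumr sum_delta1 ?ow // -em sumC em size_witt_of_dim //.
  rewrite c1_0 signr_odd !exprS ?expr0 ?add0n /=.
  have : ((-1) ^+ c2 : int) ^+ 2 = 1 by rewrite sqrr_sign.
  move: ((-1) ^+ c2) => s ss; apply/eqP; rewrite -subr_eq0; apply/eqP.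
  transitivity (4 * gam w * (s ^+ 2 - 1)); first by ring.
  by rewrite ss subrr mulr0.
- rewrite em /= in ow *; rewrite !add0n; have [c1_0|c1_gt0] := posnP c1; last first.
    rewrite big_split /= -[X in _ + X]mulr_sumr sum_gam2 -em sumC em size_witt_of_dim // !exprS /=; ring.
  rewrite ev // in ow.
  rewrite (eq_bigr (fun x => 7 ^+ c2 - (-1) ^+ c2 + 8 * (-1) ^+ c2 * delta (odd c2) (w - x)%W)); last first.
    by move=> x _; ring.
  rewrite big_split /= -[X in _ + X]mulr_sumr sum_delta2 ?ow // -em sumC em size_witt_of_dim // !exprS /=.
  ring.
rewrite (gtn_eqF m3) (gtn_eqF (ltnW m3)) m3 /= !add0n expr1.
have sm : size (witt_of_dim m) = 8%N.
  by rewrite size_witt_of_dim // (gtn_eqF m3) (gtn_eqF (ltnW m3)).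
have [c1_0|c1_gt0] := posnP c1; last first.
  by rewrite big_split /= -[X in _ + X]mulr_sumr sum_gam3 // sumC sm mulr0 addr0.
rewrite ev // addbF in ow.
rewrite (eq_bigr (fun x => 7 ^+ c2 - (-1) ^+ c2 + 8 * (-1) ^+ c2 * delta (odd c2) (w - x)%W)); last first.
  by move=> x _; ring.
rewrite big_split /= -[X in _ + X]mulr_sumr sum_delta3 // sumC sm c1_0; ring.
Qed.

Lemma size_witt_solutions ms w : 0%N \notin ms -> odd (adim w) = odd (sumn ms) ->
  (size (witt_solutions ms w))%:R =
  T_count (adim w) (count_mem 1%N ms) (count_mem 2%N ms) (count (leq 3) ms).
Proof.
move=> ms0 ow; have := eight_size_witt_solutions w ms0; rewrite ow eqxx.
set N := size _; set c1 := count_mem 1%N ms; set c2 := count_mem 2%N ms; set c3 := count _ ms.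
move=> /(congr1 (fun z : int => z%:~R : rat)); rewrite intrM /eight_count /T_count /gam.
have X (a n : nat) : ((a%:R : int) ^+ n)%:~R = a%:R ^+ n :> rat by rewrite rmorphXn rmorph_nat.
have Z (a : nat) : (a%:R : int)%:~R = a%:R :> rat by rewrite rmorph_nat.
have P (a : nat) : (Posz a)%:~R = a%:R :> rat by [].
rewrite Z P; case: ifP => _; first by rewrite !intrM !X => h; lra.
case: ifP => c1_gt0.
  rewrite intrD !intrM intrB !X !Z P => h.
  have -> : 2 ^ (c1%:Z - 2) = 2 ^+ c1 / 4 :> rat.
    by rewrite expfzDr // (_ : 2 ^ (-2) = 4^-1).
  lra.
move=> h; rewrite intrD X (intrM _ ((-1) ^+ c2)) intrB (intrM _ 8) Z rmorphXn rmorphN1 in h.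
set s : rat := (-1) ^+ c2 in h *.
(* [adim] takes each of the values 0 and 4 at a single class, so [epsilon] is nonzero exactly at
   [womega (odd c2)]. *)
have [b hb hs] : exists2 b : bool, delta (odd c2) w = b%:Z &
    epsilon (adim w) c2 = (-1) ^+ c2 * b%:Z.
  rewrite /epsilon /delta; exists (w == womega (odd c2)) => //.
  have -> : (adim w == 0%N) && ~~ odd c2 || (adim w == 4%N) && odd c2 = (w == womega (odd c2)).
    by case: (odd c2) (w) => -[[[] []] [[] []]].
  by case: (w == _); rewrite ?mulr1 ?mulr0.
rewrite hb in h; rewrite hs.
(* As 7 is -1 modulo 8, 7^c2 / 8 lies at distance 1/8 from an integer, which rounding recovers. *)
have {}h : (1 / 8 * 7 ^+ c2 : rat) = (N%:Z - (-1) ^+ c2 * b%:Z)%:~R + s / 8.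
  rewrite intrB intrM rmorphXn rmorphN1 -/s P; lra.
have -> : nearest_int (1 / 8 * 7 ^+ c2) = N%:Z - (-1) ^+ c2 * b%:Z.
  rewrite /nearest_int; apply: floor_def; rewrite h intrD.
  have [->|->] : s = 1 \/ s = -1 by rewrite /s -signr_odd; case: odd; [right|left].
    by apply/andP; split; lra.
  by apply/andP; split; lra.
by rewrite subrK.
Qed.
End Counting.

(** * Rational orbits *)

Section GramMatrix.
Variable k : fieldType.
Hypothesis two0 : (2%:R : k) != 0.

Lemma polar_sym n (q : 'cV[k]_n -> k) x y : polar q x y = polar q y x.
Proof. by rewrite /polar [y + x]addrC addrAC. Qed.

Lemma gram_sym n (q : 'cV[k]_n -> k) : (gram q)^T = gram q.
Proof.
by apply/matrixP => i j; rewrite !mxE polar_sym.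
Qed.

Lemma gram_polar n (q : 'cV[k]_n -> k) (x y : 'cV[k]_n) : quadratic_form q ->
  polar q x y = 2%:R * (x^T *m gram q *m y) 0 0.
Proof.
move=> [_ lin].
have linear_sum (f : 'cV[k]_n -> k) (z : 'cV_n) :
    scalar f -> f z = \sum_i z i 0 * f (delta_mx i 0).
  move=> lf; have f0 : f 0 = 0.
    have := lf 1 0 0; rewrite scaler0 addr0 mul1r => /eqP.
    by rewrite -subr_eq0 opprD addNKr oppr_eq0 => /eqP.
  rewrite [in LHS](matrix_sum_delta z) (eq_bigr (fun i => z i 0 *: delta_mx i 0)).
    elim/big_rec2: _ => [//|i a b _ <-]; exact: lf.
  by move=> i _; rewrite big_ord1.
rewrite (linear_sum (fun x => polar q x y)) // -mulmxA mxE mulr_sumr.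
apply: eq_bigr => i _; rewrite [x^T _ _]mxE mulrCA; congr (_ * _).
rewrite polar_sym (linear_sum (fun y => polar q y _)) // [in RHS]mxE mulr_sumr.
apply: eq_bigr => j _; rewrite [gram _ _ _]mxE polar_sym mulrA mulrC; congr (_ * _).
by rewrite mulrC divfK.
Qed.

Lemma qform_gram n (q : 'cV[k]_n -> k) (x : 'cV[k]_n) : quadratic_form q ->
  q x = (x^T *m gram q *m x) 0 0.
Proof.
move=> hq; apply: (mulfI two0); rewrite -gram_polar //.
rewrite /polar -mulr2n -scaler_nat (qformZ hq).
rewrite -natrX -addrA -opprD -mulr2n -[X in _ - X]mulr_natl -mulrBl -natrB //.
Qed.

Lemma symmetric_form_inj n (S S' : 'M[k]_n) : S^T = S -> S'^T = S' ->
  (forall u : 'rV_n, (u *m S *m u^T) 0 0 = (u *m S' *m u^T) 0 0) -> S = S'.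
Proof.
move=> sS sS' h; apply/eqP; rewrite -subr_eq0; apply/negPn/negP => n0.
have [|u] := symmetric_nonzero_value two0 _ n0; first by rewrite linearB /= sS sS'.
by rewrite mulmxBr mulmxBl mxE [X in _ + X]mxE h subrr eqxx.
Qed.
End GramMatrix.

(** * The Witt class of q and the anisotropic dimension *)

Section WittClassOfForm.
Variables (k : fieldType) (u t : k) (par : k -> bool).
Hypothesis sqc : square_classes u t par.
Let two0 := sqc_two sqc.

(** A hyperbolic plane in the canonical form would contain an isotropic vector. *)
Lemma anisotropic_adim (x : qmod k) w : nondeg x -> has_witt t par x w ->
  anisotropic_gram x -> qdim x = adim w.
Proof.
move=> nx [s [s0 xs <-]] ax; have [m hm] := ceq_canonical sqc s0.
have ds : qdim x = size s by rewrite -(qdim_dsum1 s) -(iso_dim xs).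
rewrite ds (size_canonical hm); case: m hm => [|m] hm; first by rewrite addn0.
exfalso; apply: (anisotropic_isotropic_rank ax).
suff : isotropic_rank (forgetE x) 1 by [].
apply: iso_isotropic_rank (iso_sym xs) _.
apply: iso_isotropic_rank (iso_sym (hm 1%N isT)) _.
apply: iso_isotropic_rank (iso_sym (dsum_cat _ _ _)) _.
have z0 : isotropic_rank (dsum 1 (anis u t (wsum t par s))) 0.
  by exists 0%N, 0; rewrite !mul0mx.
by apply: isotropic_rankW (isotropic_rank_osum z0 (hyps_isotropic_rank k m.+1)).
Qed.

Lemma witt_of_anisotropic_dim n n0 (q : 'cV[k]_n -> k) :
  quadratic_form q -> nondegenerate_qform q -> anisotropic_dim q n0 ->
  exists w, has_witt t par (QMod 0 (gram q)) w /\ adim w = n0.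
Proof.
move=> hq nd [m [qa [hqa aqa [P [Q [PQ QP qP]]]]]].
(* Gram matrix of the sum of the x_i y_i; the 1/2 comes from the normalization q x = x^T M x. *)
pose Hm : 'M[k]_(m + m) := block_mx 0 (2%:R^-1)%:M (2%:R^-1)%:M 0.
pose G' := block_mx (gram qa) 0 0 Hm.
have sH : Hm^T = Hm by rewrite /Hm tr_block_mx !trmx0 tr_scalar_mx.
have sG' : G'^T = G' by rewrite /G' tr_block_mx !trmx0 sH gram_sym.
have G'E z : add_hyperbolic qa z = (z^T *m G' *m z) 0 0.
  rewrite /add_hyperbolic -[in RHS](vsubmxK z); set z1 := usubmx z; set z2 := dsubmx z.
  rewrite /G' tr_col_mx mul_row_block mul_row_col !mulmx0 addr0 add0r [RHS]mxE.
  rewrite -qform_gram //; congr (_ + _).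
  rewrite -[in RHS](vsubmxK z2); set a := usubmx z2; set b := dsubmx z2.
  rewrite /Hm tr_col_mx mul_row_block mul_row_col !mulmx0 addr0 add0r.
  rewrite !mul_mx_scalar -!scalemxAl [RHS]mxE [X in _ = X + _]mxE [X in _ = _ + X]mxE.
  have -> : (b^T *m a) 0 0 = (a^T *m b) 0 0.
    by rewrite -[in LHS](trmxK a) -trmx_mul mxE.
  have half c : 2%:R^-1 * c + 2%:R^-1 * c = c :> k by field.
  rewrite half mxE.
  by apply: eq_bigr => i _; rewrite [a^T _ _]mxE.
have GE : gram q = P^T *m G' *m P.
  apply: symmetric_form_inj => //; first exact: gram_sym.
    by rewrite !trmx_mul trmxK sG' mulmxA.
  move=> v; have := qP v^T; rewrite G'E (qform_gram two0 _ hq) trmxK => <-.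
  by rewrite !trmx_mul trmxK !mulmxA.
have iq : iso (QMod 0 (gram q)) (osum (QMod 0 (gram qa)) (QMod 0 Hm)).
  exists P^T, Q^T; split=> /=.
  - by rewrite -trmx_mul QP trmx1.
  - by rewrite -trmx_mul PQ trmx1.
  - by rewrite mul0mx block_mx0 mulmx0.
  - by rewrite trmxK GE.
have uG' : G' \in unitmx.
  have := unitmx_rect (P := Q^T) (Q := P^T) _ _ nd.
  rewrite -!trmx_mul PQ QP !trmx1 => /(_ erefl erefl).
  rewrite GE trmxK !mulmxA -trmx_mul PQ trmx1 mul1mx -mulmxA PQ mulmx1 //.
have [ua uH] : gram qa \in unitmx /\ Hm \in unitmx.
  by apply/andP; move: uG'; rewrite !unitmxE det_ublock unitrM.
have na : nondeg (QMod 0 (gram qa)) by split=> //; apply: gram_sym.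
have [w hw] := has_witt_exists sqc na.
have nH : nondeg (QMod 0 Hm) by [].
have hH : has_witt t par (QMod 0 Hm) w0.
  apply: (has_witt_isotropic sqc (r := m)) => //=; first by rewrite addnn.
  exists m, (row_mx 1%:M 0); split=> /=.
    by rewrite tr_row_mx mul_row_block mul_row_col !(mul0mx, mulmx0, addr0, add0r, trmx0).
  by rewrite rank_row_mx0 mxrank1.
exists w; split.
  rewrite -(wadd0 (nsqN1 k) w); apply: has_witt_iso (has_witt_osum hw hH).
  exact: iso_forgetE iq.
apply/esym; apply: (anisotropic_adim na hw) => z /= z0.
by apply: trmx_inj; rewrite trmx0; apply: aqa; rewrite (qform_gram two0) // trmxK.
Qed.
End WittClassOfForm.

Section Realization.
Variables (k : fieldType) (u t : k) (par : k -> bool).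
Hypothesis sqc : square_classes u t par.
Local Notation nsqN1 := (nsqN1 k).
Local Notation cls := (cls t par).
Local Notation wsum := (wsum t par).
Local Notation anis := (anis u t).
Local Notation hyps := (hyps k).

Lemma wsum_hyps m : wsum (hyps m) = w0.
Proof.
have n1 := oner_neq0 k.
elim: m => [//|m IHm]; rewrite -[m.+1]add1n hypsD wsum_cat IHm wadd0 /= wadd0.
by rewrite (cls_opp sqc) // waddN.
Qed.

Lemma wsum_anis w : wsum (anis w) = w.
Proof.
have [eu e1] : evenv par u /\ evenv par 1 by rewrite (evenvu sqc) (evenv1 sqc).
have n1 : nsq (1 : k) = false by rewrite -(expr1n _ 2) nsq_square.
have ce a : evenv par a -> cls a = ((true, nsq a), (false, false)).
  by case/andP=> _ /negPf h; rewrite /cls h.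
have ct a : evenv par a -> cls (t * a) = ((false, false), (true, nsq a)).
  case/andP=> a0 /negPf h; rewrite /cls (sqc_parM sqc) ?(sqc_t sqc) // (sqc_part sqc) h /=.
  by rewrite (_ : t * a * t = t ^+ 2 * a) ?nsqZ ?(sqc_t sqc) //; ring.
have nu : nsq (- u) = ~~ nsqN1 by rewrite (nsqN sqc) // (nsq_u sqc) addbT.
have a1 x : wsum (anis1 u x) = (x, (false, false)).
  rewrite /anis1; case: x => -[] [] /=; rewrite ?ce ?(evenvN sqc) ?(nsq_u sqc) ?n1 ?nu //;
  by rewrite /wadd /wadd1 /=; case: nsqN1.
have a2 x : wsum [seq t * a | a <- anis1 u x] = ((false, false), x).
  rewrite /anis1; case: x => -[] [] /=; rewrite ?ct ?(evenvN sqc) ?(nsq_u sqc) ?n1 ?nu //;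
  by rewrite /wadd /wadd1 /=; case: nsqN1.
have -> : anis w = anis1 u w.1 ++ [seq t * a | a <- anis1 u w.2] by [].
rewrite wsum_cat a1 a2; case: w => -[a b] [c d].
by rewrite /wadd /wadd1 /= !andbF !addbF.
Qed.

Lemma wsum_bounds s : 0 \notin s -> wsum s \in witt_of_dim (size s).
Proof.
move=> s0; have [m hm] := ceq_canonical sqc s0.
by rewrite mem_witt_of_dim (size_canonical hm) leq_addr oddD odd_double addbF eqxx.
Qed.

Lemma wsum_surjective m w : w \in witt_of_dim m ->
  exists s, [/\ 0 \notin s, size s = m & wsum s = w].
Proof.
rewrite mem_witt_of_dim => /andP[le_wm /eqP par_wm].
exists (anis w ++ hyps (m - adim w)./2); split.
- by rewrite mem_cat negb_or (anis_neq0 sqc) hyps_neq0.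
- rewrite size_cat size_anis size_hyps halfK oddB // par_wm addbb /=; lia.
- by rewrite wsum_cat wsum_hyps wadd0 wsum_anis.
Qed.

Lemma scale_signK d (s : seq k) :
  [seq piece_sign k d * a | a <- [seq piece_sign k d * a | a <- s]] = s.
Proof.
rewrite -map_comp -[RHS]map_id; apply: eq_map => a /=.
by rewrite mulrA -expr2 sqrr_sign mul1r.
Qed.

Lemma scale_sign_neq0 d (s : seq k) : 0 \notin s -> 0 \notin [seq piece_sign k d * a | a <- s].
Proof.
move=> s0; apply/mapP => -[a sa] /esym/eqP.
by rewrite mulf_eq0 (negPf (piece_sign_neq0 k d)) => /eqP a0; rewrite a0 (negPf s0) in sa.
Qed.

Lemma coeffs_flatten (D : seq nat) (c : nat -> seq k) d : uniq D ->
  coeffs d (flatten [seq [seq (e, a) | a <- c e] | e <- D]) = if d \in D then c d else [::].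
Proof.
elim: D => [//|e D IHD] /= /andP[eD uD].
rewrite /coeffs filter_cat map_cat -/(coeffs _ _) -/(coeffs _ (flatten _)) IHD // inE.
have [->|ne] := eqVneq d e; first by rewrite coeffs_pairs (negPf eD) cats0.
rewrite /coeffs filter_map (eq_filter (a2 := pred0)) ?filter_pred0 // => a /=.
by rewrite eq_sym (negPf ne).
Qed.

Lemma part_witt_iso d l l' : valid_pieces l -> valid_pieces l' -> odd d ->
  iso (nform l) (nform l') -> perm_eq (block_sizes l) (block_sizes l') ->
  part_witt t par d l = part_witt t par d l'.
Proof.
move=> vl vl' od h p; have hc := iso_coeffs vl vl' od h p.
apply: (wsum_iso sqc); rewrite ?scale_sign_neq0 ?coeffs_neq0 //.
by rewrite !dsum_scale //; apply: iso_scaleG.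
Qed.

(** Converse of [part_witt_iso]: the multiplicities being fixed, the classes determine the
    multiplicity forms. Multiplying by the sign is an involution, so it can be undone. *)
Lemma iso_part_witt l l' : valid_pieces l -> valid_pieces l' ->
  perm_eq (block_sizes l) (block_sizes l') ->
  (forall d, odd d -> d \in block_sizes l -> part_witt t par d l = part_witt t par d l') ->
  iso (nform l) (nform l').
Proof.
move=> vl vl' p h; apply: nform_iso_coeffs => // d od.
have es : size (coeffs d l) = size (coeffs d l').
  by rewrite !size_coeffs //; apply: (permP p).
have [dl|ndl] := boolP (d \in block_sizes l).
  have := ceq_of_wsum sqc (scale_sign_neq0 d (coeffs_neq0 d vl)) (scale_sign_neq0 d (coeffs_neq0 d vl')).
  rewrite [X in X = _ -> _]size_map [X in _ = X -> _]size_map.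
  move=> /(_ es (h d od dl)) /(ceq_scale (piece_sign k d)).
  by rewrite !scale_signK.
have s0 : size (coeffs d l) = 0%N by rewrite size_coeffs // (count_memPn ndl).
move: (es); rewrite s0 => /esym/size0nil ->; move/size0nil: s0 => ->.
exact: ceq_refl.
Qed.
End Realization.

(** * Tuples of Witt classes as a complete invariant of conjugacy *)

Section Orbits.
Variables (k : fieldType) (u t : k) (par : k -> bool).
Hypothesis sqc : square_classes u t par.
Let two0 := sqc_two sqc.
Variables (n : nat) (M : 'M[k]_n) (lam : seq nat) (w : witt).
Hypotheses (sM : M^T = M) (uM : M \in unitmx).
Hypothesis hw : has_witt t par (QMod 0 M) w.
Hypothesis hlam : is_partition n lam.
Hypothesis heven : even_parts_even_mult lam.

Definition odd_parts (s : seq nat) : seq nat := [seq d <- undup s | odd d].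
Definition part_mults (s : seq nat) : seq nat := [seq count_mem d s | d <- odd_parts s].

Lemma odd_parts_uniq s : uniq (odd_parts s).
Proof. by rewrite filter_uniq // undup_uniq. Qed.

Lemma mem_odd_parts s d : (d \in odd_parts s) = odd d && (d \in s).
Proof. by rewrite mem_filter mem_undup. Qed.

Definition skew_jordan (X : 'M[k]_n) : Prop :=
  X^T *m M + M *m X = 0 /\ jordan_type lam X.

(** The normal form is existential here; [parts_of_conjugate] shows that the tuple does not depend
    on it. *)
Definition parts_of (X : 'M[k]_n) (s : seq witt) : Prop :=
  skew_jordan X /\ exists l, [/\ valid_pieces l, iso (QMod X^T M) (nform l) &
    s = [seq part_witt t par d l | d <- odd_parts lam]].

Let lam0 : 0%N \notin lam. Proof. by case: hlam. Qed.

Lemma skew_jordan_nilpotent X : skew_jordan X -> skew_nilpotent (QMod X^T M).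
Proof.
case=> skX jX; split=> //=.
  by rewrite trmxK; apply/eqP; rewrite -addr_eq0 skX.
move/jordan_typeE: jX => /(iso_rank (sumn lam)) /=; rewrite rank_jordan_sum => r.
exists (sumn lam); apply/eqP; rewrite -mxrank_eq0 r sumnE.
rewrite big_seq big1 // => d dl; apply/eqP; rewrite subn_eq0.
by rewrite (big_rem d) //= leq_addr.
Qed.

Lemma skew_trace0 (X : 'M[k]_n) : X^T *m M + M *m X = 0 -> \tr X = 0.
Proof.
move=> skX; have e : X = - (invmx M *m X^T *m M).
  rewrite -mulmxA -[X in LHS](mulKmx uM) -mulmxN; congr (_ *m _).
  by apply/eqP; rewrite -addr_eq0 addrC skX.
have : \tr X = - \tr X.
  by rewrite {1}e linearN /= mxtrace_mulC mulmxA mulmxV // mul1mx mxtrace_tr.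
move/eqP; rewrite -addr_eq0 -mulr2n -mulr_natl mulf_eq0 (negPf two0) => /eqP//.
Qed.

Lemma parts_of_blocks X l : skew_jordan X -> valid_pieces l ->
  iso (QMod X^T M) (nform l) -> perm_eq lam (block_sizes l).
Proof. by case=> _ jX vl /(jordan_type_block_sizes lam0 vl) <-. Qed.

Lemma parts_of_exists X : skew_jordan X ->
  exists2 s, parts_of X s & s \in witt_solutions (nsqN1 k) (part_mults lam) w.
Proof.
move=> sX; have [l [vl hl]] := normal_form_exists two0 (skew_jordan_nilpotent sX).
have pl := parts_of_blocks sX vl hl.
exists [seq part_witt t par d l | d <- odd_parts lam]; first by split=> //; exists l.
rewrite mem_witt_solutions; apply/andP; split.
  rewrite /part_mults; have : {subset odd_parts lam <= odd_parts lam} by [].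
  elim: {1 3 4}(odd_parts lam) => //= d ds IHds sub.
  have /andP[od dl] : odd d && (d \in lam) by rewrite -mem_odd_parts sub ?mem_head.
  rewrite IHds => [|e eds]; last by apply: sub; rewrite inE eds orbT.
  rewrite andbT (permP pl) -size_coeffs // -(size_map (fun a => piece_sign k d * a)).
  by apply: (wsum_bounds sqc); rewrite scale_sign_neq0 ?coeffs_neq0.
rewrite big_map -sum_part_witt ?odd_parts_uniq //.
- apply/eqP; apply: (has_witt_inj sqc (nform_witt sqc vl)).
  by apply: has_witt_iso hw; apply: iso_sym; apply: (iso_forgetE hl).
- by apply/allP => d; rewrite mem_odd_parts => /andP[].
- move=> p lp op; rewrite mem_odd_parts op (perm_mem pl).
  by apply/flattenP; exists [:: p.1]; rewrite ?inE //; apply/mapP; exists p; rewrite ?op.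
Qed.

(** A normal form with the prescribed classes has the dimension and the Witt class of M, hence is
    isometric to it; its endomorphism is transported along the isometry. *)
Lemma parts_of_realized s : s \in witt_solutions (nsqN1 k) (part_mults lam) w ->
  exists X, parts_of X s.
Proof.
rewrite mem_witt_solutions => /andP[hs /eqP sw].
have ss : size s = size (odd_parts lam).
  by move: hs; rewrite all2E size_map => /andP[/eqP].
pose x d := nth w0 s (index d (odd_parts lam)).
have xd d : d \in odd_parts lam -> x d \in witt_of_dim (count_mem d lam).
  move=> dl; have id : (index d (odd_parts lam) < size s)%N by rewrite ss index_mem.
  move: hs; rewrite all2E => /andP[_ /(all_nthP (w0, 0%N))/(_ (index d (odd_parts lam)))].
  rewrite size_zip size_map ss minnn index_mem => /(_ dl).
  rewrite nth_zip; last by rewrite size_map.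
  rewrite (nth_map 0%N); last by rewrite index_mem.
  rewrite nth_index; last exact: dl.
  exact.
have ex d : exists r : seq k, d \in lam ->
    0 \notin r /\ if odd d then size r = count_mem d lam /\
      wsum t par [seq piece_sign k d * a | a <- r] = x d
    else ((size r).*2 = count_mem d lam)%N.
  have [dl|ndl] := boolP (d \in lam); last by exists [::].
  have [od|ed] := boolP (odd d).
    have dl' : d \in odd_parts lam by rewrite mem_odd_parts od.
    have [r [r0 sr wr]] := wsum_surjective sqc (xd d dl').
    exists [seq piece_sign k d * a | a <- r] => _.
    by rewrite scale_sign_neq0 // size_map scale_signK.
  (* For even d the coefficients are placeholders, and each piece accounts for two blocks. *)
  exists (nseq (count_mem d lam)./2 1) => _; rewrite mem_nseq negb_and eq_sym oner_neq0 orbT.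
  by rewrite size_nseq halfK (negPf (heven dl ed)) subn0.
have [c hc] := choice ex.
pose l := flatten [seq [seq (d, a) | a <- c d] | d <- undup lam].
have cl d : coeffs d l = if d \in lam then c d else [::].
  by rewrite coeffs_flatten ?undup_uniq // mem_undup.
have vl : valid_pieces l.
  apply/allP => p /flattenP[r /mapP[e]]; rewrite mem_undup => el -> /mapP[b bc ->] /=.
  rewrite lt0n (memPn lam0) //=; apply: contraTneq bc => ->.
  by have [] := hc e el.
have pl : perm_eq lam (block_sizes l).
  apply/allP => d _ /=; apply/eqP.
  have [dl|ndl] := boolP (d \in lam).
    have [_] := hc d dl; case: ifP => od; last first.
      by move <-; rewrite -size_coeffs_even ?od // cl dl.
    by case=> <- _; rewrite -size_coeffs // cl dl.
  rewrite (count_memPn ndl); apply/esym.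
  have [od|ed] := boolP (odd d); first by rewrite -size_coeffs // cl (negPf ndl).
  by rewrite -size_coeffs_even // cl (negPf ndl).
have es : s = [seq part_witt t par d l | d <- odd_parts lam].
  apply: (@eq_from_nth _ w0); rewrite ?size_map // => i; rewrite ss => li.
  rewrite (nth_map 0%N) //; set d := nth 0%N _ i.
  have dl : d \in odd_parts lam by apply: mem_nth.
  have := dl; rewrite mem_odd_parts => /andP[od dlam].
  have [_] := hc d dlam; rewrite od => -[_]; rewrite /part_witt cl dlam => ->.
  by rewrite /x /d index_uniq ?odd_parts_uniq.
have dimE : qdim (nform l) = n.
  rewrite -(_ : sumn lam = n); last by case: hlam.
  rewrite (iso_dim (forgetG_nform l) : qdim (nform l) = _).
  have -> : sumn lam = sumn (block_sizes l) by apply/perm_sumn.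
  by elim: (block_sizes l) => //= d r ->.
have snl := nform_skew_nilpotent vl.
have nnl : nondeg (nform l) by case: snl.
have wl : has_witt t par (nform l) w.
  rewrite -sw es big_map -sum_part_witt ?odd_parts_uniq //; first exact: (nform_witt sqc vl).
    by apply/allP => d; rewrite mem_odd_parts => /andP[].
  move=> p lp op; rewrite mem_odd_parts op (perm_mem pl).
  by apply/flattenP; exists [:: p.1]; rewrite ?inE //; apply/mapP; exists p; rewrite ?op.
have nM : nondeg (QMod 0 M) by [].
have [P [Q [PQ QP _ PG]]] := nondeg_iso_witt sqc nM nnl (esym dimE) hw wl.
pose X := (P *m qend (nform l) *m Q)^T; exists X.
have iX : iso (QMod X^T M) (nform l).
  by exists P, Q; split=> //=; rewrite trmxK -!mulmxA QP mulmx1.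
have skX : X^T *m M + M *m X = 0.
  have [_ _ /= e _] := iso_skew_nilpotent iX snl.
  by rewrite e trmxK addNr.
by split; [split=> //; apply/(jordan_type_block_sizes lam0 vl iX) | exists l].
Qed.

Lemma iso_conjugate (X X' : 'M[k]_n) : iso (QMod X^T M) (QMod X'^T M) <->
  exists2 g, g \in unitmx /\ g^T *m M *m g = M & X' = g *m X *m invmx g.
Proof.
split=> [[P [Q [PQ QP /= PE PG]]]|[g [ug gM] ->]].
  have uP : P \in unitmx by have [] := mulmx1_unit PQ.
  exists P^T; first by rewrite unitmx_tr trmxK.
  apply: (can_inj (@trmxK _ _ _)); rewrite !trmx_mul trmx_inv trmxK.
  by rewrite mulmxA -[LHS](mulKmx uP) PE mulmxA.
exists g^T, (invmx g)^T; split=> /=.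
- by rewrite -trmx_mul mulVmx // trmx1.
- by rewrite -trmx_mul mulmxV // trmx1.
- by rewrite !trmx_mul !mulmxA -trmx_mul mulVmx // trmx1 mul1mx.
- by rewrite trmxK.
Qed.

Lemma parts_of_conjugate X X' s s' : parts_of X s -> parts_of X' s' ->
  s = s' <-> iso (QMod X^T M) (QMod X'^T M).
Proof.
case=> sX [l [vl hl ->]] [sX' [l' [vl' hl' ->]]].
have pl := parts_of_blocks sX vl hl; have pl' := parts_of_blocks sX' vl' hl'.
have pll : perm_eq (block_sizes l) (block_sizes l') by rewrite perm_sym (perm_trans _ pl) // perm_sym.
split=> [/eq_in_map h|h].
  apply: iso_trans hl (iso_trans _ (iso_sym hl')).
  apply: (iso_part_witt sqc) => // d od dl; apply: h.
  by rewrite mem_odd_parts od (perm_mem pl).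
apply/eq_in_map => d; rewrite mem_odd_parts => /andP[od dl].
apply: (part_witt_iso sqc) => //.
exact: iso_trans (iso_sym hl) (iso_trans h hl').
Qed.

Lemma skew_jordan_conjugate X X' : skew_jordan X ->
  iso (QMod X^T M) (QMod X'^T M) -> skew_jordan X'.
Proof.
move=> sX h; have snX := skew_jordan_nilpotent sX.
have [_ _ /= e _] := iso_skew_nilpotent (iso_sym h) snX.
split; first by rewrite e trmxK addNr.
apply/jordan_typeE; apply: iso_trans (iso_forgetG (iso_sym h)) _.
by have [_ /jordan_typeE] := sX.
Qed.
End Orbits.

(** * Determinants of centralizers *)

Section Determinants.
Variable k : fieldType.
Hypothesis two0 : (2%:R : k) != 0.
Implicit Types (x y : qmod k) (l : seq (nat * k)).

Lemma det_rect m n (P : 'M[k]_(m, n)) (Q : 'M_(n, m)) (A : 'M_n) :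
  P *m Q = 1%:M -> Q *m P = 1%:M -> \det (P *m A *m Q) = \det A.
Proof.
move=> PQ QP; have e : m = n.
  by apply/eqP; rewrite eqn_leq (right_inverse_dim_leq PQ) (right_inverse_dim_leq QP).
case: n / e P Q A PQ QP => P Q A PQ QP; rewrite !det_mulmx mulrAC -det_mulmx PQ.
by rewrite det1 mul1r.
Qed.

Lemma nform_reflection l : has (fun p => odd p.1) l ->
  exists C, [/\ C *m C = 1%:M, C *m qend (nform l) = qend (nform l) *m C,
    C *m qgram (nform l) *m C^T = qgram (nform l) & \det C = -1].
Proof.
elim: l => [//|p l IHl]; rewrite /nform /= -/(nform l).
case: (boolP (odd p.1)) => [op _|ep /= /IHl[C [C2 CY CM dC]]].
  have trN m : (- 1%:M : 'M[k]_m)^T = - 1%:M by rewrite linearN /= trmx1.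
  exists (block_mx (- 1%:M) 0 0 1%:M).
  rewrite tr_block_mx !mulmx_block !(mulmx0, mul0mx, addr0, add0r, trmx0) trN !trmx1.
  rewrite !(mulmxN, mulNmx, mulmx1, mul1mx, opprK) -scalar_mx_block; split=> //.
  rewrite det_ublock det1 mulr1 -scaleN1r detZ det1 mulr1 -signr_odd /piece op /=.
  by rewrite op.
exists (block_mx 1%:M 0 0 C).
rewrite tr_block_mx !mulmx_block !(mulmx0, mul0mx, addr0, add0r, trmx0, trmx1, mulmx1, mul1mx).
by rewrite C2 CY CM -scalar_mx_block det_ublock det1 mul1r.
Qed.

Lemma iso_reflection x l : iso x (nform l) -> has (fun p => odd p.1) l ->
  exists C, [/\ C \in unitmx, C *m qend x = qend x *m C,
    C *m qgram x *m C^T = qgram x & \det C = -1].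
Proof.
case=> P [Q [PQ QP PE PG]] /nform_reflection[C [C2 CY CM dC]].
exists (P *m C *m Q); split.
- apply: (proj1 (@mulmx1_unit _ _ _ (P *m C *m Q) _)).
  by rewrite -!mulmxA (mulmxA Q) QP mul1mx (mulmxA C) C2 mul1mx.
- have QE : Q *m qend x = qend (nform l) *m Q.
    by rewrite -[LHS]mulmx1 -PQ !mulmxA -(mulmxA Q) -PE mulmxA QP mul1mx.
  by rewrite -(mulmxA _ Q) QE -!mulmxA (mulmxA C) CY !mulmxA PE.
- have PQT : P^T *m Q^T = 1%:M by rewrite -trmx_mul QP trmx1.
  rewrite -PG !trmx_mul -!mulmxA (mulmxA Q) QP mul1mx (mulmxA P^T) PQT mul1mx.
  by rewrite (mulmxA (qgram _) C^T) (mulmxA C) (mulmxA C) CM.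
- by rewrite det_rect.
Qed.

(** Invariance gives (G + 1) H = G H (G + 1)^T; in determinants, those of G + 1 and H cancel. *)
Lemma cayley_det n (G H : 'M[k]_n) : H \in unitmx -> G *m H *m G^T = H ->
  G + 1%:M \in unitmx -> \det G = 1.
Proof.
move=> uH GH uG1.
have e : (G + 1%:M) *m H = G *m H *m (G + 1%:M)^T.
  by rewrite linearD /= trmx1 mulmxDr GH mulmx1 mulmxDl mul1mx addrC.
have := congr1 determinant e; rewrite !det_mulmx det_tr mulrC.
move/(mulIf (_ : \det (G + 1%:M) != 0)) => /(_ ltac:(by rewrite -unitfE -unitmxE)).
rewrite -[X in X = _]mul1r => /(mulIf (_ : \det H != 0)) => /(_ ltac:(by rewrite -unitfE -unitmxE)).
by move=> <-.
Qed.

Lemma osum_skew_nilpotent_inv x y :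
  skew_nilpotent (osum x y) -> skew_nilpotent x /\ skew_nilpotent y.
Proof.
case=> /=; rewrite tr_block_mx !trmx0 => /eq_block_mx[sx _ _ sy].
rewrite unitmxE det_ublock unitrM -!unitmxE => /andP[ux uy].
rewrite tr_block_mx !mulmx_block !(mulmx0, mul0mx, addr0, add0r, trmx0) opp_block_mx.
move=> /eq_block_mx[kx _ _ ky] [d].
rewrite expr_block_diag -[0 in RHS](block_mx0 _ _ _ _ _) => /eq_block_mx[dx _ _ dy].
by split; split=> //; exists d.
Qed.

Lemma even_qdim_nform l : ~~ has (fun p => odd p.1) l -> ~~ odd (qdim (nform l)).
Proof.
elim: l => [//|p l IHl] /=; rewrite negb_or => /andP[ep /IHl el].
by rewrite oddD (negPf el) addbF /piece (negPf ep) /= addnn odd_double.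
Qed.

(* The generalized (-1)-eigenspace K of G is Y-stable and nondegenerate; by the
   Cayley transform det G = (-1)^(dim K), and dim K is even because K only has
   Jordan blocks of even size. *)
Lemma even_centralizer_det x (G : 'M_(qdim x)) : skew_nilpotent x ->
  (forall l, valid_pieces l -> iso x (nform l) -> ~~ has (fun p => odd p.1) l) ->
  G *m qend x = qend x *m G -> G *m qgram x *m G^T = qgram x -> \det G = 1.
Proof.
case: x G => n Y M /= G snx noodd GY GM; have [/= sM uM kM _] := snx.
have uG : G \in unitmx.
  by move: uM; rewrite -{1}GM !unitmx_mul => /andP[/andP[]].
pose A : 'M[k]_n := G + 1%:M.
have GA : G *m A = A *m G by rewrite mulmxDr mulmxDl mulmx1 mul1mx.
have YA : Y *m A = A *m Y by rewrite mulmxDr mulmxDl mulmx1 mul1mx GY.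
(* Fitting decomposition of A = G + 1: from N on the ranks are stable. Positivity of N lets one
   factor A be taken out of A^N. *)
have [N N0 minN] : exists2 N, (0 < N)%N & forall m, (\rank (A ^+ N) <= \rank (A ^+ m))%N.
  pose R r := `[< exists m, \rank (A ^+ m) = r >].
  have exR : exists r, R r by exists (\rank (A ^+ 0)); apply/asboolP; exists 0%N.
  case: (ex_minnP exR) => r /asboolP[m0 rm0] minr; exists m0.+1 => // m.
  apply: leq_trans (minr _ _); last by apply/asboolP; exists m.
  by rewrite -rm0 exprS -mulmxE mxrankM_maxr.
set B := A ^+ N in minN.
have GB : G *m B = B *m G by apply: intertwine_exp.
have YB : Y *m B = B *m Y by apply: intertwine_exp.
have [U fU eU] : exists2 U : 'M_(\rank (kermx B), n), row_free U & (U :=: kermx B)%MS.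
  by exists (row_base (kermx B)); [apply: row_base_free | apply: eq_row_base].
have [W fW eW] : exists2 W : 'M_(\rank B, n), row_free W & (W :=: B)%MS.
  by exists (row_base B); [apply: row_base_free | apply: eq_row_base].
have UB : U *m B = 0 by apply/sub_kermxP; rewrite eU.
have fWB : row_free (W *m B).
  rewrite /row_free (eqmxMr B eW) eqn_leq mxrankM_maxl /=.
  by have := minN (N + N)%N; rewrite exprD.
have [C WC] : exists C, W = C *m B by apply/submxP; rewrite eW.
have GMA : G *m M *m A^T = A *m M.
  by rewrite linearD /= trmx1 mulmxDr GM mulmx1 mulmxDl mul1mx addrC.
have GMB m : G ^+ m *m M *m (A ^+ m)^T = A ^+ m *m M.
  elim: m => [|m IHm]; first by rewrite !expr0 trmx1 mulmx1.
  rewrite [A ^+ m.+1 in LHS]exprS -mulmxE trmx_mul [G ^+ m.+1]exprS -mulmxE.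
  rewrite -!mulmxA (mulmxA (G ^+ m)) (mulmxA _ (_ ^+ m)^T) IHm.
  rewrite [A ^+ m.+1]exprSr -mulmxE -!mulmxA.
  have -> : G *m (A ^+ m *m (M *m A^T)) = A ^+ m *m (G *m M *m A^T).
    by rewrite !mulmxA (intertwine_exp m GA).
  by rewrite GMA !mulmxA.
(* Kernel and image of B are orthogonal: G^N is invertible and commutes with B, and G^N M B^T = B
   M. *)
have UMB : U *m M *m B^T = 0.
  have uGN : G ^+ N \in unitmx.
    elim: (N) => [|m IHm]; first by rewrite expr0 unitmx1.
    by rewrite exprS -mulmxE unitmx_mul uG.
  have [U' eU'] : exists U', U = U' *m G ^+ N.
    by exists (U *m invmx (G ^+ N)); rewrite mulmxKV.
  have U'B : U' *m B = 0.
    rewrite -[LHS](mulmxK uGN) -(mulmxA U' B).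
    have -> : B *m G ^+ N = G ^+ N *m B by rewrite (intertwine_exp N (esym GB)).
    by rewrite mulmxA -eU' UB mul0mx.
  by rewrite eU' -!mulmxA (mulmxA _ M) GMB -/B mulmxA U'B mul0mx.
have UMW : U *m M *m W^T = 0 by rewrite WC trmx_mul mulmxA UMB mul0mx.
have WMU : W *m M *m U^T = 0.
  by apply: trmx_inj; rewrite !trmx_mul trmxK sM trmx0 mulmxA UMW.
have [G1 UG] : exists G1, U *m G = G1 *m U.
  by apply/submxP; rewrite eU; apply/sub_kermxP; rewrite -mulmxA GB mulmxA UB mul0mx.
have [Y1 UY] : exists Y1, U *m Y = Y1 *m U.
  by apply/submxP; rewrite eU; apply/sub_kermxP; rewrite -mulmxA YB mulmxA UB mul0mx.
have [G2 WG] : exists G2, W *m G = G2 *m W.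
  by apply/submxP; rewrite eW WC -mulmxA -GB mulmxA submxMl.
have [Y2 WY] : exists Y2, W *m Y = Y2 *m W.
  by apply/submxP; rewrite eW WC -mulmxA -YB mulmxA submxMl.
pose P := col_mx U W.
have fP : row_free P.
  rewrite -kermx_eq0 -submx0; apply/rV_subP => z /sub_kermxP.
  rewrite -[z]hsubmxK mul_row_col; set a := lsubmx z; set b := rsubmx z => e.
  have b0 : b = 0.
    have : (a *m U + b *m W) *m B = 0 by rewrite e mul0mx.
    rewrite mulmxDl -!mulmxA UB mulmx0 add0r => bWB; have /row_freeP[D DD] := fWB.
    by rewrite -[b]mulmx1 -DD mulmxA bWB mul0mx.
  move: e; rewrite b0 mul0mx addr0 => aU; have /row_freeP[D DD] := fU.
  by rewrite -[a]mulmx1 -DD mulmxA aU mul0mx row_mx0 sub0mx.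
have dimP : (\rank (kermx B) + \rank B)%N = n by rewrite mxrank_ker subnK ?rank_leq_row.
have [Q [PQ QP]] := rect_inverse fP dimP.
have PG : P *m G = block_mx G1 0 0 G2 *m P.
  by rewrite mul_col_mx UG WG mul_block_col !mul0mx addr0 add0r.
have PY : P *m Y = block_mx Y1 0 0 Y2 *m P.
  by rewrite mul_col_mx UY WY mul_block_col !mul0mx addr0 add0r.
pose H1 := U *m M *m U^T; pose H2 := W *m M *m W^T.
have PM : P *m M *m P^T = block_mx H1 0 0 H2.
  by rewrite tr_col_mx mul_col_mx mul_col_row UMW WMU.
have isoP : iso (QMod Y M) (osum (QMod Y1 H1) (QMod Y2 H2)).
  by apply: iso_sym; exists P, Q.
have [sn1 sn2] := osum_skew_nilpotent_inv (iso_skew_nilpotent (iso_sym isoP) snx).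
have [_ /= uH1 _ _] := sn1; have [_ /= uH2 _ _] := sn2.
have [GH1 GH2] : G1 *m H1 *m G1^T = H1 /\ G2 *m H2 *m G2^T = H2.
  have : P *m G *m M *m (P *m G)^T = P *m M *m P^T.
    by rewrite trmx_mul -!mulmxA (mulmxA M) (mulmxA G) (mulmxA G) GM !mulmxA.
  rewrite PG trmx_mul -mulmxA -mulmxA (mulmxA M) (mulmxA P) (mulmxA P) PM.
  rewrite tr_block_mx !mulmx_block !(mulmx0, mul0mx, addr0, add0r, trmx0) !mulmxA.
  by move/eq_block_mx => [].
(* A is injective on the image of A^N, so G2 + 1 is invertible. *)
have det2 : \det G2 = 1.
  apply: cayley_det uH2 GH2 _; rewrite -row_free_unit -kermx_eq0 -submx0.
  apply/rV_subP => b /sub_kermxP bG.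
  have bWA : b *m W *m A = 0.
    rewrite mulmxDr mulmx1 -mulmxA WG mulmxA -mulmxDl.
    by move: bG; rewrite mulmxDr mulmx1 => ->; rewrite mul0mx.
  have : b *m (W *m B) = 0.
    have eB : B = A *m A ^+ N.-1 by rewrite mulmxE -exprS prednK.
    by rewrite mulmxA [X in _ *m X = _]eB mulmxA bWA mul0mx.
  have /row_freeP[D DD] := fWB => bWB.
  by rewrite -[b]mulmx1 -DD mulmxA bWB mul0mx sub0mx.
have G1N : (G1 + 1%:M) ^+ N = 0.
  have UA : U *m A = (G1 + 1%:M) *m U by rewrite mulmxDr mulmxDl UG mulmx1 mul1mx.
  by apply: (row_free_inj fU); rewrite -(intertwine_exp N UA) -/B UB mul0mx.
(* G1 + 1 is nilpotent, but its N-th power multiplies a vector fixed by G1 by 2^N; so 1 is not an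
   eigenvalue of G1. *)
have det1 : \det (- G1) = 1.
  apply: (cayley_det uH1); first by rewrite linearN /= mulmxN !mulNmx opprK.
  rewrite -row_free_unit -kermx_eq0 -submx0; apply/rV_subP => b /sub_kermxP bG.
  have bG1 : b *m G1 = b.
    by move: bG; rewrite mulmxDr mulmx1 mulmxN addrC => /eqP; rewrite subr_eq0 => /eqP.
  have bGm m : b *m (G1 + 1%:M) ^+ m = 2%:R ^+ m *: b.
    elim: m => [|m IHm]; first by rewrite !expr0 mulmx1 scale1r.
    rewrite exprSr -mulmxE mulmxA IHm -scalemxAl mulmxDr mulmx1 bG1.
    by rewrite -mulr2n -scaler_nat scalerA -exprSr.
  move: (bGm N); rewrite G1N mulmx0 => /esym/eqP.
  by rewrite scaler_eq0 expf_eq0 (negPf two0) andbF /= => /eqP->; rewrite sub0mx.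
(* Normal forms of the two summands concatenate to one of x, so the first has no piece of odd
   size. *)
have even1 : ~~ odd (\rank (kermx B)).
  have [l1 [vl1 hl1]] := normal_form_exists two0 sn1.
  have [l2 [vl2 hl2]] := normal_form_exists two0 sn2.
  have h12 : iso (QMod Y M) (nform (l1 ++ l2)).
    apply: iso_trans isoP _; apply: iso_trans (iso_osum hl1 hl2) _.
    exact/iso_sym/nform_cat.
  have := noodd _ _ h12; rewrite /valid_pieces all_cat => /(_ ltac:(by apply/andP)).
  rewrite has_cat negb_or => /andP[/even_qdim_nform].
  by rewrite -(iso_dim hl1).
rewrite -(det_rect G PQ QP) PG -mulmxA PQ mulmx1 det_ublock det2 mulr1.
by rewrite -det1 -scaleN1r detZ -signr_odd (negPf even1) mul1r.
Qed.
End Determinants.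

Lemma card_image_seq (U : eqType) (V : Type) (x0 : U) (r : seq U) (f : U -> V) :
  uniq r -> {in r &, injective f} ->
  ([set f x | x in [set x | x \in r]] #= `I_(size r))%classic%card.
Proof.
move=> ur fI.
have -> : [set f x | x in [set x | x \in r]]%classic =
          [set f (nth x0 r i) | i in `I_(size r)]%classic.
  apply/seteqP; split=> _ [x /= xr <-]; last by exists (nth x0 r x) => //=; apply: mem_nth.
  by exists (index x r); rewrite /= ?index_mem ?nth_index.
apply: inj_card_eq => i j; rewrite !inE /= => ir jr h; apply/eqP.
by rewrite -(nth_uniq x0 ir jr ur); apply/eqP/fI => //; apply: mem_nth.
Qed.

Lemma invmx_mul (R : comUnitRingType) n (A B : 'M[R]_n) :
  A \in unitmx -> B \in unitmx -> invmx (A *m B) = invmx B *m invmx A.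
Proof.
move=> uA uB; have uAB : A *m B \in unitmx by rewrite unitmx_mul uA.
rewrite -[RHS](mulKmx uAB) -(mulmxA A B) (mulmxA B) (mulmxV uB) mul1mx.
by rewrite mulmxV // mulmx1.
Qed.

Section Multiplicities.
Variable lam : seq nat.
Local Notation ms := (part_mults lam).

Lemma chi_mults i : chi lam i = count_mem i ms.
Proof.
rewrite /chi /part_mults /odd_parts count_map count_filter.
by apply: eq_count => d /=; rewrite andbC.
Qed.

Lemma mults_bounds m : m \in ms -> (0 < m <= size lam)%N.
Proof.
case/mapP=> d; rewrite mem_odd_parts => /andP[_ dl] ->.
by rewrite count_size -has_count has_pred1 dl.
Qed.

Lemma mults_neq0 : 0%N \notin ms.
Proof. by apply/negP => /mults_bounds. Qed.

Lemma chi3plus_mults : chi3plus lam = count (leq 3) ms.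
Proof.
rewrite /chi3plus (eq_bigr (fun i => count_mem i ms)) => [|i _]; last exact: chi_mults.
have : all (fun m => m <= size lam)%N ms by apply/allP => m /mults_bounds/andP[].
elim: ms => [_|m s IHs /= /andP[ml sl]]; first by rewrite big1.
rewrite big_split /= IHs //; congr (_ + _)%N.
under eq_bigr => i _ do rewrite eq_sym.
rewrite -big_mkcond /= big_nat1_eq ltnS ml andbT.
by case: ifP.
Qed.

(** Modulo 2, an even part contributes nothing to the sum and an odd part contributes its
    multiplicity. *)
Lemma odd_sumn_mults : odd (sumn ms) = odd (sumn lam).
Proof.
rewrite -(perm_sumn (perm_count_undup lam)) /part_mults /odd_parts.
elim: (undup lam) => //= d s IHs; rewrite sumn_cat sumn_nseq oddD oddM -IHs.
by case: ifP => od /=; rewrite ?oddD.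
Qed.

Lemma no_odd_parts :
  (count_mem 1%N ms == 0%N) && (count_mem 2%N ms == 0%N) && (count (leq 3) ms == 0%N)
  = (odd_parts lam == [::]).
Proof.
rewrite (_ : (odd_parts lam == [::]) = (ms == [::])); last first.
  by rewrite -!size_eq0 size_map.
have := mults_neq0; case: ms => [|m s] //; rewrite inE negb_or => /andP[m0 _].
by case: m m0 => [|[|[|m]]] //= _; rewrite ?add1n ?andbF.
Qed.
End Multiplicities.

(** * Counting orbits under O(q) and SO(q) *)

Section OrthogonalOrbits.
Variables (k : fieldType) (u t : k) (par : k -> bool).
Hypothesis sqc : square_classes u t par.
Let two0 := sqc_two sqc.
Variables (n : nat) (q : 'cV[k]_n -> k) (lam : seq nat) (w : witt).
Hypotheses (nd : nondegenerate_qform q) (n_gt0 : (0 < n)%N).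
Hypothesis hw : has_witt t par (QMod 0 (gram q)) w.
Hypothesis hlam : is_partition n lam.
Hypothesis heven : even_parts_even_mult lam.
Local Notation M := (gram q).
Local Notation S := (nilp_orbit_points q lam).
Local Notation O := (O_group q).
Local Notation SO := (SO_group q).
Local Notation sols := (witt_solutions (nsqN1 k) (part_mults lam) w).
Local Notation parts := (parts_of t par (gram q) lam).

Let sM : M^T = M. Proof. exact: gram_sym. Qed.

Lemma nilp_orbit_pointsE X : S X <-> skew_jordan M lam X.
Proof.
split=> [[[_ h] j]|[h j]]; split=> //; split=> //.
exact: (skew_trace0 sqc nd h).
Qed.

(** O(q)-orbits are the fibres of the invariant, so they can be indexed by solutions. *)
Lemma parts_ofE X s Y : parts X s -> adj_orbit O X Y <-> parts Y s.
Proof.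
move=> hX; split=> [[g [ug gM] <-]|hY].
  have h : iso (QMod X^T M) (QMod (g *m X *m invmx g)^T M).
    by apply/iso_conjugate; exists g.
  have [sX [l [vl hl es]]] := hX; split; first exact: (skew_jordan_conjugate sM nd sX h).
  by exists l; split=> //; apply: iso_trans (iso_sym h) hl.
have /(parts_of_conjugate sqc hlam hX hY)/iso_conjugate[g hg e] : s = s by [].
by exists g.
Qed.

Lemma O_orbitsE :
  adj_orbits O S = [set [set X | parts X s] | s in [set s | s \in sols]]%classic.
Proof.
apply/seteqP; split=> [_ [X /nilp_orbit_pointsE sX <-]|_ [s /= ss <-]].
  have [s hs ss] := parts_of_exists sqc sM nd hw hlam sX.
  by exists s => //; apply/seteqP; split=> Y; rewrite /= (parts_ofE _ hs).
have [X hX] := parts_of_realized sqc sM nd hw hlam heven ss.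
exists X; first by apply/nilp_orbit_pointsE; case: hX.
by apply/seteqP; split=> Y; rewrite /= (parts_ofE _ hX).
Qed.

Lemma O_orbits_card : (adj_orbits O S #= `I_(size sols))%card.
Proof.
rewrite O_orbitsE; apply: (card_image_seq [::]) (uniq_witt_solutions _ _ _) _.
move=> s s' ss ss' e; have [X hX] := parts_of_realized sqc sM nd hw hlam heven ss.
have hX' : parts X s' by move: (hX); rewrite -[parts X s]/([set X | parts X s]%classic X) e.
by apply/(parts_of_conjugate sqc hlam hX hX'); apply: iso_refl.
Qed.

Lemma O_mul g h : O g -> O h -> O (g *m h).
Proof.
case=> ug gM [uh hM]; split; first by rewrite unitmx_mul ug.
by rewrite trmx_mul -!mulmxA (mulmxA M) (mulmxA g^T) (mulmxA g^T) gM mulmxA.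
Qed.

Lemma O_inv g : O g -> O (invmx g).
Proof.
case=> ug gM; split; first by rewrite unitmx_inv.
by rewrite -{1}gM !mulmxA -trmx_mul mulmxV // trmx1 mul1mx mulmxK.
Qed.

Lemma O_det g : O g -> \det g = 1 \/ \det g = -1.
Proof.
case=> ug gM; have := congr1 determinant gM; rewrite !det_mulmx det_tr mulrAC.
have dM : \det M != 0 by rewrite -unitfE -unitmxE.
rewrite -[RHS]mul1r => /(mulIf dM)/eqP; rewrite -expr2 sqrf_eq1.
by case/orP=> /eqP; [left|right].
Qed.

Lemma SO_mul g h : SO g -> SO h -> SO (g *m h).
Proof. by case=> Og dg [Oh dh]; split; [apply: O_mul | rewrite det_mulmx dg dh mulr1]. Qed.

Lemma SO_inv g : SO g -> SO (invmx g).
Proof. by case=> Og dg; split; [apply: O_inv | rewrite det_inv dg invr1]. Qed.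

Lemma SO_orbit_conj g X : SO g -> adj_orbit SO (g *m X *m invmx g) = adj_orbit SO X.
Proof.
move=> hg; have ug : g \in unitmx by case: hg => -[].
apply/seteqP; split=> _ [h hh <-].
  exists (h *m g); first exact: SO_mul.
  by have [[uh _] _] := hh; rewrite invmx_mul // !mulmxA.
exists (h *m invmx g); first exact: SO_mul (SO_inv hg).
have [[uh _] _] := hh; rewrite invmx_mul ?unitmx_inv // invmxK !mulmxA.
by rewrite !mulmxKV.
Qed.

Lemma SO_orbits_odd : odd_parts lam != [::] -> adj_orbits SO S = adj_orbits O S.
Proof.
move=> hodd; have E X : S X -> adj_orbit SO X = adj_orbit O X.
  move=> /nilp_orbit_pointsE sX.
  have [s [_ [l [vl hl _]]] _] := parts_of_exists sqc sM nd hw hlam sX.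
  have pl := parts_of_blocks hlam sX vl hl.
  have ho : has (fun p => odd p.1) l.
    case: (odd_parts lam) hodd (mem_odd_parts lam) => // d r _ /(_ d).
    rewrite mem_head => /esym/andP[od]; rewrite (perm_mem pl) => /flattenP[b /mapP[p lp ->]].
    case: ifP => op; first by move=> _; apply/hasP; exists p.
    by rewrite !inE orbb => /eqP e; rewrite e op in od.
  have [C [uC CX CM dC]] := iso_reflection hl ho.
  have hC : O C^T by split; rewrite ?unitmx_tr // trmxK.
  have CXC : C^T *m X *m invmx C^T = X.
    rewrite -[RHS](mulmxK (_ : C^T \in unitmx)) ?unitmx_tr //; congr (_ *m _).
    by apply: trmx_inj; rewrite !trmx_mul trmxK CX.
  apply/seteqP; split=> [Y [g [Og _] <-]|Y [g Og <-]]; first by exists g.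
  have [dg|dg] := O_det Og; first by exists g.
  exists (g *m C^T); first by split; [apply: O_mul | rewrite det_mulmx det_tr dg dC mulrNN mulr1].
  have [ug _] := Og; rewrite invmx_mul ?unitmx_tr // -[in RHS]CXC !mulmxA //.
by apply/seteqP; split=> _ [X SX <-]; exists X; rewrite ?E.
Qed.

(** Serves the partitions without odd parts when w is nonzero. *)
Lemma SO_orbits_empty : sols = [::] -> adj_orbits SO S = adj_orbits O S.
Proof.
move=> s0; suff S0 X : ~ S X by apply/seteqP; split=> Y [X /S0].
move=> /nilp_orbit_pointsE sX; have [s _] := parts_of_exists sqc sM nd hw hlam sX.
by rewrite s0.
Qed.

Lemma O_reflection : exists2 g, O g & \det g = -1.
Proof.
have nM : nondeg (QMod 0 M) by [].
have [s [s0 hs]] := nondeg_diagonal sqc nM.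
have ho : has (fun p => odd p.1) [seq (1%N, a) | a <- s].
  case: s s0 hs => [_ /iso_dim /= n0|a s _ _] //.
  by move: n_gt0; rewrite n0.
have [C [uC _ CM dC]] := iso_reflection hs ho.
by exists C^T; rewrite ?det_tr //; split; rewrite ?unitmx_tr // trmxK.
Qed.

Lemma SO_orbits_even : odd_parts lam = [::] -> w = w0 ->
  (adj_orbits SO S #= `I_2)%card.
Proof.
move=> hodd ew.
have solsE : sols = [:: [::]] by rewrite /part_mults hodd ew.
have [X0 hX0] : exists X, parts X [::].
  by apply: (parts_of_realized sqc sM nd hw hlam heven); rewrite solsE.
have [sX0 _] := hX0; have [g0 Og0 dg0] := O_reflection.
have ug0 : g0 \in unitmx by case: Og0.
pose X1 := g0 *m X0 *m invmx g0.
pose f (b : bool) := adj_orbit SO (if b then X1 else X0).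
have cent_det g : O g -> g *m X0 *m invmx g = X0 -> \det g = 1.
  move=> [ug gM] gX; rewrite -det_tr.
  apply: (@even_centralizer_det _ two0 (QMod X0^T M)) => /=.
  - exact: (skew_jordan_nilpotent sM nd sX0).
  - move=> l vl hl; apply/hasPn => p lp; apply/negP => op.
    have : p.1 \in odd_parts lam.
      rewrite mem_odd_parts op (perm_mem (parts_of_blocks hlam sX0 vl hl)).
      by apply/flattenP; exists [:: p.1]; rewrite ?inE //; apply/mapP; exists p; rewrite ?op.
    by rewrite hodd.
  - rewrite -!trmx_mul; congr trmx.
    by rewrite -[X in X *m _ = _]gX mulmxKV.
  - by rewrite trmxK.
have -> : adj_orbits SO S = [set f b | b in [set b | b \in [:: false; true]]]%classic.
  apply/seteqP; split=> [_ [X SX <-]|_ [b _ <-]].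
    have sX : skew_jordan M lam X by apply/nilp_orbit_pointsE.
    have [s hX] := parts_of_exists sqc sM nd hw hlam sX.
    rewrite solsE inE => /eqP es; rewrite es in hX.
    have /(parts_ofE X hX0)[g Og eX] := hX.
    have [dg|dg] := O_det Og.
      by exists false => //; rewrite /f -eX SO_orbit_conj.
    exists true => //; rewrite /f /X1 -eX.
    (* g and g0 both have determinant -1, so g g0^-1 lies in SO(q); it conjugates X1 to X. *)
    have h : SO (g *m invmx g0).
      split; first exact: O_mul Og (O_inv Og0).
      by rewrite det_mulmx det_inv dg dg0 invrN1 mulrNN mulr1.
    rewrite -(SO_orbit_conj _ h); congr (adj_orbit _ _).
    have ug : g \in unitmx by case: Og.
    by rewrite invmx_mul ?unitmx_inv // invmxK !mulmxA !mulmxKV.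
  exists (if b then X1 else X0) => //; apply/nilp_orbit_pointsE.
  case: b => //; have hX1 : adj_orbit O X0 X1 by exists g0.
  by have [] := (parts_ofE X1 hX0).1 hX1.
apply: (card_image_seq false) => // b b' _ _; rewrite /f.
(* If X1 = h X0 h^-1 with det h = 1, then h^-1 g0 centralizes X0 with determinant -1, against
   [cent_det]. *)
have ne : adj_orbit SO X1 <> adj_orbit SO X0.
  move=> e; have : adj_orbit SO X1 X1.
    exists 1%:M; last by rewrite invmx1 mulmx1 mul1mx.
    by split; [split; rewrite ?unitmx1 // trmx1 mul1mx mulmx1 | rewrite det1].
  rewrite e => -[h hh eh]; have [Oh dh] := hh.
  have uh : h \in unitmx by case: Oh.
  have := cent_det (invmx h *m g0) (O_mul (O_inv Oh) Og0).
  rewrite det_mulmx det_inv dh dg0 invr1 mul1r => H.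
  have /eqP : (-1 : k) = 1.
    apply: H; rewrite invmx_mul ?unitmx_inv // invmxK.
    transitivity (invmx h *m (g0 *m X0 *m invmx g0) *m h); first by rewrite !mulmxA.
    by rewrite -/X1 -eh !mulmxA mulVmx // mul1mx mulmxKV.
  by rewrite eq_sym -subr_eq0 opprK -(natrD _ 1 1) (negPf two0).
by case: b; case: b' => // e; case: ne; rewrite ?e // -e.
Qed.
End OrthogonalOrbits.

Theorem mainTheorem1 (k : fieldType) (v : k -> \bar int) (p : nat)
    (n n0 : nat) (q : 'cV[k]_n -> k) (lam : seq nat)
    (hk : nonarch_local_field v)
    (hp : residue_char v p) (hp2 : p <> 2%N)
    (hchar : char_zero_or_large k n)
    (hn : (0 < n)%N)
    (hq : quadratic_form q) (hnd : nondegenerate_qform q)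
    (hn0 : anisotropic_dim q n0)
    (hlam : is_partition n lam) (heven : even_parts_even_mult lam) :
  let T := T_count n0 (chi lam 1) (chi lam 2) (chi3plus lam) in
  has_card (adj_orbits (O_group q) (nilp_orbit_points q lam)) T /\
  has_card (adj_orbits (SO_group q) (nilp_orbit_points q lam))
    (if [&& chi lam 1 == 0%N, chi lam 2 == 0%N, chi3plus lam == 0%N
          & n0 == 0%N]
     then 2%:R else T).
Proof.
have [u [t [par sqc]]] := local_square_classes hk hp hp2.
have [w [hw en0]] := witt_of_anisotropic_dim sqc hq hnd hn0.
rewrite /= !chi_mults chi3plus_mults.
(* n exceeds [adim w] by twice a number of hyperbolic planes, and has the parity of the sum of the
   multiplicities. *)
have ow : odd (adim w) = odd (sumn (part_mults lam)).
  rewrite odd_sumn_mults; have [_ _ ->] := hlam.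
  have [s [s0 hs <-]] := hw; have [m hm] := ceq_canonical sqc s0.
  have -> : n = size s by rewrite -(qdim_dsum1 s) -(iso_dim hs).
  by rewrite (size_canonical hm) oddD odd_double addbF.
have eT := size_witt_solutions (nsqN1 k) (mults_neq0 lam) ow.
rewrite en0 in eT.
have cO := O_orbits_card sqc hnd hw hlam heven.
split; first by exists (size (witt_solutions (nsqN1 k) (part_mults lam) w)).
rewrite !andbA no_odd_parts; case: ifP => [/andP[/eqP hodd /eqP n00]|h].
  exists 2%N => //; apply: (SO_orbits_even sqc hnd hn hw hlam heven hodd).
  by apply: adim_eq0; rewrite en0.
exists (size (witt_solutions (nsqN1 k) (part_mults lam) w)) => //.
have [hodd|hodd] := eqVneq (odd_parts lam) [::]; last first.
  by rewrite (SO_orbits_odd sqc hnd hw hlam).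
(* Without odd parts the empty tuple has sum zero, so a nonzero w admits no solution. *)
rewrite (SO_orbits_empty sqc hnd hw hlam) //.
rewrite /part_mults hodd /= in h *; case: eqP => // ew.
by rewrite -en0 ew in h.
Qed.
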